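(* Let $f\in C(I,I)$ with $h(f)=0$ and $x<y$ in $I$. The following are equivalent: (1) $\langle x,y\rangle$ is $f$-nonseparable; (2) $\langle x,y\rangle$ is an IT-pair; (3) $\langle x,y\rangle$ is an IN-pair.
   Context: $I=[0,1]$, $C(I,I)$ continuous self-maps of $I$, $h(f)$ topological entropy, $\omega_f(x)$ the $\omega$-limit set of $x$. For subsets $A_1,A_2\subset I$, $J\subset\mathbb Z_+$ is an independence set for $(A_1,A_2)$ if for every nonempty finite $F\subset J$ and every $s\in\{1,2\}^F$, $\bigcap_{i\in F}f^{-i}A_{s(i)}\ne\emptyset$. $\langle x_1,x_2\rangle$ is an IT-pair (resp. IN-pair) if for all neighborhoods $U_1\ni x_1$, $U_2\ni x_2$, $(U_1,U_2)$ has an infinite independence set (resp. arbitrarily long finite independence sets). Periodic portion: for $h(f)=0$ and $\omega_f(z)$ infinite, $J_k^i=[\min\omega_{f^{2^k}}(f^i(z)),\max\omega_{f^{2^k}}(f^i(z))]$ for $k\ge1$, $0\le i<2^k$; for fixed $k$ pairwise disjoint, with $J_{k+1}^i\cup J_{k+1}^{2^k+i}\subset J_k^i$. A nested sequence is a choice of $i_k$ with $J_1^{i_1}\supset J_2^{i_2}\supset\cdots$. A pair $\langle u,v\rangle$, $u\ne v$, is $f$-nonseparable if for some $z$ with $\omega_f(z)$ infinite there is a nested sequence with $\bigcap_kJ_k^{i_k}=[u,v]$ or $[v,u]$. *)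

(* Defs.v *)
From Stdlib Require Import Reals Lra List.
Import ListNotations.
Open Scope R_scope.

Definition inI (x : R) : Prop := 0 <= x <= 1.

Definition iter (f : R -> R) (n : nat) (x : R) : R := Nat.iter n f x.

Definition self_map_I (f : R -> R) : Prop := forall x, inI x -> inI (f x).
Definition continuous_on_I (f : R -> R) : Prop :=
  forall x, inI x -> forall eps, eps > 0 -> exists delta, delta > 0 /\
    forall y, inI y -> Rabs (y - x) < delta -> Rabs (f y - f x) < eps.
Definition CII (f : R -> R) : Prop := self_map_I f /\ continuous_on_I f.

Definition separated (f : R -> R) (n : nat) (eps : R) (E : list R) : Prop :=
  NoDup E /\ (forall p, In p E -> inI p) /\
  (forall p q, In p E -> In q E -> p <> q ->
     exists j, (j < n)%nat /\ Rabs (iter f j p - iter f j q) > eps).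

(** h(f) = 0.  Since h(f) = lim_{eps->0} limsup_n (1/n) log s(n,eps) >= 0,
    where s(n,eps) is the maximal cardinality of an (n,eps)-separated set,
    h(f) = 0 unfolds to: for all eps>0 and delta>0, for n large enough
    every (n,eps)-separated set has at most exp(delta n) elements. *)
Definition zero_entropy (f : R -> R) : Prop :=
  forall eps delta, eps > 0 -> delta > 0 -> exists N : nat,
    forall n E, (n >= N)%nat -> separated f n eps E ->
      INR (length E) <= exp (delta * INR n).

Definition omega (g : R -> R) (x : R) (y : R) : Prop :=
  forall eps, eps > 0 -> forall N : nat, exists n, (n >= N)%nat /\
    Rabs (iter g n x - y) < eps.

Definition infinite_set (A : R -> Prop) : Prop :=
  forall l : list R, exists y, A y /\ ~ In y l.

(** J_k^i = [min ω_{f^{2^k}}(f^i z), max ω_{f^{2^k}}(f^i z)], written as the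
    convex hull of the (compact, nonempty) omega-limit set. *)
Definition Jint (f : R -> R) (z : R) (k i : nat) (t : R) : Prop :=
  exists a b, omega (iter f (2 ^ k)) (iter f i z) a /\
              omega (iter f (2 ^ k)) (iter f i z) b /\ a <= t <= b.

Definition nested_seq (f : R -> R) (z : R) (ik : nat -> nat) : Prop :=
  (forall k, (k >= 1)%nat -> (ik k < 2 ^ k)%nat) /\
  (forall k, (k >= 1)%nat -> forall t,
      Jint f z (S k) (ik (S k)) t -> Jint f z k (ik k) t).

Definition nonseparable (f : R -> R) (u v : R) : Prop :=
  u <> v /\
  exists z, inI z /\ infinite_set (omega f z) /\
    exists ik, nested_seq f z ik /\
      ((forall t, (forall k, (k >= 1)%nat -> Jint f z k (ik k) t) <-> u <= t <= v) \/
       (forall t, (forall k, (k >= 1)%nat -> Jint f z k (ik k) t) <-> v <= t <= u)).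

Definition independence_set (f : R -> R) (A1 A2 : R -> Prop) (J : nat -> Prop) : Prop :=
  forall (F : list nat) (s : nat -> bool), F <> [] -> (forall i, In i F -> J i) ->
    exists w, inI w /\
      forall i, In i F -> (if s i then A1 else A2) (iter f i w).

Definition nbhd (x : R) (U : R -> Prop) : Prop :=
  exists eps, eps > 0 /\ forall t, inI t -> Rabs (t - x) < eps -> U t.

Definition IT_pair (f : R -> R) (x1 x2 : R) : Prop :=
  forall U1 U2, nbhd x1 U1 -> nbhd x2 U2 ->
    exists J : nat -> Prop, (forall N, exists n, (n >= N)%nat /\ J n) /\
      independence_set f U1 U2 J.

Definition IN_pair (f : R -> R) (x1 x2 : R) : Prop :=
  forall U1 U2, nbhd x1 U1 -> nbhd x2 U2 -> forall m : nat,
    exists l : list nat, NoDup l /\ (length l >= m)%nat /\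
      independence_set f U1 U2 (fun i => In i l).

(* Main.v *)
Require Import Defs.
From Stdlib Require Import Reals Lra Lia List Arith Classical ClassicalEpsilon.
Import ListNotations.
Open Scope R_scope.

(** Zero entropy is used only through the absence of two loops at an interval passing
    through disjoint intervals: composing the loops in the two possible orders would give
    a horseshoe for an iterate. Hence an orbit that does not converge eventually jumps
    back and forth over a fixed point, staying at a positive distance from it; applied to
    [f^(2^k)] this separates the portions [J_k^i] of a fixed level.

    If [[x,y]] is the intersection of a nested sequence of portions, then for infinitely
    many [l] the sibling portion at level [l+1] is close to, say, [x] on the outer side.
    Odd multiples of [2^l] steps exchange the siblings, so neighbourhoods of both
    endpoints cover smaller neighbourhoods of both endpoints, and chaining these coverings
    yields an infinite independence set.

    Conversely, for an IN-pair the interval [[x,y]] contains no periodic point, and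
    cutting an interval of period [2^e] around it along the backward orbit of a fixed
    point of [f^(2^e)] outside [[x,y]] leaves a smaller interval around it, whose period
    is a larger power of two. Iterating this gives nested periodic intervals whose closures
    shrink to [[x,y]]. The required [z] is the midpoint of [[x,y]] if its returns to these
    intervals occur on both sides, and otherwise a point whose orbit follows a chain of
    shrinking neighbourhoods of one endpoint. *)

(** * Coverings, horseshoes and entropy *)

(** Coverings need points on definite sides of a target, whereas the hypotheses only give points
    near [x] and [y], possibly equal to an endpoint or on either side of it. Most case distinctions
    come from this: boxes outside or inside [[x,y]] in the forward direction, and in the converse
    extra entries in a pattern, chosen so that only points in the wanted position can realise it.
    Such entries cost nothing, since arbitrarily many times are available. A pigeonhole on residues
    moreover gives independence for every iterate, with gaps that outlast the time a given preimage
    takes to reach its fixed point.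

    Powers of two enter through alternation: an orbit of odd period cannot alternate, so a point of
    odd period is fixed, and three disjoint intervals of a cycle cannot share a point of their
    closures. Left and right are exchanged by conjugation with [1 - t], and maps are extended to the
    line by constants outside [I], so that continuity carries no domain conditions. *)

Lemma choice_function {A B : Type} (P : A -> B -> Prop) :
  (forall a, exists b, P a b) -> exists s : A -> B, forall a, P a (s a).
Proof.
  intros H. exists (fun a => proj1_sig (constructive_indefinite_description _ (H a))).
  intros a. apply proj2_sig.
Qed.

Lemma pos_min a b : 0 < a -> 0 < b -> exists e, 0 < e /\ e <= a /\ e <= b.
Proof.
  intros Ha Hb. exists (Rmin a b). split; [apply Rmin_pos; assumption|].
  split; [apply Rmin_l|apply Rmin_r].
Qed.

Lemma dependent_choice {A : Type} (P : A -> A -> Prop) (a0 : A) :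
  (forall a, exists b, P a b) -> exists s : nat -> A, s 0%nat = a0 /\ forall n, P (s n) (s (S n)).
Proof.
  intros H. destruct (choice_function P H) as [nxt Hn].
  exists (fun n => Nat.iter n nxt a0). split; [reflexivity|]. intros n. apply Hn.
Qed.

Lemma iter_S f n x : iter f (S n) x = f (iter f n x).
Proof. reflexivity. Qed.

Lemma iter_add f m n x : iter f (m + n) x = iter f m (iter f n x).
Proof. induction m as [|m IH]; [reflexivity|]. simpl Nat.add. rewrite !iter_S. congruence. Qed.

Lemma iter_mul f s n x : iter (iter f s) n x = iter f (s * n) x.
Proof.
  induction n as [|n IH].
  - rewrite Nat.mul_0_r. reflexivity.
  - rewrite iter_S, IH, Nat.mul_succ_r, (Nat.add_comm (s * n)), iter_add. reflexivity.
Qed.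

Lemma iter_succ_r f n x : iter f (S n) x = iter f n (f x).
Proof. rewrite <- Nat.add_1_r, iter_add. reflexivity. Qed.

Lemma iter_1 f x : iter f 1 x = f x.
Proof. reflexivity. Qed.

Lemma iter_fix f n p : f p = p -> iter f n p = p.
Proof. intros H; induction n as [|n IH]; [reflexivity|]. rewrite iter_S, IH; exact H. Qed.

Lemma iter_fix_ge f r n t p : f p = p -> iter f r t = p -> (r <= n)%nat -> iter f n t = p.
Proof.
  intros H H1 H2. replace n with ((n - r) + r)%nat by lia.
  rewrite iter_add, H1. apply iter_fix, H.
Qed.

Lemma iter_continuity f n : continuity f -> continuity (iter f n).
Proof.
  intros Hf; induction n as [|n IH].
  - exact (derivable_continuous _ derivable_id).
  - exact (continuity_comp (iter f n) f IH Hf).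
Qed.

Lemma ivt (f : R -> R) p q e :
  continuity f -> f p <= e <= f q ->
  exists w, Rmin p q <= w <= Rmax p q /\ f w = e.
Proof.
  intros Hf He.
  assert (Hc : forall k, continuity (fun t => k * (f t - e))).
  { intros k. apply continuity_mult; [apply continuity_const; intros ? ?; reflexivity|].
    apply continuity_minus; [exact Hf|apply continuity_const; intros ? ?; reflexivity]. }
  destruct (Rle_lt_dec p q) as [Hpq|Hpq].
  - destruct (IVT_cor _ p q (Hc 1) Hpq) as [w [Hw Hw']]; [nra|].
    exists w. rewrite Rmin_left, Rmax_right by lra. split; [exact Hw|lra].
  - destruct (IVT_cor _ q p (Hc 1)) as [w [Hw Hw']]; [lra|nra|].
    exists w. rewrite Rmin_right, Rmax_left by lra. split; [exact Hw|lra].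
Qed.

Lemma ivt_within (f : R -> R) a b p q e :
  continuity f -> a <= p <= b -> a <= q <= b -> f p <= e <= f q ->
  exists w, a <= w <= b /\ f w = e.
Proof.
  intros Hf Hp Hq He. destruct (ivt f p q e Hf He) as [w [[H1 H2] H3]].
  exists w; split; [|exact H3]. revert H1 H2.
  unfold Rmin, Rmax. destruct (Rle_dec p q); lra.
Qed.

(** Covering of [[c,d]] by the image of [[a,b]], witnessed by two points whose images lie beyond its
    ends. Two orbit points suffice to prove it, and the intermediate value theorem recovers
    preimages in [cov_point]. *)
Definition cov (f : R -> R) (n : nat) (a b c d : R) : Prop :=
  exists p q, a <= p <= b /\ a <= q <= b /\ iter f n p <= c /\ d <= iter f n q.

Lemma cov_point f n a b c d e :
  continuity f -> cov f n a b c d -> c <= e <= d -> exists w, a <= w <= b /\ iter f n w = e.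
Proof.
  intros Hf (p & q & Hp & Hq & H1 & H2) He.
  apply (ivt_within (iter f n) a b p q e); auto using iter_continuity; lra.
Qed.

Lemma cov_comp f n m a b c d u v :
  continuity f -> cov f n a b c d -> cov f m c d u v -> cov f (m + n) a b u v.
Proof.
  intros Hf H (p & q & Hp & Hq & H1 & H2).
  destruct (cov_point f n a b c d p Hf H Hp) as [p' [Hp' Ep]].
  destruct (cov_point f n a b c d q Hf H Hq) as [q' [Hq' Eq]].
  exists p', q'. rewrite !iter_add, Ep, Eq. auto.
Qed.

Lemma cov_sub f n a b c d a' b' c' d' :
  cov f n a b c d -> a' <= a -> b <= b' -> c <= c' -> d' <= d -> cov f n a' b' c' d'.
Proof. intros (p & q & Hp & Hq & H1 & H2) ? ? ? ?. exists p, q. repeat split; lra. Qed.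

(** Two loops at [[a,b]] through disjoint intervals: the two orders in which the
    loops can be composed give a horseshoe for an iterate. *)
Definition no_horseshoe (f : R -> R) : Prop :=
  forall a b c1 d1 c2 d2 n m1 m2, d1 < c2 ->
    cov f n a b c1 d1 -> cov f n a b c2 d2 ->
    cov f m1 c1 d1 a b -> cov f m2 c2 d2 a b -> False.

Section Entropy.
Variables (f : R -> R) (a b c1 d1 c2 d2 : R) (n m1 m2 : nat).
Hypothesis Hf : continuity f.
Hypothesis HI : forall t, inI (f t).
Hypothesis Hd : d1 < c2.
Hypothesis H1 : cov f n a b c1 d1.
Hypothesis H2 : cov f n a b c2 d2.
Hypothesis H3 : cov f m1 c1 d1 a b.
Hypothesis H4 : cov f m2 c2 d2 a b.

(** The time of both loops together is the same in either order, so that points with different codes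
    can be compared at equal times. *)
Let L := (n + m1 + (n + m2))%nat.

Let branch (s : bool) (w : R) :=
  if s then c1 <= iter f n w <= d1 else c2 <= iter f n w <= d2.

Lemma horseshoe_time_pos : (n < L)%nat.
Proof.
  (* If all times vanished, both disjoint intervals would contain [[a,b]]. *)
  destruct (Nat.eq_dec L 0) as [E|E]; [exfalso|unfold L in *; lia].
  assert (m1 = 0%nat /\ m2 = 0%nat) as [E1 E2] by (unfold L in E; lia).
  rewrite E1 in H3. rewrite E2 in H4.
  destruct H3 as (p & q & ? & ? & Hp & Hq), H4 as (p' & q' & ? & ? & Hp' & Hq').
  destruct H1 as (p1 & _ & ? & _).
  unfold iter in *; simpl in *. lra.
Qed.

Lemma horseshoe_branch s e : a <= e <= b ->
  exists w, a <= w <= b /\ branch s w /\ iter f L w = e.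
Proof.
  assert (K : forall c d c' d' m m',
    cov f n a b c d -> cov f n a b c' d' -> cov f m c d a b -> cov f m' c' d' a b ->
    a <= e <= b -> exists w, a <= w <= b /\ c <= iter f n w <= d /\
      iter f (m' + (n + (m + n))) w = e).
  { intros c d c' d' m m' A1 A2 A3 A4 He.
    destruct (cov_point f m' c' d' a b e Hf A4 He) as [y2 [Hy2 E2]].
    destruct (cov_point f n a b c' d' y2 Hf A2 Hy2) as [x1 [Hx1 E1]].
    destruct (cov_point f m c d a b x1 Hf A3 Hx1) as [y1 [Hy1 E1']].
    destruct (cov_point f n a b c d y1 Hf A1 Hy1) as [x0 [Hx0 E0]].
    exists x0. rewrite !iter_add, E0, E1', E1, E2. auto. }
  intros He. destruct s.
  - destruct (K c1 d1 c2 d2 m1 m2 H1 H2 H3 H4 He) as (w & ? & ? & E).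
    exists w. split; [assumption|split; [assumption|]].
    replace L with (m2 + (n + (m1 + n)))%nat by (unfold L; lia). exact E.
  - destruct (K c2 d2 c1 d1 m2 m1 H2 H1 H4 H3 He) as (w & ? & ? & E).
    exists w. split; [assumption|split; [assumption|]].
    replace L with (m1 + (n + (m2 + n)))%nat by (unfold L; lia). exact E.
Qed.

Lemma horseshoe_separated N : exists E, length E = (2 ^ N)%nat /\
  separated f (N * L) ((c2 - d1) / 2) E.
Proof.
  pose proof horseshoe_time_pos as HL.
  assert (Hab : a <= b) by (destruct H1 as (p & _ & ? & _); lra).
  assert (K : forall N, exists E, length E = (2 ^ N)%nat /\
    (forall p, In p E -> a <= p <= b) /\ NoDup E /\
    (forall p q, In p E -> In q E -> p <> q -> exists i, (i < N)%nat /\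
       Rabs (iter f (i * L + n) p - iter f (i * L + n) q) > (c2 - d1) / 2)).
  { clear N. induction N as [|N (E & HE1 & HE2 & HE3 & HE4)].
    - exists [a]. split; [reflexivity|]. split.
      + intros p [<-|[]]. lra.
      + split; [repeat constructor; intros []|].
        intros p q [<-|[]] [<-|[]]; congruence.
    (* A preimage picked by Hilbert's epsilon; it is meaningful for [e] in [[a,b]] only. *)
    - set (pre := fun s e => epsilon (inhabits 0)
        (fun w => a <= w <= b /\ branch s w /\ iter f L w = e)).
      assert (Hpre : forall s e, In e E ->
        a <= pre s e <= b /\ branch s (pre s e) /\ iter f L (pre s e) = e).
      { intros s e He. unfold pre. apply epsilon_spec.
        apply horseshoe_branch, HE2, He. }
      assert (Hnd : forall s, NoDup (map (pre s) E)).
      { intros s. apply NoDup_map_NoDup_ForallPairs; [|exact HE3].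
        intros x y Hx Hy Exy. destruct (Hpre s x Hx) as (_ & _ & E1).
        destruct (Hpre s y Hy) as (_ & _ & E2). congruence. }
      assert (Hfar : forall x y, In x E -> In y E ->
        Rabs (iter f n (pre true x) - iter f n (pre false y)) > (c2 - d1) / 2).
      { intros x y Hx Hy. destruct (Hpre true x Hx) as (_ & B1 & _).
        destruct (Hpre false y Hy) as (_ & B2 & _). simpl in B1, B2.
        rewrite Rabs_left; lra. }
      exists (map (pre true) E ++ map (pre false) E).
      split; [rewrite length_app, !length_map, HE1; simpl; lia|].
      split; [|split].
      + intros p Hp. apply in_app_or in Hp.
        destruct Hp as [Hp|Hp]; apply in_map_iff in Hp; destruct Hp as (e & <- & He);
          apply Hpre, He.
      + apply NoDup_app; auto.
        intros p Hp Hq. apply in_map_iff in Hp, Hq.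
        destruct Hp as (e & <- & He), Hq as (e' & Ee & He').
        specialize (Hfar e e' He He'). rewrite Ee, Rminus_diag, Rabs_R0 in Hfar. lra.
      + intros p q Hp Hq Hpq. apply in_app_or in Hp, Hq.
        assert (Step : forall s x y, In x E -> In y E -> pre s x <> pre s y ->
          exists i, (i < S N)%nat /\
            Rabs (iter f (i * L + n) (pre s x) - iter f (i * L + n) (pre s y)) > (c2 - d1) / 2).
        { intros s x y Hx Hy Hxy. assert (x <> y) as Hne by congruence.
          destruct (HE4 x y Hx Hy Hne) as (i & Hi & Hi').
          exists (S i). split; [lia|].
          replace (S i * L + n)%nat with ((i * L + n) + L)%nat by (simpl; lia).
          rewrite !(iter_add f _ L). destruct (Hpre s x Hx) as (_ & _ & ->).
          destruct (Hpre s y Hy) as (_ & _ & ->). exact Hi'. }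
        destruct Hp as [Hp|Hp], Hq as [Hq|Hq]; apply in_map_iff in Hp, Hq;
          destruct Hp as (e & <- & He), Hq as (e' & <- & He').
        * apply Step; auto.
        * exists 0%nat. split; [lia|]. apply Hfar; auto.
        * exists 0%nat. split; [lia|]. rewrite Rabs_minus_sym. apply Hfar; auto.
        * apply Step; auto. }
  (* Points of [[a,b]] need not lie in [I], but points of the form [f^L w] do. *)
  destruct (K N) as (E & HE1 & HE2 & HE3 & HE4).
  assert (HEI : forall p, In p E -> inI p).
  { intros p Hp. destruct (horseshoe_branch true p (HE2 p Hp)) as (w & _ & _ & <-).
    destruct L as [|L']; [lia|]. rewrite iter_S. apply HI. }
  exists E. split; [exact HE1|]. split; [exact HE3|]. split; [exact HEI|].
  intros p q Hp Hq Hpq. destruct (HE4 p q Hp Hq Hpq) as (i & Hi & Hi').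
  exists (i * L + n)%nat. split; [nia|exact Hi'].
Qed.

Lemma horseshoe_positive_entropy : ~ zero_entropy f.
Proof.
  intros HZ. pose proof horseshoe_time_pos as HL.
  assert (HLp : 0 < INR L) by (apply lt_0_INR; lia).
  assert (Hln : 0 < ln 2) by (rewrite <- ln_1; apply ln_increasing; lra).
  (* With this rate the entropy bound would read [2^(N+1) <= 2^((N+1)/2)]. *)
  destruct (HZ ((c2 - d1) / 2) (ln 2 / (2 * INR L))) as [N HN]; [lra| |].
  { apply Rdiv_lt_0_compat; lra. }
  destruct (horseshoe_separated (S N)) as (E & HE1 & HE3).
  assert (HN' : (S N * L >= N)%nat) by nia.
  specialize (HN _ E HN' HE3). rewrite HE1, pow_INR, mult_INR in HN.
  replace (ln 2 / (2 * INR L) * (INR (S N) * INR L)) with (INR (S N) * (ln 2 / 2)) in HN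
    by (field; lra).
  assert (HS : 0 < INR (S N)) by (apply lt_0_INR; lia).
  replace (INR 2 ^ S N) with (exp (INR (S N) * ln 2)) in HN.
  - assert (exp (INR (S N) * (ln 2 / 2)) < exp (INR (S N) * ln 2)) by (apply exp_increasing; nra).
    lra.
  - replace (INR 2) with 2 by (simpl; lra).
    rewrite <- (Rpower_pow (S N) 2) by lra. reflexivity.
Qed.
End Entropy.

Lemma zero_entropy_no_horseshoe f :
  continuity f -> (forall t, inI (f t)) -> zero_entropy f -> no_horseshoe f.
Proof.
  intros Hf HI HZ a b c1 d1 c2 d2 n m1 m2 Hd H1 H2 H3 H4.
  exact (horseshoe_positive_entropy f a b c1 d1 c2 d2 n m1 m2 Hf HI Hd H1 H2 H3 H4 HZ).
Qed.

(** Maps of the whole line with values in [I]; [extend] turns a self-map of [I] into one of them. *)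
Definition tame (f : R -> R) : Prop :=
  continuity f /\ (forall t, inI (f t)) /\ no_horseshoe f.

(** Conjugation by the reflection of [I], from which every one-sided statement gets its mirror
    image. *)
Definition refl (f : R -> R) (t : R) : R := 1 - f (1 - t).

Lemma iter_refl f n t : iter (refl f) n t = 1 - iter f n (1 - t).
Proof.
  induction n as [|n IH]; [unfold iter; simpl; lra|].
  rewrite !iter_S, IH. unfold refl. do 2 f_equal. lra.
Qed.

Lemma cov_refl f n a b c d : cov (refl f) n a b c d -> cov f n (1 - b) (1 - a) (1 - d) (1 - c).
Proof.
  intros (p & q & Hp & Hq & H1 & H2). rewrite iter_refl in H1, H2.
  exists (1 - q), (1 - p). repeat split; lra.
Qed.

Lemma continuity_refl f : continuity f -> continuity (refl f).
Proof.
  intros Hf. unfold refl.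
  assert (H1 : continuity (fun t => 1 - t)).
  { apply continuity_minus; [apply continuity_const; intros ? ?; reflexivity|].
    exact (derivable_continuous _ derivable_id). }
  exact (continuity_comp (fun t => f (1 - t)) (fun t => 1 - t)
    (continuity_comp (fun t => 1 - t) f H1 Hf) H1).
Qed.

Lemma tame_refl f : tame f -> tame (refl f).
Proof.
  intros (Hf & HI & HN). split; [apply continuity_refl, Hf|]. split.
  - intros t. unfold refl. specialize (HI (1 - t)). unfold inI in *. lra.
  - intros a b c1 d1 c2 d2 n m1 m2 Hd H1 H2 H3 H4. apply cov_refl in H1, H2, H3, H4.
    apply (HN (1 - b) (1 - a) (1 - d2) (1 - c2) (1 - d1) (1 - c1) n m2 m1); auto. lra.
Qed.

Lemma tame_iter f s : (0 < s)%nat -> tame f -> tame (iter f s).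
Proof.
  intros Hs (Hf & HI & HN). split; [apply iter_continuity, Hf|]. split.
  - intros t. destruct s as [|s]; [lia|]. rewrite iter_S. apply HI.
  - assert (K : forall n a b c d, cov (iter f s) n a b c d -> cov f (s * n) a b c d).
    { intros n a b c d (p & q & H). rewrite !iter_mul in H. exists p, q. exact H. }
    intros a b c1 d1 c2 d2 n m1 m2 Hd H1 H2 H3 H4.
    eapply (HN a b c1 d1 c2 d2); eauto.
Qed.

Lemma tame_iter_inI f n t : tame f -> inI t -> inI (iter f n t).
Proof. intros (_ & HI & _) Ht. destruct n; [exact Ht|]. apply HI. Qed.

(** The intervals [[a,c]] and [[c,b]] share [c], so they are shrunk to be disjoint. With [s1] and
    [s2] mapped to [c], the second iterate of [g] stretches [[a',s1]] and [[s2,b']] over [[a,b]],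
    and [s1 < c' <= c <= c'' < s2]. *)
Lemma weak_horseshoe f n a c b :
  tame f -> a < c < b -> b <= iter f n a -> iter f n c <= a -> b <= iter f n b -> False.
Proof.
  intros (Hf & _ & HN) Hc Ha Hm Hb.
  pose proof (iter_continuity f n Hf) as Hg.
  set (g := iter f n) in *.
  destruct (ivt_within g a c c a b Hg) as (a' & Ha' & Ea'); [lra|lra|lra|].
  destruct (ivt_within g a' c c a' a Hg) as (c' & Hc' & Ec'); [lra|lra|lra|].
  destruct (ivt_within g c b c b b Hg) as (b' & Hb' & Eb'); [lra|lra|lra|].
  destruct (ivt_within g c b' c b' a Hg) as (c'' & Hc'' & Ec''); [lra|lra|lra|].
  destruct (ivt_within g a' c' c' a' c Hg) as (s1 & Hs1 & Es1); [lra|lra|lra|].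
  destruct (ivt_within g c'' b' c'' b' c Hg) as (s2 & Hs2 & Es2); [lra|lra|lra|].
  assert (s1 <> c') by (intros ->; lra). assert (s2 <> c'') by (intros ->; lra).
  assert (I2 : forall t, iter f (n + n) t = g (g t)) by (intros; apply iter_add).
  apply (HN a b a' s1 s2 b' 0%nat (n + n)%nat (n + n)%nat); [lra| | | |].
  - exists a, b. unfold iter; simpl. repeat split; lra.
  - exists a, b. unfold iter; simpl. repeat split; lra.
  - exists s1, a'. rewrite !I2, Es1, Ea'. repeat split; lra.
  - exists s2, b'. rewrite !I2, Es2, Eb'. repeat split; lra.
Qed.

Lemma weak_horseshoe_refl f n a c b :
  tame f -> a < c < b -> iter f n a <= a -> b <= iter f n c -> iter f n b <= a -> False.
Proof.
  intros H Hc Ha Hm Hb.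
  apply (weak_horseshoe (refl f) n (1 - b) (1 - c) (1 - a)); [apply tame_refl, H|lra|..];
    rewrite iter_refl; ring_simplify (1 - (1 - a)) (1 - (1 - b)) (1 - (1 - c)); lra.
Qed.

(** At time [n] both [t] and [p] are at [p], so if [c] had come down to [t], the three points would
    form a [weak_horseshoe]. *)
Lemma trap_left f p t c r n :
  tame f -> f p = p -> t < c < p -> iter f r t = p -> (r <= n)%nat -> t < iter f n c.
Proof.
  intros H Hp Hc Ht Hr. apply Rnot_le_lt. intros Hle.
  apply (weak_horseshoe f n t c p); auto.
  - rewrite (iter_fix_ge f r n t p); auto; lra.
  - rewrite iter_fix; auto; lra.
Qed.

Lemma trap_right f p t c r n :
  tame f -> f p = p -> p < c < t -> iter f r t = p -> (r <= n)%nat -> iter f n c < t.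
Proof.
  intros H Hp Hc Ht Hr. apply Rnot_le_lt. intros Hle.
  apply (weak_horseshoe_refl f n p c t); auto.
  - rewrite iter_fix; auto; lra.
  - rewrite (iter_fix_ge f r n t p); auto; lra.
Qed.

(** * Fixed points and limit points of orbits *)

Lemma continuity_eps f x eps : continuity f -> 0 < eps ->
  exists delta, 0 < delta /\ forall y, Rabs (y - x) < delta -> Rabs (f y - f x) < eps.
Proof.
  intros Hf He. destruct (Hf x eps He) as (d & Hd & H). exists d. split; [exact Hd|].
  intros y Hy. destruct (Req_dec x y) as [<-|Hne].
  - rewrite Rminus_diag, Rabs_R0. exact He.
  - apply (H y). split; [|exact Hy]. split; [exact I|exact Hne].
Qed.

Lemma first_crossing g z a b :
  continuity g -> a <= b -> z < g a -> g b <= z ->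
  exists e, a < e <= b /\ g e = z /\ forall t, a <= t < e -> z < g t.
Proof.
  intros Hg Hab Ha Hb.
  set (E := fun t => a <= t <= b /\ forall s, a <= s <= t -> z < g s).
  assert (HEa : E a). { split; [lra|]. intros s Hs. replace s with a by lra. exact Ha. }
  destruct (completeness E) as [e [He1 He2]].
  { exists b. intros t [Ht _]. lra. }
  { exists a. exact HEa. }
  assert (Hae : a <= e) by (apply He1, HEa).
  assert (Heb : e <= b) by (apply He2; intros t [Ht _]; lra).
  assert (Hlt : forall t, a <= t < e -> z < g t).
  { intros t Ht. destruct (Rlt_or_le z (g t)) as [|Hn]; [assumption|exfalso].
    assert (e <= t); [|lra]. apply He2. intros s [Hs Hs'].
    destruct (Rle_or_lt s t) as [|Hts]; [assumption|].
    specialize (Hs' t ltac:(lra)). lra. }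
  assert (Hge : z <= g e).
  { apply Rnot_lt_le. intros Hn.
    destruct (continuity_eps g e (z - g e) Hg) as (d & Hd & H); [lra|].
    assert (a < e) by (destruct (Req_dec a e) as [->|]; lra).
    set (t := Rmax a (e - d / 2)).
    assert (Ht : a <= t < e /\ e - d < t) by (unfold t, Rmax; destruct Rle_dec; lra).
    specialize (Hlt t (proj1 Ht)). specialize (H t). rewrite Rabs_left in H by lra.
    specialize (H ltac:(lra)). apply Rabs_def2 in H. lra. }
  assert (Hle : g e <= z).
  { apply Rnot_lt_le. intros Hn.
    destruct (Req_dec e b) as [->|Hne]; [lra|].
    destruct (continuity_eps g e (g e - z) Hg) as (d & Hd & H); [lra|].
    set (t := Rmin b (e + d / 2)).
    assert (Ht : e < t <= b /\ t < e + d) by (unfold t, Rmin; destruct Rle_dec; lra).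
    assert (t <= e); [|lra]. apply He1. split; [lra|]. intros s Hs.
    destruct (Rlt_or_le s e) as [Hse|Hse]; [apply Hlt; lra|].
    specialize (H s). rewrite Rabs_right in H by lra. specialize (H ltac:(lra)).
    apply Rabs_def2 in H. lra. }
  exists e. assert (a <> e) by (intros ->; lra).
  split; [lra|split; [lra|exact Hlt]].
Qed.

Lemma last_fixed_below g a b :
  continuity g -> a <= b -> g a <= a -> b < g b ->
  exists z, a <= z < b /\ g z = z /\ forall t, z < t <= b -> t < g t.
Proof.
  intros Hg Hab Ha Hb.
  set (k := fun t => g (- t) + t).
  assert (Hk : continuity k).
  { apply continuity_plus; [|exact (derivable_continuous _ derivable_id)].
    exact (continuity_comp (fun t => - t) g
      (continuity_opp _ (derivable_continuous _ derivable_id)) Hg). }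
  destruct (first_crossing k 0 (- b) (- a) Hk) as (e & He & Ee & H); unfold k in *;
    rewrite ?Ropp_involutive; try lra.
  exists (- e). split; [lra|]. split; [lra|]. intros t Ht.
  specialize (H (- t) ltac:(lra)). rewrite Ropp_involutive in H. lra.
Qed.

Lemma first_fixed_above g a b :
  continuity g -> a <= b -> a < g a -> g b <= b ->
  exists z, a < z <= b /\ g z = z /\ forall t, a <= t < z -> t < g t.
Proof.
  intros Hg Hab Ha Hb.
  set (k := fun t => g t - t).
  assert (Hk : continuity k).
  { apply continuity_minus; [exact Hg|exact (derivable_continuous _ derivable_id)]. }
  destruct (first_crossing k 0 a b Hk) as (e & He & Ee & H); unfold k in *; try lra.
  exists e. split; [lra|]. split; [lra|]. intros t Ht. specialize (H t Ht). lra.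
Qed.

Lemma first_index_gen (P : nat -> Prop) k : ~ P 0%nat -> P k -> exists i, (i < k)%nat /\ P (S i) /\
  forall j, (j <= i)%nat -> ~ P j.
Proof.
  intros H0. induction k as [k IH] using lt_wf_ind. intros Hk.
  destruct k as [|k]; [contradiction|].
  destruct (classic (exists j, (j <= k)%nat /\ P j)) as [(j & Hj & Pj)|Hn].
  - destruct (IH j ltac:(lia) Pj) as (i & Hi & Hi'). exists i. split; [lia|exact Hi'].
  - exists k. split; [lia|]. split; [exact Hk|]. intros j Hj Pj. apply Hn. eauto.
Qed.

(** Consider the first fall to or below [z]. It starts from a point [b > a], and the first preimage
    [e] of [z] in [(a,b]] must have been jumped over from some orbit point in [(z,e)]. That point,
    [z] and [e] form a weak horseshoe for [g] itself. *)
Lemma no_return_below_fixed g z a k :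
  tame g -> g z = z -> z < a -> (forall t, z < t <= a -> t < g t) -> z < iter g k a.
Proof.
  intros Hg Hz Ha Hup. apply Rnot_le_lt. intros Hk. pose proof (proj1 Hg) as Hc.
  destruct (first_index_gen (fun i => iter g i a <= z) k) as (i & _ & Hi & Hj);
    [unfold iter; simpl; lra|exact Hk|].
  rewrite iter_S in Hi. set (b := iter g i a) in *.
  assert (Hb : z < b) by (apply Rnot_le_lt, (Hj i); lia).
  assert (Hab : a < b). { apply Rnot_le_lt. intros Hle. specialize (Hup b ltac:(lra)). lra. }
  pose proof (Hup a ltac:(lra)) as Hga.
  destruct (first_crossing g z a b Hc) as (e & He & Ee & Hlt); [lra..|].
  assert (Hi' : (i > 0)%nat) by (destruct i; [unfold b, iter in Hab; simpl in Hab; lra|lia]).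
  destruct (first_index_gen (fun j => e <= iter g j a) i) as (j & Hji & Hj1 & Hj2);
    [unfold iter; simpl; lra|change (iter g i a) with b; lra|].
  rewrite iter_S in Hj1.
  assert (z < iter g j a < e).
  { split; [apply Rnot_le_lt, (Hj j); lia|apply Rnot_le_lt, (Hj2 j); lia]. }
  apply (weak_horseshoe_refl g 1 z (iter g j a) e Hg); rewrite ?iter_1; lra.
Qed.

Lemma no_return_above_fixed g z a k :
  tame g -> g z = z -> a < z -> (forall t, a <= t < z -> g t < t) -> iter g k a < z.
Proof.
  intros Hg Hz Ha Hd.
  pose proof (no_return_below_fixed (refl g) (1 - z) (1 - a) k (tame_refl g Hg)) as H.
  rewrite iter_refl in H. ring_simplify (1 - (1 - a)) in H. unfold refl in H.
  assert (1 - z < 1 - iter g k a); [|lra]. apply H.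
  - replace (1 - (1 - z)) with z by lra. lra.
  - lra.
  - intros t Ht. specialize (Hd (1 - t) ltac:(lra)). lra.
Qed.

(** In the wrong order the two points would have a fixed point between them which the earlier of the
    two cannot pass, by the no-return lemmas. *)
Lemma ups_before_downs g z i j :
  tame g -> iter g i z < iter g (S i) z -> iter g (S j) z < iter g j z ->
  iter g i z < iter g j z.
Proof.
  intros Hg Hi Hj. rewrite iter_S in Hi, Hj. pose proof (proj1 Hg) as Hc.
  apply Rnot_le_lt. intros Hle.
  assert (iter g j z <> iter g i z) by (intros E; rewrite E in Hj; lra).
  destruct (Nat.le_gt_cases i j) as [Hij|Hij].
  - destruct (last_fixed_below g (iter g j z) (iter g i z) Hc) as (w & Hw & Ew & H'); [lra..|].
    pose proof (no_return_below_fixed g w (iter g i z) (j - i) Hg Ew ltac:(lra) H') as K.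
    rewrite <- iter_add in K. replace (j - i + i)%nat with j in K by lia. lra.
  - destruct (last_fixed_below (refl g) (1 - iter g i z) (1 - iter g j z)) as (w & Hw & Ew & H');
      [apply continuity_refl, Hc|lra|..].
    1,2: unfold refl; ring_simplify (1 - (1 - iter g i z)) (1 - (1 - iter g j z)); lra.
    assert (Ew' : g (1 - w) = 1 - w) by (unfold refl in Ew; lra).
    pose proof (no_return_above_fixed g (1 - w) (iter g j z) (i - j) Hg Ew' ltac:(lra)) as K.
    rewrite <- iter_add in K. replace (i - j + j)%nat with i in K by lia.
    assert (iter g i z < 1 - w); [|lra]. apply K. intros t Ht.
    specialize (H' (1 - t) ltac:(lra)). unfold refl in H'.
    replace (1 - (1 - t)) with t in H' by lra. lra.
Qed.

(** Cluster values, in the same shape as [omega], so that the two notions are convertible along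
    orbits. *)
Definition climit (s : nat -> R) (a : R) : Prop :=
  forall eps, eps > 0 -> forall N : nat, exists n, (n >= N)%nat /\ Rabs (s n - a) < eps.

Lemma climit_exists (s : nat -> R) a b : (forall N, exists n, (n >= N)%nat /\ a <= s n <= b) ->
  exists l, climit s l /\ a <= l <= b.
Proof.
  intros H.
  destruct (choice_function _ H) as [phi Hphi].
  destruct (Bolzano_Weierstrass (fun N => s (phi N)) (fun t => a <= t <= b)) as [l Hl].
  { apply compact_P3. }
  { intros N. apply Hphi. }
  assert (Hcl : climit s l).
  { intros eps He N. destruct (Hl (fun t => Rabs (t - l) < eps) N) as (p & Hp & Hp').
    - exists (mkposreal eps He). intros t Ht. exact Ht.
    - exists (phi p). split; [|exact Hp']. destruct (Hphi p). lia. }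
  exists l. split; [exact Hcl|].
  assert (K : forall eps, eps > 0 -> a - eps <= l <= b + eps).
  { intros eps He. destruct (Hl (fun t => Rabs (t - l) < eps) 0%nat) as (p & _ & Hp').
    - exists (mkposreal eps He). intros t Ht. exact Ht.
    - destruct (Hphi p) as [_ Hp]. apply Rabs_def2 in Hp'. lra. }
  split; apply Rnot_lt_le; intros Hn.
  - specialize (K ((a - l) / 2) ltac:(lra)). lra.
  - specialize (K ((l - b) / 2) ltac:(lra)). lra.
Qed.

Lemma climit_le s a c : climit s a -> (exists N, forall n, (n >= N)%nat -> s n <= c) -> a <= c.
Proof.
  intros Ha [N HN]. apply Rnot_lt_le. intros Hc.
  destruct (Ha (a - c) ltac:(lra) N) as (n & Hn & Hn'). specialize (HN n Hn).
  apply Rabs_def2 in Hn'. lra.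
Qed.

Lemma climit_ge s a c : climit s a -> (exists N, forall n, (n >= N)%nat -> c <= s n) -> c <= a.
Proof.
  intros Ha [N HN]. apply Rnot_lt_le. intros Hc.
  destruct (Ha (c - a) ltac:(lra) N) as (n & Hn & Hn'). specialize (HN n Hn).
  apply Rabs_def2 in Hn'. lra.
Qed.

Lemma climit_image g z a : continuity g -> climit (fun n => iter g n z) a ->
  climit (fun n => iter g n z) (g a).
Proof.
  intros Hg Ha eps He N.
  destruct (continuity_eps g a eps Hg He) as (d & Hd & H).
  destruct (Ha d Hd N) as (n & Hn & Hn'). exists (S n). split; [lia|].
  rewrite iter_S. apply H, Hn'.
Qed.

Lemma seq_limit_value g (s : nat -> R) a c :
  continuity g -> (forall eps, eps > 0 -> forall N, exists n, (n >= N)%nat /\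
     Rabs (s n - a) < eps /\ Rabs (g (s n) - c) < eps) -> g a = c.
Proof.
  intros Hg H. apply NNPP. intros Hne.
  set (e := Rabs (g a - c) / 2).
  assert (He : 0 < e). { unfold e. assert (0 < Rabs (g a - c)) by (apply Rabs_pos_lt; lra). lra. }
  destruct (continuity_eps g a e Hg He) as (d & Hd & H').
  destruct (pos_min d e Hd He) as (r & Hr & Hrd & Hre).
  destruct (H r Hr 0%nat) as (n & _ & H1 & H2).
  specialize (H' (s n) ltac:(lra)).
  assert (Rabs (g a - c) <= Rabs (g (s n) - g a) + Rabs (g (s n) - c)).
  { replace (g a - c) with (- (g (s n) - g a) + (g (s n) - c)) by lra.
    eapply Rle_trans; [apply Rabs_triang|]. rewrite Rabs_Ropp. lra. }
  unfold e in *. lra.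
Qed.

Lemma climit_preimage g z a b c : continuity g ->
  (forall eps, eps > 0 -> forall N, exists n, (n >= N)%nat /\ a <= iter g n z <= b /\
     Rabs (iter g (S n) z - c) < eps) ->
  exists s, climit (fun n => iter g n z) s /\ a <= s <= b /\ g s = c.
Proof.
  intros Hg H.
  destruct (choice_function _
    (fun N => H (/ INR (S N)) ltac:(apply Rinv_0_lt_compat, lt_0_INR; lia) N)) as [phi Hphi].
  destruct (climit_exists (fun N => iter g (phi N) z) a b) as (l & Hl & Hl').
  { intros N. exists N. split; [lia|apply Hphi]. }
  exists l. split; [|split; [exact Hl'|]].
  - intros eps He N. destruct (Hl eps He N) as (n & Hn & Hn').
    exists (phi n). split; [destruct (Hphi n); lia|exact Hn'].
  - apply (seq_limit_value g (fun N => iter g (phi N) z) l c Hg).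
    intros eps He N.
    destruct (archimed_cor1 eps He) as (N' & HN' & HN'').
    destruct (Hl eps He (N + N')%nat) as (n & Hn & Hn').
    exists n. split; [lia|]. split; [exact Hn'|].
    destruct (Hphi n) as (_ & _ & K). rewrite iter_S in K.
    eapply Rlt_trans; [exact K|]. eapply Rle_lt_trans; [|exact HN'].
    apply Rinv_le_contravar; [apply lt_0_INR; lia|apply le_INR; lia].
Qed.

Lemma climit_refl g z a : climit (fun n => iter g n z) a ->
  climit (fun n => iter (refl g) n (1 - z)) (1 - a).
Proof.
  intros Ha eps He N. destruct (Ha eps He N) as (n & Hn & Hn'). exists n. split; [exact Hn|].
  rewrite iter_refl. replace (1 - (1 - z)) with z by lra.
  replace (1 - iter g n z - (1 - a)) with (- (iter g n z - a)) by lra.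
  rewrite Rabs_Ropp. exact Hn'.
Qed.

Definition converges (s : nat -> R) : Prop := exists l, Un_cv s l.

Lemma converges_refl g z :
  converges (fun n => iter (refl g) n z) -> converges (fun n => iter g n (1 - z)).
Proof.
  intros [l Hl]. exists (1 - l). intros eps He. destruct (Hl eps He) as [N HN].
  exists N. intros n Hn. specialize (HN n Hn). rewrite iter_refl in HN. unfold Rdist in *.
  replace (iter g n (1 - z) - (1 - l)) with (- (1 - iter g n (1 - z) - l)) by lra.
  rewrite Rabs_Ropp. exact HN.
Qed.

Lemma eventually_increasing_converges g z N :
  tame g -> inI z -> (forall n, (n >= N)%nat -> iter g n z <= iter g (S n) z) ->
  converges (fun n => iter g n z).
Proof.
  intros Hg Hz H.
  destruct (Un_cv_crit (fun n => iter g (n + N) z)) as [l Hl].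
  - intros n. apply (H (n + N)%nat). lia.
  - exists 1. intros t [n ->]. apply (tame_iter_inI g (n + N) z Hg Hz).
  - exists l. intros eps He. destruct (Hl eps He) as [N' HN']. exists (N + N')%nat.
    intros n Hn. specialize (HN' (n - N)%nat ltac:(lia)).
    replace (n - N + N)%nat with n in HN' by lia. exact HN'.
Qed.

Lemma eventually_decreasing_converges g z N :
  tame g -> inI z -> (forall n, (n >= N)%nat -> iter g (S n) z <= iter g n z) ->
  converges (fun n => iter g n z).
Proof.
  intros Hg Hz H.
  destruct (eventually_increasing_converges (refl g) (1 - z) N (tame_refl g Hg)) as [l Hl].
  - unfold inI in *; lra.
  - intros n Hn. rewrite !iter_refl. replace (1 - (1 - z)) with z by lra.
    specialize (H n Hn). lra.
  - pose proof (converges_refl g (1 - z) (ex_intro _ l Hl)) as K.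
    replace (1 - (1 - z)) with z in K by lra. exact K.
Qed.

(** * Nonconvergent orbits alternate around a fixed point *)

Definition om (g : R -> R) (z a : R) : Prop := climit (fun n => iter g n z) a.

Lemma om_bounds g z a : tame g -> inI z -> om g z a -> inI a.
Proof.
  intros Hg Hz Ha. split.
  - apply (climit_ge _ _ 0 Ha). exists 0%nat. intros n _. apply (tame_iter_inI g n z Hg Hz).
  - apply (climit_le _ _ 1 Ha). exists 0%nat. intros n _. apply (tame_iter_inI g n z Hg Hz).
Qed.

Lemma om_preimage g z a : tame g -> inI z -> om g z a -> exists b, om g z b /\ g b = a.
Proof.
  intros Hg Hz Ha.
  destruct (climit_preimage g z 0 1 a (proj1 Hg)) as (s & Hs & _ & E); [|eauto].
  intros eps He N. destruct (Ha eps He (S N)) as (n & Hn & Hn').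
  destruct n as [|n]; [lia|]. exists n. split; [lia|]. split; [|exact Hn'].
  apply (tame_iter_inI g n z Hg Hz).
Qed.

Lemma om_pair g z a b a' b' : tame g ->
  (forall N, exists n, (n >= N)%nat /\ a <= iter g n z <= b /\ a' <= iter g (S n) z <= b') ->
  exists c, om g z c /\ a <= c <= b /\ a' <= g c <= b'.
Proof.
  intros Hg H.
  destruct (choice_function _ H) as [phi Hphi].
  destruct (climit_exists (fun N => iter g (phi N) z) a b) as (c & Hc & Hc').
  { intros N. exists N. split; [lia|apply Hphi]. }
  exists c. split; [|split; [exact Hc'|]].
  - intros eps He N. destruct (Hc eps He N) as (n & Hn & Hn'). exists (phi n).
    split; [destruct (Hphi n); lia|exact Hn'].
  - assert (K : climit (fun N => g (iter g (phi N) z)) (g c)).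
    { intros eps He N. destruct (continuity_eps g c eps (proj1 Hg) He) as (d & Hd & H').
      destruct (Hc d Hd N) as (n & Hn & Hn'). exists n. split; [exact Hn|apply H', Hn']. }
    split.
    + apply (climit_ge _ _ a' K). exists 0%nat. intros n _.
      destruct (Hphi n) as (_ & _ & E). rewrite iter_S in E. apply E.
    + apply (climit_le _ _ b' K). exists 0%nat. intros n _.
      destruct (Hphi n) as (_ & _ & E). rewrite iter_S in E. apply E.
Qed.

(** The fixed point [p] separates the points of a nonconvergent orbit that move up from those that
    move down. *)
Record splits (g : R -> R) (z p : R) : Prop := {
  sp_tame : tame g;
  sp_inI : inI z;
  sp_div : ~ converges (fun n => iter g n z);
  sp_fix : g p = p;
  sp_split : forall n, (iter g n z < p /\ iter g n z < iter g (S n) z) \/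
                       (p < iter g n z /\ iter g (S n) z < iter g n z)
}.
Arguments sp_tame {g z p}.
Arguments sp_inI {g z p}.
Arguments sp_div {g z p}.
Arguments sp_fix {g z p}.
Arguments sp_split {g z p}.

Lemma splits_refl g z p : splits g z p -> splits (refl g) (1 - z) (1 - p).
Proof.
  intros [H1 H2 H3 H4 H5]. split.
  - apply tame_refl, H1.
  - unfold inI in *; lra.
  - intros Hc. apply H3. apply converges_refl in Hc.
    replace (1 - (1 - z)) with z in Hc by lra. exact Hc.
  - unfold refl. replace (1 - (1 - p)) with p by lra. lra.
  - intros n. rewrite !iter_refl. replace (1 - (1 - z)) with z by lra.
    destruct (H5 n); [right|left]; lra.
Qed.
Arguments splits_refl {g z p}.

Lemma om_refl g z a : om g z a -> om (refl g) (1 - z) (1 - a).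
Proof. apply climit_refl. Qed.
Arguments om_refl {g z a}.

Lemma orbit_not_fixed g z n : ~ converges (fun n => iter g n z) -> g (iter g n z) <> iter g n z.
Proof.
  intros H E. apply H. exists (iter g n z). intros eps He. exists n. intros m Hm.
  replace m with ((m - n) + n)%nat by lia. rewrite iter_add, (iter_fix g _ _ E).
  unfold Rdist. rewrite Rminus_diag, Rabs_R0. exact He.
Qed.

(** The supremum [l] of the points moving up satisfies [l <= g l]. If it is not fixed, the first
    fixed point above it serves, because all points in between move up and so none of them is an
    orbit point moving down. *)
Lemma splits_exists g z : tame g -> inI z -> ~ converges (fun n => iter g n z) ->
  exists p, splits g z p.
Proof.
  intros Hg Hz Hdiv.
  assert (Hnf := fun n => orbit_not_fixed g z n Hdiv).
  assert (Hup : exists n, iter g n z < iter g (S n) z).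
  { apply NNPP. intros Hn. apply Hdiv, (eventually_decreasing_converges g z 0 Hg Hz).
    intros n _. apply Rnot_lt_le. intros Hlt. apply Hn. eauto. }
  assert (Hdn : exists n, iter g (S n) z < iter g n z).
  { apply NNPP. intros Hn. apply Hdiv, (eventually_increasing_converges g z 0 Hg Hz).
    intros n _. apply Rnot_lt_le. intros Hlt. apply Hn. eauto. }
  destruct Hdn as [j Hj].
  set (E := fun t => exists n, t = iter g n z /\ iter g n z < iter g (S n) z).
  destruct (completeness E) as [l [Hl1 Hl2]].
  { exists (iter g j z). intros t (n & -> & Hn). apply Rlt_le, (ups_before_downs g z n j Hg Hn Hj). }
  { destruct Hup as [n Hn]. exists (iter g n z), n. auto. }
  assert (Hdown : forall n, iter g (S n) z < iter g n z -> l <= iter g n z).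
  { intros n Hn. apply Hl2. intros t (m & -> & Hm). apply Rlt_le, ups_before_downs; auto. }
  assert (Hgl : l <= g l).
  { apply Rnot_lt_le. intros Hlt.
    destruct (continuity_eps g l ((l - g l) / 2) (proj1 Hg)) as (d & Hd & H); [lra|].
    destruct (pos_min d ((l - g l) / 2)) as (d' & Hd' & D1 & D2); [lra..|].
    assert (exists t, E t /\ l - d' < t) as (t & (n & -> & Hn) & Ht).
    { apply NNPP. intros Hno. assert (l <= l - d'); [|lra]. apply Hl2. intros t Ht.
      apply Rnot_lt_le. intros Hlt'. apply Hno. eauto. }
    assert (iter g n z <= l) by (apply Hl1; exists n; auto).
    rewrite iter_S in Hn. specialize (H (iter g n z)). rewrite Rabs_left1 in H by lra.
    specialize (H ltac:(lra)). apply Rabs_def2 in H. lra. }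
  assert (exists p, g p = p /\ l <= p /\ forall n, iter g (S n) z < iter g n z -> p <= iter g n z)
    as (p & Hp & Hlp & Hpd).
  { destruct (Req_dec (g l) l) as [El|Hne]; [exists l; repeat split; auto; lra|].
    rewrite iter_S in Hj.
    destruct (first_fixed_above g l (iter g j z) (proj1 Hg)) as (p & Hp & Ep & H); try lra.
    { apply Hdown. rewrite iter_S. exact Hj. }
    exists p. split; [exact Ep|]. split; [lra|]. intros n Hn. apply Rnot_lt_le. intros Hlt.
    specialize (H (iter g n z)). rewrite iter_S in Hn. specialize (Hdown n).
    rewrite iter_S in Hdown. specialize (Hdown Hn). lra. }
  exists p. split; auto. intros n. specialize (Hnf n). rewrite <- iter_S in Hnf.
  assert (iter g n z <> p). { intros E'. apply (orbit_not_fixed g z n Hdiv). rewrite E'. exact Hp. }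
  destruct (Rtotal_order (iter g n z) (iter g (S n) z)) as [H'|[H'|H']].
  - left. split; [|exact H']. assert (iter g n z <= l) by (apply Hl1; exists n; auto). lra.
  - congruence.
  - right. specialize (Hpd n H'). split; lra.
Qed.

Section Split.
Variables (g : R -> R) (z p : R).
Hypothesis HS : splits g z p.

Let s n := iter g n z.

(** The backward orbit of [p]. Its points are barriers: an orbit that gets strictly between such a
    point and [p] eventually stays on that side of the point, by [trap_left] and its mirror
    image. *)
Definition bad (t : R) : Prop := exists r, iter g r t = p.

Lemma infinitely_many_left N : exists n, (n >= N)%nat /\ s n < p.
Proof.
  apply NNPP. intros Hn. apply (sp_div HS).
  apply (eventually_decreasing_converges g z N (sp_tame HS) (sp_inI HS)).
  intros n Hn'. destruct (sp_split HS n) as [[H _]|[_ H]]; [|lra].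
  exfalso. apply Hn. exists n. split; assumption.
Qed.

Lemma bad_shadow_left t q m : bad t -> om g z q -> q < t -> t < s m < p -> False.
Proof.
  intros [r Hr] Hq Hqt Hm.
  assert (t <= q); [|lra]. apply (climit_ge _ _ t Hq). exists (m + r)%nat. intros n Hn.
  replace n with ((n - m) + m)%nat by lia. rewrite iter_add.
  apply Rlt_le, (trap_left g p t (s m) r); auto; [apply HS|apply HS|lia].
Qed.

Lemma om_orbit_near a eps : om g z a -> 0 < eps -> exists m, Rabs (s m - a) < eps.
Proof. intros Ha He. destruct (Ha eps He 0%nat) as (m & _ & Hm). exists m. exact Hm. Qed.

Lemma no_bad_between_left t1 t2 t3 :
  om g z t1 -> bad t2 -> om g z t3 -> t1 < t2 -> t2 < t3 -> t3 < p -> False.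
Proof.
  intros H1 H2 H3 L1 L2 L3.
  destruct (pos_min (t3 - t2) (p - t3)) as (r & Hr & R1 & R2); [lra..|].
  destruct (om_orbit_near t3 r H3 Hr) as (m & Hm).
  apply Rabs_def2 in Hm. apply (bad_shadow_left t2 t1 m H2 H1 L1). lra.
Qed.

(** The middle one of three would be a barrier between two limit points. *)
Lemma three_bad_left t1 t2 t3 : om g z t1 -> om g z t2 -> om g z t3 ->
  bad t1 -> bad t2 -> bad t3 -> t1 <> t2 -> t1 <> t3 -> t2 <> t3 ->
  t1 < p -> t2 < p -> t3 < p -> False.
Proof.
  intros O1 O2 O3 B1 B2 B3 D1 D2 D3 L1 L2 L3. pose proof no_bad_between_left as K.
  destruct (Rtotal_order t1 t2) as [|[|]], (Rtotal_order t1 t3) as [|[|]],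
    (Rtotal_order t2 t3) as [|[|]]; try contradiction; try lra;
  unfold Rgt in *;
  match goal with A : ?a < ?b, B : ?b < ?c |- _ => apply (K a b c); assumption || lra end.
Qed.
End Split.

Lemma bad_refl g p t : bad g p t -> bad (refl g) (1 - p) (1 - t).
Proof.
  intros [r Hr]. exists r. rewrite iter_refl. replace (1 - (1 - t)) with t by lra. congruence.
Qed.

Lemma three_bad_right g z p t1 t2 t3 : splits g z p -> om g z t1 -> om g z t2 -> om g z t3 ->
  bad g p t1 -> bad g p t2 -> bad g p t3 -> t1 <> t2 -> t1 <> t3 -> t2 <> t3 ->
  p < t1 -> p < t2 -> p < t3 -> False.
Proof.
  intros HS O1 O2 O3 B1 B2 B3 D1 D2 D3 L1 L2 L3.
  apply (three_bad_left (refl g) (1 - z) (1 - p) (splits_refl HS)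
    (1 - t1) (1 - t2) (1 - t3)); auto using om_refl, bad_refl; lra.
Qed.

(** A limit point that eventually falls on [p] has an infinite chain of distinct
    preimages of the same kind, but each side of [p] contains at most two of them. *)
Lemma om_bad_eq g z p t : splits g z p -> om g z t -> bad g p t -> t = p.
Proof.
  intros HS Ht [r Hr]. apply NNPP. intros Hne.
  set (hit := fun r t => iter g r t = p /\ forall j, (j < r)%nat -> iter g j t <> p).
  assert (Hhit : exists r, hit r t).
  { revert Hr. induction r as [r IH] using lt_wf_ind. intros Hr.
    destruct (classic (exists j, (j < r)%nat /\ iter g j t = p)) as [(j & Hj & E)|Hno].
    - apply (IH j Hj E).
    - exists r. split; [exact Hr|]. intros j Hj E. apply Hno. eauto. }
  clear r Hr. destruct Hhit as [r Hr].
  assert (Hinj : forall r1 r2 t1 t2, hit r1 t1 -> hit r2 t2 -> r1 <> r2 -> t1 <> t2).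
  { intros r1 r2 t1 t2 [E1 F1] [E2 F2] Hrr ->.
    destruct (Nat.lt_gt_cases r1 r2) as [Hc _]. destruct (Hc Hrr) as [Hlt|Hlt].
    - apply (F2 r1 Hlt E1).
    - apply (F1 r2 Hlt E2). }
  assert (Hpre : forall r t, om g z t /\ hit r t /\ t <> p ->
    exists t', om g z t' /\ hit (S r) t' /\ t' <> p).
  { intros r0 t0 (O & [E F] & D).
    destruct (om_preimage g z t0 (sp_tame HS) (sp_inI HS) O) as (b & Ob & Eb).
    assert (b <> p). { intros ->. apply D. rewrite <- Eb. apply HS. }
    exists b. split; [exact Ob|]. split; [|assumption]. split.
    - rewrite iter_succ_r, Eb. exact E.
    - intros [|j] Hj; [exact H|]. rewrite iter_succ_r, Eb. apply F. lia. }
  destruct (Hpre r t (conj Ht (conj Hr Hne))) as (t1 & H1).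
  destruct (Hpre _ _ H1) as (t2 & H2). destruct (Hpre _ _ H2) as (t3 & H3).
  destruct (Hpre _ _ H3) as (t4 & H4).
  destruct H1 as (O1 & K1 & N1), H2 as (O2 & K2 & N2), H3 as (O3 & K3 & N3), H4 as (O4 & K4 & N4).
  assert (B : forall r t, hit r t -> bad g p t) by (intros r0 t0 [E _]; exists r0; exact E).
  (* Five distinct points on two sides of [p]: three of them share a side. *)
  destruct (Rdichotomy _ _ Hne) as [L0|L0], (Rdichotomy _ _ N1) as [L1|L1],
    (Rdichotomy _ _ N2) as [L2|L2], (Rdichotomy _ _ N3) as [L3|L3],
    (Rdichotomy _ _ N4) as [L4|L4];
  match goal with
  | A : ?a < p, B : ?b < p, C : ?c < p, Ka : hit ?i ?a, Kb : hit ?j ?b, Kc : hit ?k ?c |- _ =>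
      apply (three_bad_left g z p HS a b c); eauto; eapply Hinj; eauto; lia
  | A : ?a > p, B : ?b > p, C : ?c > p, Ka : hit ?i ?a, Kb : hit ?j ?b, Kc : hit ?k ?c |- _ =>
      apply (three_bad_right g z p a b c HS); eauto; eapply Hinj; eauto; lia
  end.
Qed.

(** Between limit points of different type lies a preimage of [p], which would be a barrier between
    them. *)
Lemma om_left_same_type g z p c1 c2 : splits g z p -> om g z c1 -> om g z c2 ->
  c1 < p -> c2 < p -> g c1 < p -> p < g c2 -> False.
Proof.
  intros HS O1 O2 L1 L2 G1 G2.
  destruct (ivt g c1 c2 p (proj1 (sp_tame HS))) as (t & Ht & Et); [lra|].
  assert (B : bad g p t) by (exists 1%nat; exact Et).
  assert (t <> c1) by (intros ->; lra). assert (t <> c2) by (intros ->; lra).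
  unfold Rmin, Rmax in Ht. destruct (Rle_dec c1 c2).
  - apply (no_bad_between_left g z p HS c1 t c2); auto; lra.
  - apply (no_bad_between_left g z p HS c2 t c1); auto; lra.
Qed.

Definition approached_left (g : R -> R) (z p : R) : Prop :=
  forall d, 0 < d -> forall N, exists n, (n >= N)%nat /\ p - d < iter g n z < p.

Lemma same_side g a p : continuity g -> (forall n t, a <= t < p -> iter g n t <> p) ->
  forall n t1 t2, a <= t1 < p -> a <= t2 < p -> iter g n t1 < p -> iter g n t2 < p.
Proof.
  intros Hg H n t1 t2 H1 H2 H3. apply Rnot_le_lt. intros H4.
  destruct (ivt (iter g n) t1 t2 p (iter_continuity g n Hg)) as (w & Hw & Ew); [lra|].
  apply (H n w); [|exact Ew]. unfold Rmin, Rmax in Hw. destruct (Rle_dec t1 t2); lra.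
Qed.

Lemma left_near_fixed g a p n e : continuity g -> g p = p -> a < p -> 0 < e ->
  exists u, a <= u < p /\ Rabs (iter g n u - p) < e.
Proof.
  intros Hg Hp Ha He.
  destruct (continuity_eps (iter g n) p e (iter_continuity g n Hg) He) as (d & Hd & H).
  destruct (pos_min (p - a) (d / 2)) as (r & Hr & R1 & R2); [lra..|].
  exists (p - r). split; [lra|]. rewrite <- (iter_fix g n p Hp) at 2. apply H. rewrite Rabs_left; lra.
Qed.

(** An orbit point between a barrier and [p] would keep the orbit away from [a], so [[a,p)] contains
    no barrier and each iterate maps it to one side of [p]. If [g] kept it on the left, so would all
    iterates, and the orbit would increase from some time on and converge. *)
Lemma crossing_left g z p a : splits g z p -> om g z a -> a < p -> approached_left g z p ->
  (forall t, a <= t < p -> p < g t) /\ (forall n t, a <= t < p -> iter g n t <> p).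
Proof.
  intros HS Oa La HA. pose proof (sp_tame HS) as Hg.
  assert (Hnb : forall t, a <= t < p -> ~ bad g p t).
  { intros t Ht Bt. destruct (Req_dec t a) as [->|Hne].
    - pose proof (om_bad_eq g z p a HS Oa Bt). lra.
    - destruct (HA (p - t) ltac:(lra) 0%nat) as (m & _ & Hm).
      apply (bad_shadow_left g z p HS t a m Bt Oa); lra. }
  assert (Hnb' : forall n t, a <= t < p -> iter g n t <> p).
  { intros n t Ht E. apply (Hnb t Ht). exists n. exact E. }
  split; [|exact Hnb'].
  pose proof (same_side g a p (proj1 Hg) Hnb') as Hside.
  intros t Ht. destruct (Rtotal_order p (g t)) as [|[E|Hlt]]; [assumption|exfalso..].
  { apply (Hnb' 1%nat t Ht). symmetry. exact E. }
  assert (Hall : forall n t', a <= t' < p -> iter g n t' < p).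
  { induction n as [|n IH]; intros t' Ht'; [apply Ht'|].
    destruct (left_near_fixed g a p n (p - a) (proj1 Hg) (sp_fix HS)) as (u & Hu & H); [lra..|].
    apply Rabs_def2 in H.
    specialize (IH u Hu). apply (Hside (S n) u t' Hu Ht').
    rewrite iter_S. apply (Hside 1%nat t (iter g n u) Ht); [lra|exact Hlt]. }
  destruct (HA (p - a) ltac:(lra) 0%nat) as (m & _ & Hm).
  apply (sp_div HS), (eventually_increasing_converges g z m Hg (sp_inI HS)).
  intros n Hn. destruct (sp_split HS n) as [[_ H]|[H _]]; [lra|].
  specialize (Hall (n - m)%nat (iter g m z) ltac:(lra)). rewrite <- iter_add in Hall.
  replace (n - m + m)%nat with n in Hall by lia. lra.
Qed.

Lemma crossing_right g z p b : splits g z p -> om g z b -> p < b ->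
  approached_left (refl g) (1 - z) (1 - p) ->
  (forall t, p < t <= b -> g t < p) /\ (forall n t, p < t <= b -> iter g n t <> p).
Proof.
  intros HS Ob Lb HA.
  destruct (crossing_left (refl g) (1 - z) (1 - p) (1 - b) (splits_refl HS)
    (om_refl Ob) ltac:(lra) HA) as [H1 H2].
  split.
  - intros t Ht. specialize (H1 (1 - t) ltac:(lra)). unfold refl in H1.
    replace (1 - (1 - t)) with t in H1 by lra. lra.
  - intros n t Ht E. apply (H2 n (1 - t) ltac:(lra)). rewrite iter_refl.
    replace (1 - (1 - t)) with t by lra. congruence.
Qed.

(** If [p] were approached, the orbit of [g^2] on one side of [p] would have to enter
    a neighbourhood of [p] by an increasing step and to leave it by a decreasing one. *)
Lemma fixed_not_approached g z p a :
  splits g z p -> om g z a -> a < p -> ~ approached_left g z p.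
Proof.
  intros HS Oa La HA. pose proof (sp_tame HS) as Hg. pose proof (proj1 Hg) as Hc.
  destruct (crossing_left g z p a HS Oa La HA) as [HL HLn].
  set (b := g a). assert (Lb : p < b) by (apply HL; lra).
  assert (Ob : om g z b) by (apply climit_image; assumption).
  assert (HA' : approached_left (refl g) (1 - z) (1 - p)).
  { intros d Hd N. destruct (continuity_eps g p d Hc Hd) as (e & He & H).
    destruct (pos_min e (p - a)) as (r & Hr & R1 & R2); [lra..|].
    destruct (HA r Hr N) as (n & Hn & Hn').
    exists (S n). split; [lia|]. rewrite iter_refl. replace (1 - (1 - z)) with z by lra.
    rewrite iter_S. specialize (HL (iter g n z) ltac:(lra)). specialize (H (iter g n z)).
    rewrite Rabs_left, (sp_fix HS) in H by lra. specialize (H ltac:(lra)).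
    apply Rabs_def2 in H. lra. }
  destruct (crossing_right g z p b HS Ob Lb HA') as [HR HRn].
  pose proof (same_side g a p Hc HLn) as Hside.
  assert (Hnear := fun n e => left_near_fixed g a p n e Hc (sp_fix HS) La).
  (* Each iterate brings some point of [[a,p)] close to [p], where the next step changes side; by
     [same_side] this one point decides for the whole interval. *)
  assert (Halt : forall k t, a <= t < p -> iter g (2 * k) t < p /\ p < iter g (S (2 * k)) t).
  { assert (Hodd : forall n, (forall t, a <= t < p -> iter g n t < p) ->
      forall t, a <= t < p -> p < iter g (S n) t).
    { intros n Hn t Ht. destruct (Hnear n (p - a) ltac:(lra)) as (u & Hu & Hu').
      apply Rabs_def2 in Hu'. specialize (Hn u Hu). specialize (HL (iter g n u) ltac:(lra)).
      destruct (Rtotal_order p (iter g (S n) t)) as [|[E|Hlt]]; [assumption|exfalso..].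
      - apply (HLn (S n) t Ht). symmetry; exact E.
      - pose proof (Hside (S n) t u Ht Hu Hlt) as K. rewrite iter_S in K. lra. }
    assert (Hev : forall n, (forall t, a <= t < p -> p < iter g n t) ->
      forall t, a <= t < p -> iter g (S n) t < p).
    { intros n Hn t Ht. destruct (Hnear n (b - p) ltac:(lra)) as (u & Hu & Hu').
      apply Rabs_def2 in Hu'. specialize (Hn u Hu). specialize (HR (iter g n u) ltac:(lra)).
      apply (Hside (S n) u t Hu Ht). rewrite iter_S. exact HR. }
    induction k as [|k IH]; intros t Ht.
    - split; [apply Ht|]. apply (Hodd 0%nat); [intros; unfold iter; simpl; lra|exact Ht].
    - assert (E : (2 * S k = S (S (2 * k)))%nat) by lia. rewrite E.
      assert (K : forall t, a <= t < p -> iter g (S (S (2 * k))) t < p).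
      { apply Hev. intros; apply IH; assumption. }
      split; [apply K, Ht|]. apply Hodd; assumption. }
  destruct (HA (p - a) ltac:(lra) 0%nat) as (m0 & _ & Hm0).
  set (h := iter g 2). set (y := iter g m0 z).
  assert (Hy : a <= y < p) by (unfold y; lra).
  assert (Hw : forall k, iter h k y = iter g (2 * k + m0) z).
  { intros k. unfold h, y. rewrite iter_mul, iter_add. reflexivity. }
  assert (Hh : tame h) by (apply tame_iter; [lia|exact Hg]).
  assert (Hwp : forall k, iter h k y < p).
  { intros k. rewrite Hw, iter_add. apply Halt, Hy. }
  assert (Hpar : forall n, (n >= m0)%nat -> iter g n z < p ->
    exists k, (n = 2 * k + m0)%nat).
  { intros n Hn Hlt. destruct (Nat.Even_or_Odd (n - m0)) as [[k Hk]|[k Hk]]; [exists k; lia|].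
    exfalso. destruct (Halt k y Hy) as [_ K]. unfold y in K. rewrite <- iter_add in K.
    replace (S (2 * k) + m0)%nat with n in K by lia. lra. }
  assert (Hdown : exists k, iter h (S k) y < iter h k y).
  { apply NNPP. intros Hno.
    assert (Hmon : forall k j, iter h k y <= iter h (j + k) y).
    { intros k. induction j as [|j IH]; [simpl; lra|]. eapply Rle_trans; [exact IH|].
      apply Rnot_lt_le. intros K. apply Hno. eauto. }
    destruct (HA ((p - a) / 2) ltac:(lra) m0) as (n & Hn & Hn').
    destruct (Hpar n Hn ltac:(lra)) as (k & Ek).
    destruct (Oa ((p - a) / 2) ltac:(lra) n) as (n' & Hn1 & Hn2). apply Rabs_def2 in Hn2.
    destruct (Hpar n' ltac:(lia) ltac:(lra)) as (k' & Ek').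
    specialize (Hmon k (k' - k)%nat). replace (k' - k + k)%nat with k' in Hmon by lia.
    rewrite !Hw, <- Ek, <- Ek' in Hmon. lra. }
  destruct Hdown as [k0 Hk0]. set (d0 := iter h k0 y) in *.
  assert (Hups : forall k, iter h k y < iter h (S k) y -> iter h k y <= d0).
  { intros k Hk. apply Rlt_le, (ups_before_downs h y k k0 Hh Hk Hk0). }
  assert (Hd0 : d0 < p) by apply Hwp.
  (* Otherwise the orbit of [h] has a limit point at most [d0] which [h] maps to [p]. By [om_bad_eq]
     it equals [p], although [d0 < p]. *)
  assert (exists c N, c < p /\ forall k, (k >= N)%nat -> iter h k y <= d0 -> iter h (S k) y <= c)
    as (c & N & Hcp & Hc').
  { apply NNPP. intros Hno.
    destruct (climit_preimage h y 0 d0 p (proj1 Hh)) as (q & Oq & Hq & Eq).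
    - intros eps He N. apply NNPP. intros Hno'. apply Hno. exists (p - eps), N. split; [lra|].
      intros k Hk Hle. apply Rnot_lt_le. intros Hlt. apply Hno'. exists k. split; [exact Hk|].
      split; [split; [|exact Hle]|].
      + rewrite Hw. apply (tame_iter_inI g _ z Hg (sp_inI HS)).
      + specialize (Hwp (S k)). rewrite Rabs_left; lra.
    - assert (q = p); [|lra]. apply (om_bad_eq g z p q HS); [|exists 2%nat; exact Eq].
      intros eps He M. destruct (Oq eps He M) as (n & Hn & Hn'). exists (2 * n + m0)%nat.
      split; [lia|]. rewrite <- Hw. exact Hn'. }
  set (B := Rmax c (iter h N y)).
  assert (HB : B < p) by (apply Rmax_lub_lt; [exact Hcp|apply Hwp]).
  assert (HBb : forall k, (k >= N)%nat -> iter h k y <= B).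
  { intros k Hk. replace k with ((k - N) + N)%nat by lia. induction (k - N)%nat as [|j IH].
    - apply Rmax_r.
    - simpl Nat.add. destruct (Rle_or_lt (iter h (j + N) y) d0) as [Hle|Hlt].
      + eapply Rle_trans; [apply Hc'; [lia|exact Hle]|apply Rmax_l].
      + eapply Rle_trans; [|exact IH]. apply Rnot_lt_le. intros K. apply Hups in K. lra. }
  destruct (HA (p - B) ltac:(lra) (2 * N + m0)%nat) as (n & Hn & Hn').
  destruct (Hpar n ltac:(lia) ltac:(lra)) as (k & Ek).
  specialize (HBb k ltac:(lia)). rewrite Hw, <- Ek in HBb. lra.
Qed.

Lemma unique_om_converges g z p : tame g -> inI z -> (forall a, om g z a -> a = p) ->
  converges (fun n => iter g n z).
Proof.
  intros Hg Hz H. exists p. intros eps He. apply NNPP. intros Hno.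
  assert (K : forall N, exists n, (n >= N)%nat /\ Rabs (iter g n z - p) >= eps).
  { intros N. apply NNPP. intros Hno'. apply Hno. exists N. intros n Hn. unfold Rdist.
    apply Rnot_le_lt. intros Hle. apply Hno'. exists n. split; [exact Hn|lra]. }
  assert (B := fun n => tame_iter_inI g n z Hg Hz).
  destruct (classic (forall N, exists n, (n >= N)%nat /\ 0 <= iter g n z <= p - eps)) as [H1|H1].
  - destruct (climit_exists (fun n => iter g n z) 0 (p - eps) H1) as (l & Hl & Hl').
    apply H in Hl. lra.
  - apply not_all_ex_not in H1. destruct H1 as [N0 H1].
    destruct (climit_exists (fun n => iter g n z) (p + eps) 1) as (l & Hl & Hl').
    + intros N. destruct (K (N + N0)%nat) as (n & Hn & Hn'). exists n. split; [lia|].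
      specialize (B n). unfold inI in B. split; [|lra]. apply Rnot_lt_le. intros Hlt.
      apply H1. exists n. split; [lia|]. split; [lra|].
      unfold Rabs in Hn'. destruct (Rcase_abs (iter g n z - p)); lra.
    + apply H in Hl. lra.
Qed.

(** As [p] is not approached from the left, it is approached from the right, so no limit point lies
    beyond it. The orbit is then eventually below [p + d]; once to the right of [p] it cannot jump
    across the gap on the left, hence it decreases and converges. *)
Lemma splits_isolated_aux g z p a : splits g z p -> om g z a -> a < p -> ~ om g z p.
Proof.
  intros HS Oa La Op. pose proof (sp_tame HS) as Hg.
  pose proof (fixed_not_approached g z p a HS Oa La) as HnA.
  apply not_all_ex_not in HnA. destruct HnA as [d0 HnA].
  apply imply_to_and in HnA. destruct HnA as [Hd0 HnA].
  apply not_all_ex_not in HnA. destruct HnA as [N0 HnA].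
  assert (Hleft : forall n, (n >= N0)%nat -> iter g n z < p -> iter g n z <= p - d0).
  { intros n Hn Hlt. apply Rnot_lt_le. intros K. apply HnA. exists n. auto. }
  assert (HA : approached_left (refl g) (1 - z) (1 - p)).
  { intros d Hd N. destruct (pos_min d d0 Hd Hd0) as (r & Hr & R1 & R2).
    destruct (Op r Hr (N + N0)%nat) as (n & Hn & Hn').
    apply Rabs_def2 in Hn'. exists n. split; [lia|]. rewrite iter_refl.
    replace (1 - (1 - z)) with z by lra. specialize (Hleft n ltac:(lia)).
    destruct (sp_split HS n) as [[K _]|[K _]]; lra. }
  assert (Hno : forall b, om g z b -> b <= p).
  { intros b Ob. apply Rnot_lt_le. intros Lb.
    apply (fixed_not_approached (refl g) (1 - z) (1 - p) (1 - b)
      (splits_refl HS) (om_refl Ob) ltac:(lra) HA). }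
  destruct (continuity_eps g p d0 (proj1 Hg) Hd0) as (d & Hd & Hd').
  assert (exists N1, forall n, (n >= N1)%nat -> iter g n z < p + d) as [N1 HN1].
  { apply NNPP. intros K.
    destruct (climit_exists (fun n => iter g n z) (p + d) 1) as (l & Hl & Hl').
    - intros N. apply NNPP. intros K'. apply K. exists N. intros n Hn. apply Rnot_le_lt. intros K2.
      apply K'. exists n. split; [exact Hn|]. split; [lra|].
      apply (tame_iter_inI g n z Hg (sp_inI HS)).
    - apply Hno in Hl. lra. }
  destruct (HA 1 ltac:(lra) (N0 + N1)%nat) as (m & Hm & Hm').
  rewrite iter_refl in Hm'. replace (1 - (1 - z)) with z in Hm' by lra.
  assert (Hright : forall j, p < iter g (j + m) z).
  { induction j as [|j IH]; [simpl; lra|].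
    specialize (HN1 (j + m)%nat ltac:(lia)).
    specialize (Hd' (iter g (j + m) z)). rewrite Rabs_right in Hd' by lra.
    specialize (Hd' ltac:(lra)). rewrite (sp_fix HS) in Hd'. apply Rabs_def2 in Hd'.
    simpl Nat.add. rewrite iter_S.
    specialize (Hleft (S (j + m)) ltac:(lia)). rewrite iter_S in Hleft.
    destruct (sp_split HS (S (j + m))) as [[K _]|[K _]]; rewrite iter_S in K; lra. }
  apply (sp_div HS), (eventually_decreasing_converges g z m Hg (sp_inI HS)).
  intros n Hn. specialize (Hright (n - m)%nat). replace (n - m + m)%nat with n in Hright by lia.
  destruct (sp_split HS n) as [[K _]|[_ K]]; lra.
Qed.

Lemma splits_isolated g z p : splits g z p -> ~ om g z p.
Proof.
  intros HS Op.
  assert (exists a, om g z a /\ a <> p) as (a & Oa & Ha).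
  { apply NNPP. intros Hno. apply (sp_div HS).
    apply (unique_om_converges g z p (sp_tame HS) (sp_inI HS)).
    intros a Oa. apply NNPP. intros Hne. apply Hno. eauto. }
  destruct (Rdichotomy _ _ Ha) as [L|L].
  - exact (splits_isolated_aux g z p a HS Oa L Op).
  - apply (splits_isolated_aux (refl g) (1 - z) (1 - p) (1 - a) (splits_refl HS)
      (om_refl Oa) ltac:(lra) (om_refl Op)).
Qed.

Lemma splits_gap g z p : splits g z p -> exists e N, 0 < e /\
  forall n, (n >= N)%nat -> iter g n z < p - e \/ p + e < iter g n z.
Proof.
  intros HS. apply NNPP. intros Hno. apply (splits_isolated g z p HS).
  intros eps He N. apply NNPP. intros Hno'. apply Hno. exists (eps / 2), N. split; [lra|].
  intros n Hn. destruct (Rlt_or_le (iter g n z) (p - eps / 2)); [left; assumption|right].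
  apply Rnot_le_lt. intros Hle. apply Hno'. exists n. split; [exact Hn|].
  apply Rabs_def1; lra.
Qed.

(** A limit point mapped from left to left excludes limit points mapped from left to right; the
    orbit would then stay on the left eventually, increase and converge. *)
Lemma left_to_right g z p : splits g z p ->
  exists N, forall n, (n >= N)%nat -> iter g n z < p -> p < iter g (S n) z.
Proof.
  intros HS. apply NNPP. intros Hno. pose proof (sp_tame HS) as Hg.
  pose proof (fun n => tame_iter_inI g n z Hg (sp_inI HS)) as HI.
  destruct (splits_gap g z p HS) as (e & N0 & He & Hgap).
  destruct (om_pair g z 0 (p - e) 0 (p - e) Hg) as (c & Oc & Hc & Gc).
  { intros N. apply NNPP. intros Hno'. apply Hno. exists (N + N0)%nat. intros n Hn Hlt.
    destruct (Hgap n ltac:(lia)) as [H1|H1]; [|lra].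
    destruct (Hgap (S n) ltac:(lia)) as [H2|H2]; [exfalso|lra].
    apply Hno'. exists n. split; [lia|]. pose proof (HI n). pose proof (HI (S n)).
    unfold inI in *. lra. }
  assert (exists N1, forall n, (n >= N1)%nat -> iter g n z < p -> iter g (S n) z < p) as [N1 HN1].
  { apply NNPP. intros Hno2.
    destruct (om_pair g z 0 (p - e) (p + e) 1 Hg) as (c' & Oc' & Hc' & Gc').
    - intros N. apply NNPP. intros Hno'. apply Hno2. exists (N + N0)%nat. intros n Hn Hlt.
      destruct (Hgap n ltac:(lia)) as [H1|H1]; [|lra].
      destruct (Hgap (S n) ltac:(lia)) as [H2|H2]; [lra|exfalso].
      apply Hno'. exists n. split; [lia|]. pose proof (HI n). pose proof (HI (S n)).
      unfold inI in *. lra.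
    - apply (om_left_same_type g z p c c' HS Oc Oc'); lra. }
  destruct (infinitely_many_left g z p HS N1) as (m & Hm & Hm').
  apply (sp_div HS), (eventually_increasing_converges g z m Hg (sp_inI HS)).
  assert (K : forall j, iter g (j + m) z < p).
  { induction j as [|j IH]; [exact Hm'|]. simpl Nat.add. apply HN1; [lia|exact IH]. }
  intros n Hn. specialize (K (n - m)%nat). replace (n - m + m)%nat with n in K by lia.
  destruct (sp_split HS n) as [[_ H]|[H _]]; lra.
Qed.

Theorem alternation g z : tame g -> inI z -> ~ converges (fun n => iter g n z) ->
  exists p e N, 0 < e /\ forall m, iter g (N + 2 * m) z < p - e /\ p + e < iter g (S (N + 2 * m)) z.
Proof.
  intros Hg Hz Hdiv. destruct (splits_exists g z Hg Hz Hdiv) as [p HS].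
  destruct (splits_gap g z p HS) as (e & N0 & He & Hgap).
  destruct (left_to_right g z p HS) as (N1 & HN1).
  destruct (left_to_right _ _ _ (splits_refl HS)) as (N2 & HN2).
  destruct (infinitely_many_left g z p HS (N0 + N1 + N2)) as (N & HN & HN').
  assert (HR : forall n, (n >= N2)%nat -> p < iter g n z -> iter g (S n) z < p).
  { intros n Hn Hlt. specialize (HN2 n Hn). rewrite !iter_refl in HN2.
    replace (1 - (1 - z)) with z in HN2 by lra. specialize (HN2 ltac:(lra)). lra. }
  exists p, e, N. split; [exact He|].
  assert (K : forall m, iter g (N + 2 * m) z < p).
  { induction m as [|m IH]; [rewrite Nat.add_0_r; exact HN'|].
    replace (N + 2 * S m)%nat with (S (S (N + 2 * m))) by lia.
    apply HR; [lia|]. apply HN1; [lia|exact IH]. }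
  intros m. specialize (K m). pose proof (HN1 (N + 2 * m)%nat ltac:(lia) K) as K'.
  destruct (Hgap (N + 2 * m)%nat ltac:(lia)), (Hgap (S (N + 2 * m)) ltac:(lia)); lra.
Qed.

(** Alternation puts times of different parity on different sides of a point, while an odd period
    identifies such times. *)
Lemma odd_period_fixed g q e : tame g -> inI e -> Nat.Odd q -> iter g q e = e -> g e = e.
Proof.
  intros Hg He [j Hq] E. apply NNPP. intros Hne.
  assert (Eq : forall n k, iter g (n + q * k) e = iter g n e).
  { intros n k. rewrite iter_add, <- iter_mul, (iter_fix (iter g q) k e E). reflexivity. }
  destruct (alternation g e Hg He) as (p & d & N & Hd & H).
  - intros [l Hl]. apply Hne.
    assert (K : forall n, iter g n e = l).
    { intros n. apply NNPP. intros Hnl.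
      destruct (Hl (Rabs (iter g n e - l))) as [N HN]; [apply Rabs_pos_lt; lra|].
      specialize (HN (n + q * N)%nat ltac:(nia)). rewrite Eq in HN. unfold Rdist in HN. lra. }
    rewrite <- (iter_1 g e), (K 1%nat). symmetry. exact (K 0%nat).
  - pose proof (H 0%nat) as [_ H0]. pose proof (H (S j)) as [H1 _].
    pose proof (Eq (S (N + 2 * 0)) 1%nat) as E'.
    replace (S (N + 2 * 0) + q * 1)%nat with (N + 2 * S j)%nat in E' by lia. lra.
Qed.

(** * Residue classes modulo powers of two *)

Lemma pow2_pos k : (0 < 2 ^ k)%nat.
Proof. pose proof (Nat.pow_nonzero 2 k). lia. Qed.

Lemma mod_pow2_S n k : (n mod 2 ^ S k = n mod 2 ^ k + 2 ^ k * ((n / 2 ^ k) mod 2))%nat.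
Proof. rewrite Nat.pow_succ_r', Nat.mul_comm. apply Nat.Div0.mod_mul_r. Qed.

Lemma mod_pow2_S_mod n k : ((n mod 2 ^ S k) mod 2 ^ k = n mod 2 ^ k)%nat.
Proof.
  rewrite mod_pow2_S, Nat.mul_comm, Nat.Div0.mod_add. apply Nat.Div0.mod_mod.
Qed.

Lemma mod_pow2_le n m k l : (k <= l)%nat -> n mod 2 ^ l = m mod 2 ^ l -> n mod 2 ^ k = m mod 2 ^ k.
Proof.
  induction 1 as [|l Hl IH]; [auto|]. intros E. apply IH.
  rewrite <- (mod_pow2_S_mod n l), <- (mod_pow2_S_mod m l), E. reflexivity.
Qed.

Lemma mod_pow2_add_mul n l k m : (k <= l)%nat -> ((n + 2 ^ l * m) mod 2 ^ k = n mod 2 ^ k)%nat.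
Proof.
  intros H. replace (2 ^ l * m)%nat with ((2 ^ (l - k) * m) * 2 ^ k)%nat.
  - apply Nat.Div0.mod_add.
  - replace l with ((l - k) + k)%nat at 2 by lia. rewrite Nat.pow_add_r. lia.
Qed.

Lemma mul_pow2_mod0 l k m : (k <= l)%nat -> ((2 ^ l * m) mod 2 ^ k = 0)%nat.
Proof.
  intros H. pose proof (mod_pow2_add_mul 0 l k m H) as E. rewrite Nat.add_0_l in E.
  rewrite E. apply Nat.Div0.mod_0_l.
Qed.

Lemma bit_flip n k q :
  (((n + 2 ^ k * (2 * q + 1)) / 2 ^ k) mod 2 = 1 - (n / 2 ^ k) mod 2)%nat.
Proof.
  rewrite (Nat.mul_comm (2 ^ k)), Nat.div_add by (pose proof (pow2_pos k); lia).
  replace (n / 2 ^ k + (2 * q + 1))%nat with ((n / 2 ^ k + 1) + q * 2)%nat by lia.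
  rewrite Nat.Div0.mod_add, Nat.Div0.add_mod.
  pose proof (Nat.mod_upper_bound (n / 2 ^ k) 2 ltac:(lia)).
  destruct ((n / 2 ^ k) mod 2)%nat as [|[|]]; [reflexivity|reflexivity|lia].
Qed.

(** An odd multiple of [2^k] flips the binary digit of weight [2^k] and keeps the lower ones. *)
Lemma shift_out n k q r :
  (n mod 2 ^ S k = r)%nat -> ((n + 2 ^ k * (2 * q + 1)) mod 2 ^ S k <> r)%nat.
Proof.
  intros <-. rewrite !mod_pow2_S, bit_flip, mod_pow2_add_mul by lia.
  pose proof (pow2_pos k). pose proof (Nat.mod_upper_bound (n / 2 ^ k) 2 ltac:(lia)). nia.
Qed.

Lemma odd_part d : (0 < d)%nat -> exists l q, d = (2 ^ l * (2 * q + 1))%nat.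
Proof.
  induction d as [d IH] using lt_wf_ind. intros Hd.
  destruct (Nat.Even_or_Odd d) as [[e He]|[e He]].
  - destruct (IH e ltac:(lia) ltac:(lia)) as (l & q & E). exists (S l), q.
    rewrite Nat.pow_succ_r'. lia.
  - exists 0%nat, e. simpl. lia.
Qed.

Lemma odd_part_ge k n m : (n < m)%nat -> (n mod 2 ^ k = m mod 2 ^ k)%nat ->
  exists l q, (k <= l)%nat /\ m = (n + 2 ^ l * (2 * q + 1))%nat.
Proof.
  intros Hlt E. destruct (odd_part (m - n) ltac:(lia)) as (l & q & H).
  exists l, q. assert (Hm : m = (n + 2 ^ l * (2 * q + 1))%nat) by lia. split; [|exact Hm].
  apply Nat.nlt_ge. intros Hlk.
  apply (shift_out n l q (n mod 2 ^ S l) eq_refl). rewrite <- Hm.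
  symmetry. apply (mod_pow2_le n m (S l) k Hlk E).
Qed.

(** The sequence form of an infinite independence set: the times are fixed before the pattern, of
    which every finite part is realised. The point [w] may lie outside [I]; [shadows_IT_pair]
    restarts it at a later time. *)
Definition shadows (f : R -> R) (x y : R) : Prop :=
  forall eps, eps > 0 -> exists t : nat -> nat, (forall j, (t j < t (S j))%nat) /\
    forall N (s : nat -> bool), exists w, forall j, (j < N)%nat ->
      Rabs (iter f (t j) w - (if s j then x else y)) < eps.

Lemma shadows_refl f x y : shadows (refl f) (1 - y) (1 - x) -> shadows f x y.
Proof.
  intros H eps He. destruct (H eps He) as (t & Ht & H'). exists t. split; [exact Ht|].
  intros N s. destruct (H' N (fun j => negb (s j))) as [w Hw]. exists (1 - w).
  intros j Hj. specialize (Hw j Hj). rewrite iter_refl in Hw.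
  rewrite <- Rabs_Ropp. destruct (s j); simpl in Hw;
  match goal with |- Rabs ?a < _ => match type of Hw with Rabs ?b < _ =>
    replace a with b by lra end end; exact Hw.
Qed.

(** * Chaining coverings along a pattern *)

Section Chain.
Variables (f : R -> R) (x y : R) (right : bool).
Hypothesis Hf : continuity f.

(** The box at [x] lies outside [[x,y]]; the flag [right] tells whether the box at [y] lies outside
    or inside. The interval covered in [Hchain] contains both boxes of size [e'], so the next entry
    of the pattern is free. *)
Definition lo (s : bool) (e : R) := if s then x - e else if right then y else y - e.
Definition hi (s : bool) (e : R) := if s then x else if right then y + e else y.
Definition in_box (s : bool) (e t : R) : Prop := lo s e <= t <= hi s e.

Hypothesis Hxy : x < y.
Hypothesis Hchain : forall e, 0 < e -> exists e' d, 0 < e' <= e /\ (0 < d)%nat /\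
  forall s, cov f d (lo s e) (hi s e) (x - e') (hi false e').

Lemma chain_shadows : shadows f x y.
Proof.
  intros eps Heps.
  destruct (dependent_choice (fun a b : {e | 0 < e} => proj1_sig b <= proj1_sig a /\
    exists d, (0 < d)%nat /\ forall s, cov f d (lo s (proj1_sig a)) (hi s (proj1_sig a))
      (x - proj1_sig b) (hi false (proj1_sig b))) (exist _ (eps / 2) (ltac:(lra) : 0 < eps / 2)))
    as (es & E0 & Hes).
  { intros [e He]. destruct (Hchain e He) as (e' & d & He' & Hd).
    exists (exist _ e' (proj1 He')). simpl. split; [apply He'|exists d; exact Hd]. }
  destruct (choice_function _ (fun j => proj2 (Hes j))) as [d Hd].
  set (e := fun j => proj1_sig (es j)) in *.
  assert (Hepos : forall j, 0 < e j) by (intros j; unfold e; destruct (es j); assumption).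
  assert (Heub : forall j, e j <= eps / 2).
  { induction j as [|j IH]; [unfold e; rewrite E0; simpl; lra|].
    eapply Rle_trans; [apply Hes|exact IH]. }
  set (t := fix t j := match j with O => O | S j => (t j + d j)%nat end).
  assert (Hmon : forall j i, (t j <= t (j + i))%nat).
  { intros j i. induction i as [|i IH]; [rewrite Nat.add_0_r; lia|].
    rewrite Nat.add_succ_r. simpl. lia. }
  exists t. split; [intros j; simpl; pose proof (proj1 (Hd j)); lia|].
  intros N s.
  assert (K : forall (N j0 : nat), exists w, in_box (s j0) (e j0) w /\ forall i, (i <= N)%nat ->
    in_box (s (j0 + i)%nat) (e (j0 + i)%nat) (iter f (t (j0 + i)%nat - t j0)%nat w)).
  { clear N. induction N as [|N IH]; intros j0.
    - exists (lo (s j0) (e j0)).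
      assert (in_box (s j0) (e j0) (lo (s j0) (e j0))).
      { unfold in_box, lo, hi. specialize (Hepos j0). destruct (s j0), right; lra. }
      split; [assumption|]. intros i Hi. replace i with 0%nat by lia.
      rewrite Nat.add_0_r, Nat.sub_diag. assumption.
    - destruct (IH (S j0)) as (w1 & Hw1 & H1).
      destruct (cov_point f (d j0) _ _ _ _ w1 Hf (proj2 (Hd j0) (s j0))) as (w & Hw & Ew).
      { fold (e (S j0)). unfold in_box, lo, hi in Hw1. specialize (Hepos (S j0)).
        unfold hi. destruct (s (S j0)), right; lra. }
      exists w. split; [exact Hw|]. intros [|i] Hi.
      + rewrite Nat.add_0_r, Nat.sub_diag. exact Hw.
      + specialize (H1 i ltac:(lia)). rewrite Nat.add_succ_r. simpl Nat.add in H1.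
        replace (t (S (j0 + i)) - t j0)%nat with ((t (S (j0 + i)) - t (S j0)) + d j0)%nat.
        * rewrite iter_add, Ew. exact H1.
        * pose proof (Hmon (S j0) i) as M. simpl Nat.add in M. simpl t in *. lia. }
  destruct (K N 0%nat) as (w & _ & Hw). exists w. intros j Hj.
  specialize (Hw j ltac:(lia)). simpl in Hw. rewrite Nat.sub_0_r in Hw.
  unfold in_box, lo, hi in Hw. specialize (Hepos j). specialize (Heub j).
  apply Rabs_def1; destruct (s j), right; lra.
Qed.
End Chain.

(** * Coverings along nested residue classes of times *)

Section ClassData.
Variables (f : R -> R) (x y z : R) (c : nat -> nat).

Let s n := iter f n z.

(** [c k] stands for the index [i_k] of the nested sequence of portions. *)
Definition in_class (k n : nat) : Prop := (n mod 2 ^ k = c k)%nat.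

(** Times of class [k] outside class [k+1] are those of the sibling portion. *)
Definition left_at (k : nat) : Prop := exists e N, 0 < e /\ forall n, (n >= N)%nat ->
  in_class k n -> ~ in_class (S k) n -> s n < x - e.
Definition right_at (k : nat) : Prop := exists e N, 0 < e /\ forall n, (n >= N)%nat ->
  in_class k n -> ~ in_class (S k) n -> y + e < s n.

Record class_data : Prop := {
  cd_cont : continuity f;
  cd_lt : x < y;
  cd_bound : forall k, (1 <= k)%nat -> (c k < 2 ^ k)%nat;
  cd_nest : forall k, (1 <= k)%nat -> (c (S k) mod 2 ^ k = c k)%nat;
  cd_near : forall d, 0 < d -> exists k0, forall k, (k0 <= k)%nat -> exists N, forall n,
    (n >= N)%nat -> in_class k n -> x - d < s n < y + d;
  cd_lo : forall k d N, (1 <= k)%nat -> 0 < d -> exists n, (n >= N)%nat /\ in_class k n /\ s n < x + d;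
  cd_hi : forall k d N, (1 <= k)%nat -> 0 < d -> exists n, (n >= N)%nat /\ in_class k n /\ y - d < s n;
  cd_side : forall k, (1 <= k)%nat -> left_at k \/ right_at k
}.

Hypothesis HD : class_data.
Hypothesis HL : forall K, exists l, (K <= l)%nat /\ left_at l.

Lemma in_class_le k l n : (1 <= k <= l)%nat -> in_class l n -> in_class k n.
Proof.
  intros [Hk Hl]. induction Hl as [|l Hl IH]; [auto|]. intros H. apply IH. unfold in_class in *.
  rewrite <- mod_pow2_S_mod, H. apply (cd_nest HD). lia.
Qed.

Lemma class_shift_out l q n : in_class (S l) n -> ~ in_class (S l) (n + 2 ^ l * (2 * q + 1)).
Proof. apply shift_out. Qed.

Lemma class_shift l q n : in_class l n -> in_class l (n + 2 ^ l * (2 * q + 1)).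
Proof. unfold in_class. rewrite mod_pow2_add_mul; auto. Qed.

Lemma s_shift d n : s (n + d) = iter f d (s n).
Proof. unfold s. rewrite Nat.add_comm. apply iter_add. Qed.

Lemma other_half_exists l N : (1 <= l)%nat -> exists n, (n >= N)%nat /\ in_class l n /\ ~ in_class (S l) n.
Proof.
  intros Hl. destruct (cd_hi HD (S l) 1 N ltac:(lia) ltac:(lra)) as (n & Hn & Hn' & _).
  exists (n + 2 ^ l * (2 * 0 + 1))%nat. split; [lia|]. split.
  - apply class_shift, (in_class_le l (S l)); [lia|exact Hn'].
  - apply class_shift_out, Hn'.
Qed.

(** The other half of the class lies in [[x-e,x]], and an odd multiple of [2^l] steps
    exchanges the two halves. *)
Lemma left_box_image e : 0 < e -> exists K, (1 <= K)%nat /\ forall l q, (K <= l)%nat -> left_at l ->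
  exists N, forall n, (n >= N)%nat -> in_class (S l) n ->
    exists w, x - e <= w <= x /\ iter f (2 ^ l * (2 * q + 1)) w = s n.
Proof.
  intros He. destruct (cd_near HD e He) as [k0 Hk0].
  exists (S k0). split; [lia|]. intros l q Hl (d & N1 & Hd & H1).
  destruct (Hk0 l ltac:(lia)) as [N2 H2].
  set (D := (2 ^ l * (2 * q + 1))%nat).
  assert (HD0 : (0 < D)%nat) by (unfold D; pose proof (pow2_pos l); nia).
  exists (N1 + N2 + 2 * D)%nat. intros n Hn Hc.
  assert (Hcl : in_class l (n - D)).
  { pose proof (in_class_le l (S l) n ltac:(lia) Hc) as K. unfold in_class in *.
    rewrite <- K. pose proof (mod_pow2_add_mul (n - D) l l (2 * q + 1) ltac:(lia)) as E.
    fold D in E. replace (n - D + D)%nat with n in E by lia. congruence. }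
  assert (Hcn : ~ in_class (S l) (n - D)).
  { intros K. apply (class_shift_out l q _ K). fold D. replace (n - D + D)%nat with n by lia. exact Hc. }
  exists (s (n - D)). rewrite <- s_shift. replace (n - D + D)%nat with n by lia.
  split; [|reflexivity].
  specialize (H1 (n - D)%nat ltac:(lia) Hcl Hcn). specialize (H2 (n - D)%nat ltac:(lia) Hcl). lra.
Qed.

Lemma class_below l : (1 <= l)%nat -> exists e, 0 < e /\ forall N, exists n, (n >= N)%nat /\
  in_class l n /\ s n < x - e.
Proof.
  intros Hl. destruct (HL l) as (l' & Hl' & (e & N' & He & H')). exists e. split; [exact He|].
  intros N. destruct (other_half_exists l' (N + N') ltac:(lia)) as (n & Hn & Hn1 & Hn2).
  exists n. split; [lia|]. split; [apply (in_class_le l l'); [lia|exact Hn1]|]. apply H'; auto; lia.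
Qed.

Definition approach_right : Prop := forall k e N, (1 <= k)%nat -> 0 < e ->
  exists n, (n >= N)%nat /\ in_class k n /\ y < s n < y + e.

Lemma right_inf_approach : (forall K, exists r, (K <= r)%nat /\ right_at r) -> approach_right.
Proof.
  intros HR k e N Hk He. destruct (cd_near HD e He) as [k0 Hk0].
  destruct (HR (k + k0)%nat) as (r & Hr & (e' & N1 & He' & H1)).
  destruct (Hk0 r ltac:(lia)) as [N2 H2].
  destruct (other_half_exists r (N + N1 + N2) ltac:(lia)) as (n & Hn & Hn1 & Hn2).
  exists n. split; [lia|]. split; [apply (in_class_le k r); [lia|exact Hn1]|].
  specialize (H1 n ltac:(lia) Hn1 Hn2). specialize (H2 n ltac:(lia) Hn1). lra.
Qed.

(** If siblings lie on the right at infinitely many levels, a visit to one at level [r] is repeated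
    after [2^l] steps for every [l > r]. Otherwise two visits of the same class differ by an odd
    multiple of some large [2^l], and the sibling at this level has to be on the left. *)
Lemma right_returns : approach_right -> forall e K, 0 < e -> exists l q n, (K <= l)%nat /\ left_at l /\
  y < s n < y + e /\ y < s (n + 2 ^ l * (2 * q + 1)) < y + e.
Proof.
  intros HA e K He.
  destruct (classic (forall K, exists r, (K <= r)%nat /\ right_at r)) as [HR|HR].
  - destruct (cd_near HD e He) as [k0 Hk0].
    destruct (HR (S k0)) as (r & Hr & (e' & N1 & He' & H1)).
    destruct (Hk0 r ltac:(lia)) as [N2 H2].
    destruct (other_half_exists r (N1 + N2) ltac:(lia)) as (n & Hn & Hn1 & Hn2).
    destruct (HL (K + S r)%nat) as (l & Hl & Hl').
    exists l, 0%nat, n. split; [lia|]. split; [exact Hl'|].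
    assert (Hs : in_class r (n + 2 ^ l * (2 * 0 + 1)) /\ ~ in_class (S r) (n + 2 ^ l * (2 * 0 + 1))).
    { unfold in_class in *. rewrite !mod_pow2_add_mul by lia. auto. }
    destruct Hs as [Hs1 Hs2].
    pose proof (H1 n ltac:(lia) Hn1 Hn2). pose proof (H2 n ltac:(lia) Hn1).
    pose proof (H1 (n + 2 ^ l * (2 * 0 + 1))%nat ltac:(lia) Hs1 Hs2).
    pose proof (H2 (n + 2 ^ l * (2 * 0 + 1))%nat ltac:(lia) Hs1). lra.
  - apply not_all_ex_not in HR. destruct HR as [K1 HR].
    set (k := S (K + K1)).
    destruct (HA k e 0%nat ltac:(lia) He) as (n & _ & Hn1 & Hn2).
    destruct (HA k e (S n) ltac:(lia) He) as (m & Hm & Hm1 & Hm2).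
    destruct (odd_part_ge k n m ltac:(lia)) as (l & q & Hl & E); [congruence|].
    exists l, q, n. split; [lia|]. split; [|rewrite <- E; auto].
    destruct (cd_side HD l ltac:(lia)) as [|Hr]; [assumption|].
    exfalso. apply HR. exists l. split; [lia|exact Hr].
Qed.

(** One time [d] serves both boxes. From the left of [x] the sibling is exchanged with class [l+1],
    which has points on both outer sides. From the right of [y], class [l+1] is sent to the left of
    [x], and [right_returns] provides the way back to the right. *)
Lemma shadows_right : approach_right -> shadows f x y.
Proof.
  intros HA. apply (chain_shadows f x y true (cd_cont HD) (cd_lt HD)).
  intros e He. destruct (left_box_image e He) as (K & HK & HKl).
  destruct (right_returns HA e K He) as (l & q & n & Hl & Hlat & Hn1 & Hn2).
  set (d := (2 ^ l * (2 * q + 1))%nat) in *.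
  destruct (HKl l q Hl Hlat) as [N1 H1]. fold d in H1.
  destruct Hlat as (eta & N2 & Heta & H2).
  destruct (class_below (S l) ltac:(lia)) as (eta' & Heta' & H3).
  destruct (HA (S l) e N1 ltac:(lia) He) as (n1 & Hn11 & Hn12 & Hn13).
  destruct (HA (S l) e N2 ltac:(lia) He) as (n2 & Hn21 & Hn22 & Hn23).
  destruct (H3 N1) as (n3 & Hn31 & Hn32 & Hn33).
  destruct (H1 n1 Hn11 Hn12) as (w1 & Hw1 & Ew1).
  destruct (H1 n3 Hn31 Hn32) as (w3 & Hw3 & Ew3).
  assert (Hn2d : s (n2 + d) < x - eta).
  { apply H2; [lia| |apply class_shift_out, Hn22].
    apply class_shift, (in_class_le l (S l)); [lia|exact Hn22]. }
  destruct (pos_min eta eta') as (r1 & Hr1 & B1 & B2); [lra..|].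
  destruct (pos_min (s (n + d) - y) (s n1 - y)) as (r2 & Hr2 & B3 & B4); [lra..|].
  destruct (pos_min r1 r2 Hr1 Hr2) as (r & Hr & B5 & B6).
  destruct (pos_min e r He Hr) as (e' & He' & B7 & B8).
  exists e', d. split; [lra|]. split; [unfold d; pose proof (pow2_pos l); nia|].
  intros [|]; unfold lo, hi.
  - exists w3, w1. rewrite Ew1, Ew3. repeat split; lra.
  - exists (s n2), (s n). rewrite <- (s_shift d n2), <- (s_shift d n). repeat split; lra.
Qed.

Lemma shadows_left : ~ approach_right -> shadows f x y.
Proof.
  intros HA.
  assert (HR : exists K1, forall l, (K1 <= l)%nat -> left_at l).
  { assert (HR : ~ (forall K, exists r, (K <= r)%nat /\ right_at r))
      by (intros K; apply HA, right_inf_approach, K).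
    apply not_all_ex_not in HR. destruct HR as [K1 HR]. exists (S K1). intros l Hl.
    destruct (cd_side HD l ltac:(lia)) as [|Hr]; [assumption|].
    exfalso. apply HR. exists l. split; [lia|exact Hr]. }
  destruct HR as [K1 HR].
  (* At a high level the class is eventually below [y + e0], while values strictly between [y] and
     [y + e0] are excluded; so the class points near [y] are at most [y]. *)
  assert (HAL : forall k e N, (1 <= k)%nat -> 0 < e ->
    exists n, (n >= N)%nat /\ in_class k n /\ y - e < s n <= y).
  { assert (exists k0 e0 N0, (1 <= k0)%nat /\ 0 < e0 /\ forall n, (n >= N0)%nat -> in_class k0 n ->
      ~ (y < s n < y + e0)) as (k0 & e0 & N0 & Hk0 & He0 & H0).
    { apply NNPP. intros Hno. apply HA. intros k e N Hk He. apply NNPP. intros Hno'.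
      apply Hno. exists k, e, N. split; [exact Hk|]. split; [exact He|]. intros n Hn Hc Hy.
      apply Hno'. exists n. auto. }
    intros k e N Hk He. destruct (cd_near HD e0 He0) as [k1 Hk1].
    destruct (Hk1 (k + k0 + k1)%nat ltac:(lia)) as [N1 HN1].
    destruct (cd_hi HD (k + k0 + k1) e (N + N0 + N1) ltac:(lia) He) as (n & Hn & Hn1 & Hn2).
    exists n. split; [lia|]. split; [apply (in_class_le k (k + k0 + k1)); [lia|exact Hn1]|].
    specialize (HN1 n ltac:(lia) Hn1).
    specialize (H0 n ltac:(lia) (in_class_le k0 (k + k0 + k1) n ltac:(lia) Hn1)). lra. }
  pose proof (cd_lt HD) as Hxy.
  (* The image of the closed interval contains points arbitrarily close to [y] from
     below, hence [y] itself. *)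
  assert (Hreach : forall e, 0 < e -> exists K, (1 <= K)%nat /\ forall l q, (K <= l)%nat ->
    left_at l -> exists w, x - e <= w <= x /\ iter f (2 ^ l * (2 * q + 1)) w = y).
  { intros e He. destruct (left_box_image e He) as (K & HK & HKl). exists K. split; [exact HK|].
    intros l q Hl Hlat. destruct (HKl l q Hl Hlat) as [N H].
    set (D := (2 ^ l * (2 * q + 1))%nat) in *.
    pose proof (iter_continuity f D (cd_cont HD)) as Hc.
    destruct (continuity_ab_maj (iter f D) (x - e) x) as (m & Hm & Hm'); [lra|intros; apply Hc|].
    assert (y <= iter f D m).
    { apply Rnot_lt_le. intros Hlt.
      destruct (HAL (S l) (y - iter f D m) N ltac:(lia) ltac:(lra)) as (n & Hn & Hn1 & Hn2).
      destruct (H n Hn Hn1) as (w & Hw & Ew). specialize (Hm w Hw). lra. }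
    destruct (class_below (S l) ltac:(lia)) as (e' & He' & Hb).
    destruct (Hb N) as (n & Hn & Hn1 & Hn2). destruct (H n Hn Hn1) as (w & Hw & Ew).
    apply (ivt_within (iter f D) (x - e) x w m y Hc Hw Hm'). lra. }
  apply (chain_shadows f x y false (cd_cont HD) (cd_lt HD)).
  intros e He. destruct (left_box_image e He) as (K & HK & HKl).
  destruct (Hreach e He) as (K' & HK' & HKr).
  set (k := (K + K' + K1)%nat).
  destruct (pos_min e (y - x)) as (e1 & He1 & He1e & He1x); [lra..|].
  destruct (HAL k e1 0%nat ltac:(lia) He1) as (n & _ & Hn1 & Hn2).
  destruct (HAL k e1 (S n) ltac:(lia) He1) as (m & Hm & Hm1 & Hm2).
  destruct (odd_part_ge k n m ltac:(lia)) as (l1 & q1 & Hl1 & Em); [congruence|].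
  set (d1 := (2 ^ l1 * (2 * q1 + 1))%nat) in *.
  destruct (HR l1 ltac:(lia)) as (eta & N2 & Heta & H2).
  destruct (HAL (S l1) e1 N2 ltac:(lia) He1) as (n2 & Hn21 & Hn22 & Hn23).
  assert (Hout : forall q, s (n2 + 2 ^ l1 * (2 * q + 1)) < x - eta).
  { intros q. apply H2; [lia| |apply class_shift_out, Hn22].
    apply class_shift, (in_class_le l1 (S l1)); [lia|exact Hn22]. }
  pose proof (Hout q1) as Hn2d. fold d1 in Hn2d.
  (* Class points near [y] may stay below it, so [y] itself is reached by a detour: [[y-e,y]] covers
     [[x-eta,x]] in time [d1], where [e1 <= y - x] is used, and a point of the latter hits [y] in
     time [d2]. Taking [l > l1] keeps [d1 + d2] an odd multiple of [2^l1]. *)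
  destruct (Hreach eta Heta) as (K2 & HK2 & HKr2).
  set (l := (S l1 + K2 + K1)%nat). set (d2 := (2 ^ l * (2 * 0 + 1))%nat).
  destruct (HKr2 l 0%nat ltac:(unfold l; lia) (HR l ltac:(unfold l; lia))) as (w & Hw & Ew).
  fold d2 in Ew.
  assert (Ed : exists q, (d1 + d2 = 2 ^ l1 * (2 * q + 1))%nat).
  { exists (q1 + 2 ^ (K2 + K1))%nat. unfold d1, d2, l.
    replace (S l1 + K2 + K1)%nat with (l1 + S (K2 + K1))%nat by lia.
    rewrite Nat.pow_add_r, Nat.pow_succ_r'. lia. }
  destruct Ed as [q Ed].
  pose proof (Hout q) as Hn2d'. rewrite <- Ed in Hn2d'.
  destruct (cov_point f d1 (y - e) y (x - eta) x w (cd_cont HD)) as (w' & Hw' & Ew'); [|lra|].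
  { exists (s n2), (s n). rewrite <- (s_shift d1 n2), <- (s_shift d1 n), <- Em. repeat split; lra. }
  destruct (HKr l1 q ltac:(lia) (HR l1 ltac:(lia))) as (v & Hv & Ev).
  destruct (HKl l1 q ltac:(lia) (HR l1 ltac:(lia))) as (N3 & H3).
  destruct (class_below (S l1) ltac:(lia)) as (eta' & Heta' & Hb).
  destruct (Hb N3) as (n3 & Hn31 & Hn32 & Hn33).
  destruct (H3 n3 Hn31 Hn32) as (u & Hu & Eu).
  destruct (pos_min eta eta' Heta Heta') as (r & Hr & B1 & B2).
  destruct (pos_min e r He Hr) as (e' & He' & B3 & B4).
  exists e', (d1 + d2)%nat. split; [lra|].
  split; [unfold d2; pose proof (pow2_pos l); nia|].
  intros [|]; unfold lo, hi.
  - exists u, v. rewrite Ed, Eu, Ev. repeat split; lra.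
  - exists (s n2), w'. rewrite <- (s_shift (d1 + d2) n2), (Nat.add_comm d1 d2), iter_add, Ew', Ew.
    rewrite (Nat.add_comm d2 d1). repeat split; lra.
Qed.

Lemma shadows_of_left_class_data : shadows f x y.
Proof. destruct (classic approach_right); [apply shadows_right|apply shadows_left]; assumption. Qed.
End ClassData.

Lemma class_data_refl f x y z c : class_data f x y z c ->
  class_data (refl f) (1 - y) (1 - x) (1 - z) c.
Proof.
  assert (E : forall n, iter (refl f) n (1 - z) = 1 - iter f n z).
  { intros n. rewrite iter_refl. do 2 f_equal. lra. }
  intros [H1 H2 H3 H4 H5 H6 H7 H8]. split; auto.
  - apply continuity_refl, H1.
  - lra.
  - intros d Hd. destruct (H5 d Hd) as [k0 Hk]. exists k0. intros k Hk'.
    destruct (Hk k Hk') as [N HN]. exists N. intros n Hn Hc. rewrite E. specialize (HN n Hn Hc). lra.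
  - intros k d N Hk Hd. destruct (H7 k d N Hk Hd) as (n & Hn & Hc & Hs). exists n.
    rewrite E. repeat split; auto; lra.
  - intros k d N Hk Hd. destruct (H6 k d N Hk Hd) as (n & Hn & Hc & Hs). exists n.
    rewrite E. repeat split; auto; lra.
  - intros k Hk. destruct (H8 k Hk) as [(e & N & He & H)|(e & N & He & H)]; [right|left];
      exists e, N; (split; [exact He|]); intros n Hn Hc Hc'; rewrite E; specialize (H n Hn Hc Hc'); lra.
Qed.

Theorem class_data_shadows f x y z c : class_data f x y z c -> shadows f x y.
Proof.
  intros HD.
  destruct (classic (forall K, exists l, (K <= l)%nat /\ left_at f x z c l)) as [HL|HL].
  - exact (shadows_of_left_class_data f x y z c HD HL).
  - apply shadows_refl, (shadows_of_left_class_data _ _ _ (1 - z) c (class_data_refl _ _ _ _ _ HD)).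
    apply not_all_ex_not in HL. destruct HL as [K0 HL].
    intros K. exists (S (K + K0)). split; [lia|].
    destruct (cd_side _ _ _ _ _ HD (S (K + K0)) ltac:(lia)) as [Hl|(e & N & He & H)].
    { exfalso. apply HL. exists (S (K + K0)). split; [lia|exact Hl]. }
    exists e, N. split; [exact He|]. intros n Hn Hc Hc'. rewrite iter_refl.
    replace (1 - (1 - z)) with z by lra. specialize (H n Hn Hc Hc'). lra.
Qed.

(** * Periodic portions *)

Lemma omega_class f z q i a :
  omega (iter f q) (iter f i z) a <-> climit (fun m => iter f (q * m + i) z) a.
Proof.
  assert (E : forall n, iter (iter f q) n (iter f i z) = iter f (q * n + i) z).
  { intros n. rewrite iter_mul, iter_add. reflexivity. }
  split; intros H eps He N; destruct (H eps He N) as (n & Hn & Hn'); exists n;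
    (split; [exact Hn|]); [rewrite <- E|rewrite E]; exact Hn'.
Qed.

Lemma omega_class_refine f z k i a : omega (iter f (2 ^ S k)) (iter f i z) a ->
  omega (iter f (2 ^ k)) (iter f (i mod 2 ^ k) z) a.
Proof.
  intros H. apply omega_class. apply omega_class in H. intros eps He N.
  destruct (H eps He N) as (n & Hn & Hn').
  exists (2 * n + i / 2 ^ k)%nat. split; [lia|].
  pose proof (Nat.div_mod_eq i (2 ^ k)) as E. rewrite Nat.pow_succ_r' in Hn'.
  replace (2 ^ k * (2 * n + i / 2 ^ k) + i mod 2 ^ k)%nat with (2 * 2 ^ k * n + i)%nat by nia.
  exact Hn'.
Qed.

Lemma Jint_refine f z k i t : Jint f z (S k) i t -> Jint f z k (i mod 2 ^ k) t.
Proof.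
  intros (a & b & Ha & Hb & H). exists a, b. repeat split; try apply H; apply omega_class_refine; assumption.
Qed.

Lemma Jint_convex f z k i t1 t t2 : Jint f z k i t1 -> Jint f z k i t2 -> t1 <= t <= t2 -> Jint f z k i t.
Proof.
  intros (a1 & b1 & Ha1 & Hb1 & H1) (a2 & b2 & Ha2 & Hb2 & H2) H. exists a1, b2.
  repeat split; auto; lra.
Qed.

Section Infinite.
Variables (f : R -> R) (z : R).
Hypothesis Hf : tame f.
Hypothesis Hz : inI z.
Hypothesis Hinf : infinite_set (omega f z).

Lemma omega_nonempty q i : exists a, omega (iter f q) (iter f i z) a.
Proof.
  destruct (climit_exists (fun m => iter f (q * m + i) z) 0 1) as (a & Ha & _).
  - intros N. exists N. split; [lia|]. apply (tame_iter_inI f _ z Hf Hz).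
  - exists a. apply omega_class, Ha.
Qed.

(** If this orbit of [f^q] converged to [l], every limit point of [z] would be among the first [q]
    iterates of [l]. *)
Lemma infinite_omega_diverges q i : (0 < q)%nat ->
  ~ converges (fun n => iter (iter f q) n (iter f i z)).
Proof.
  intros Hq [l Hl].
  destruct (Hinf (map (fun j => iter f j l) (seq 0 q))) as (v & Hv & Hnv).
  assert (K : forall Q, (Q <= q)%nat -> exists d N, 0 < d /\ forall m j, (m >= N)%nat -> (j < Q)%nat ->
    d <= Rabs (iter f (j + (q * m + i)) z - v)).
  { induction Q as [|Q IH]; intros HQ; [exists 1, 0%nat; split; [lra|lia]|].
    destruct (IH ltac:(lia)) as (d1 & N1 & Hd1 & H1).
    assert (Hne : iter f Q l <> v).
    { intros E. apply Hnv, in_map_iff. exists Q. split; [exact E|]. apply in_seq. lia. }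
    set (d2 := Rabs (iter f Q l - v) / 2).
    assert (Hd2 : 0 < d2) by (unfold d2; assert (0 < Rabs (iter f Q l - v)) by (apply Rabs_pos_lt; lra); lra).
    destruct (continuity_eps (iter f Q) l d2 (iter_continuity f Q (proj1 Hf)) Hd2) as (e & He & H2).
    destruct (Hl e He) as [N2 HN2].
    exists (Rmin d1 d2), (N1 + N2)%nat. split; [apply Rmin_pos; lra|].
    intros m j Hm Hj. destruct (Nat.eq_dec j Q) as [->|Hne'].
    - eapply Rle_trans; [apply Rmin_r|]. specialize (HN2 m ltac:(lia)). unfold Rdist in HN2.
      rewrite iter_mul, <- iter_add in HN2. specialize (H2 _ HN2). rewrite <- iter_add in H2.
      assert (T : Rabs (iter f Q l - v) <=
        Rabs (iter f (Q + (q * m + i)) z - iter f Q l) + Rabs (iter f (Q + (q * m + i)) z - v)).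
      { rewrite (Rabs_minus_sym _ (iter f Q l)).
        eapply Rle_trans; [|apply Rabs_triang]. right. f_equal. lra. }
      unfold d2 in *. lra.
    - eapply Rle_trans; [apply Rmin_l|]. apply H1; lia. }
  destruct (K q ltac:(lia)) as (d & N & Hd & H).
  destruct (Hv d Hd (i + q * (N + 1))%nat) as (n & Hn & Hn').
  pose proof (Nat.div_mod_eq (n - i) q) as E.
  pose proof (Nat.mod_upper_bound (n - i) q ltac:(lia)).
  assert ((n - i) / q >= N)%nat.
  { apply Nat.div_le_lower_bound; [lia|]. nia. }
  specialize (H ((n - i) / q)%nat ((n - i) mod q)%nat ltac:(lia) ltac:(lia)).
  replace ((n - i) mod q + (q * ((n - i) / q) + i))%nat with n in H by nia. lra.
Qed.

(** [alternation] for [f^(2^k)], with [b] recording which parity of the block index lies on the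
    left. *)
Lemma level_split k i : exists p e N b, 0 < e /\ forall M, (M >= N)%nat ->
  if Bool.eqb (Nat.even M) b then iter f (2 ^ k * M + i) z < p - e
  else p + e < iter f (2 ^ k * M + i) z.
Proof.
  pose proof (pow2_pos k) as Hp.
  destruct (alternation (iter f (2 ^ k)) (iter f i z)) as (p & e & N & He & H).
  { apply tame_iter; assumption. }
  { apply tame_iter_inI; assumption. }
  { apply infinite_omega_diverges, Hp. }
  exists p, e, N, (Nat.even N). split; [exact He|]. intros M HM.
  assert (E : forall n, iter f (2 ^ k * n + i) z = iter (iter f (2 ^ k)) n (iter f i z)).
  { intros n. rewrite iter_mul, iter_add. reflexivity. }
  rewrite E. destruct (Nat.Even_or_Odd (M - N)) as [[m Hm]|[m Hm]].
  - replace M with (N + 2 * m)%nat by lia. rewrite Nat.even_add, Nat.even_mul. simpl Nat.even.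
    replace (Bool.eqb (Bool.eqb (Nat.even N) (true || Nat.even m)) (Nat.even N)) with true
      by (destruct (Nat.even N); reflexivity).
    apply H.
  - replace M with (S (N + 2 * m)) by lia. rewrite Nat.even_succ, <- Nat.negb_even, Nat.even_add, Nat.even_mul.
    replace (Bool.eqb (negb (Bool.eqb (Nat.even N) (Nat.even 2 || Nat.even m))) (Nat.even N)) with false
      by (destruct (Nat.even N); reflexivity).
    apply H.
Qed.

Lemma half_class_side k i p e N b a : 0 < e ->
  (forall M, (M >= N)%nat ->
    if Bool.eqb (Nat.even M) b then iter f (2 ^ k * M + i mod 2 ^ k) z < p - e
    else p + e < iter f (2 ^ k * M + i mod 2 ^ k) z) ->
  omega (iter f (2 ^ S k)) (iter f i z) a ->
  if Bool.eqb (Nat.even (i / 2 ^ k)) b then a <= p - e else p + e <= a.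
Proof.
  intros He H Ha. apply omega_class in Ha.
  assert (E : forall m, iter f (2 ^ S k * m + i) z = iter f (2 ^ k * (2 * m + i / 2 ^ k) + i mod 2 ^ k) z).
  { intros m. f_equal. rewrite Nat.pow_succ_r'. pose proof (Nat.div_mod_eq i (2 ^ k)). nia. }
  assert (Ev : forall m, Nat.even (2 * m + i / 2 ^ k) = Nat.even (i / 2 ^ k)).
  { intros m. rewrite Nat.even_add, Nat.even_mul. simpl. destruct Nat.even; reflexivity. }
  destruct (Bool.eqb (Nat.even (i / 2 ^ k)) b) eqn:Eb.
  - apply (climit_le _ _ _ Ha). exists N. intros n Hn. rewrite E.
    specialize (H (2 * n + i / 2 ^ k)%nat ltac:(lia)). rewrite Ev, Eb in H. lra.
  - apply (climit_ge _ _ _ Ha). exists N. intros n Hn. rewrite E.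
    specialize (H (2 * n + i / 2 ^ k)%nat ltac:(lia)). rewrite Ev, Eb in H. lra.
Qed.

Lemma bit_lt2 k i : (i < 2 ^ S k)%nat -> (i / 2 ^ k < 2)%nat.
Proof.
  intros H. apply Nat.Div0.div_lt_upper_bound. rewrite Nat.pow_succ_r' in H. lia.
Qed.

Lemma even_mod2 m : Nat.even (m mod 2) = Nat.even m.
Proof.
  rewrite (Nat.div_mod_eq m 2) at 2. rewrite Nat.even_add, Nat.even_mul.
  change (Nat.even 2) with true. destruct (Nat.even (m mod 2)); reflexivity.
Qed.

Lemma even_inj a b : (a < 2)%nat -> (b < 2)%nat -> a <> b -> Nat.even a = negb (Nat.even b).
Proof. intros. destruct a as [|[|]], b as [|[|]]; try lia; reflexivity. Qed.

Lemma Jint_disjoint k i j t : (i < 2 ^ k)%nat -> (j < 2 ^ k)%nat -> i <> j ->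
  Jint f z k i t -> Jint f z k j t -> False.
Proof.
  revert i j. induction k as [|k IH]; intros i j Hi Hj Hij Ji Jj; [simpl in *; lia|].
  pose proof (pow2_pos k) as Hp.
  destruct (Nat.eq_dec (i mod 2 ^ k) (j mod 2 ^ k)) as [E|Hne].
  - destruct (level_split k (i mod 2 ^ k)) as (p & e & N & b & He & H).
    assert (H' := H). rewrite E in H'.
    destruct Ji as (a1 & b1 & Ha1 & Hb1 & H1), Jj as (a2 & b2 & Ha2 & Hb2 & H2).
    assert (Hbits : (i / 2 ^ k <> j / 2 ^ k)%nat).
    { intros E'. apply Hij. rewrite (Nat.div_mod_eq i (2 ^ k)), (Nat.div_mod_eq j (2 ^ k)), E, E'.
      reflexivity. }
    pose proof (even_inj _ _ (bit_lt2 k i Hi) (bit_lt2 k j Hj) Hbits) as Ee.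
    pose proof (half_class_side k i p e N b a1 He H Ha1) as S1.
    pose proof (half_class_side k i p e N b b1 He H Hb1) as S2.
    pose proof (half_class_side k j p e N b a2 He H' Ha2) as S3.
    pose proof (half_class_side k j p e N b b2 He H' Hb2) as S4.
    rewrite Ee in S1, S2. destruct (Nat.even (j / 2 ^ k)), b; simpl in *; lra.
  - apply (IH (i mod 2 ^ k)%nat (j mod 2 ^ k)%nat); auto using Jint_refine.
    + apply Nat.mod_upper_bound; lia.
    + apply Nat.mod_upper_bound; lia.
Qed.

Variable ik : nat -> nat.
Hypothesis Hnest : nested_seq f z ik.

(** The inclusion of portions determines the residue of the index, because distinct portions of the
    same level are disjoint. *)
Lemma nested_mod k : (1 <= k)%nat -> (ik (S k) mod 2 ^ k = ik k)%nat.
Proof.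
  intros Hk. apply NNPP. intros Hne. destruct Hnest as [Hb Hn].
  destruct (omega_nonempty (2 ^ S k) (ik (S k))) as [a Ha].
  assert (J : Jint f z (S k) (ik (S k)) a) by (exists a, a; repeat split; auto; lra).
  apply (Jint_disjoint k (ik (S k) mod 2 ^ k)%nat (ik k) a); auto.
  - apply Nat.mod_upper_bound. pose proof (pow2_pos k). lia.
  - apply Jint_refine, J.
Qed.

Lemma omega_class_mono k l a : (1 <= k <= l)%nat -> omega (iter f (2 ^ l)) (iter f (ik l) z) a ->
  omega (iter f (2 ^ k)) (iter f (ik k) z) a.
Proof.
  intros [Hk Hl]. induction Hl as [|l Hl IH]; [auto|]. intros H. apply IH.
  rewrite <- (nested_mod l) by lia. apply omega_class_refine, H.
Qed.

(** This excludes the alternative of [nonseparable] with the endpoints reversed, where the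
    intersection would be empty. *)
Lemma Jint_common_point : exists t, forall k, (k >= 1)%nat -> Jint f z k (ik k) t.
Proof.
  destruct (choice_function _ (fun k => omega_nonempty (2 ^ k) (ik k))) as [a Ha].
  destruct (climit_exists a 0 1) as (l & Hl & _).
  { intros N. exists N. split; [lia|].
    apply (om_bounds (iter f (2 ^ N)) (iter f (ik N) z)); [|apply tame_iter_inI; assumption|apply Ha].
    apply tame_iter; [apply pow2_pos|exact Hf]. }
  exists l. intros k Hk.
  assert (Ho : omega (iter f (2 ^ k)) (iter f (ik k) z) l).
  { intros eps He N. destruct (Hl (eps / 2) ltac:(lra) k) as (j & Hj & Hj').
    destruct (omega_class_mono k j (a j) ltac:(lia) (Ha j) (eps / 2) ltac:(lra) N) as (n & Hn & Hn').
    exists n. split; [exact Hn|].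
    set (u := iter (iter f (2 ^ k)) n (iter f (ik k) z)) in *.
    replace (u - l) with ((u - a j) + (a j - l)) by lra.
    eapply Rle_lt_trans; [apply Rabs_triang|]. lra. }
  exists l, l. repeat split; auto; lra.
Qed.

Lemma in_class_decomp k n : in_class ik k n -> n = (2 ^ k * (n / 2 ^ k) + ik k)%nat.
Proof. unfold in_class. intros <-. apply Nat.div_mod_eq. Qed.

Lemma class_in k m : (1 <= k)%nat -> in_class ik k (2 ^ k * m + ik k).
Proof.
  intros Hk. unfold in_class. rewrite Nat.add_comm, mod_pow2_add_mul by lia.
  apply Nat.mod_small, (proj1 Hnest k Hk).
Qed.

Lemma class_eventually_avoids k a b :
  (forall t, omega (iter f (2 ^ k)) (iter f (ik k) z) t -> ~ (a <= t <= b)) ->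
  exists N, forall n, (n >= N)%nat -> in_class ik k n -> ~ (a <= iter f n z <= b).
Proof.
  intros H. apply NNPP. intros Hno.
  destruct (climit_exists (fun m => iter f (2 ^ k * m + ik k) z) a b) as (t & Ht & Ht').
  - intros N. apply NNPP. intros Hno'. apply Hno. exists (2 ^ k * N + ik k)%nat.
    intros n Hn Hc Hab. apply Hno'. exists (n / 2 ^ k)%nat.
    apply in_class_decomp in Hc. rewrite <- Hc. split; [pose proof (pow2_pos k); nia|exact Hab].
  - apply omega_class in Ht. exact (H t Ht Ht').
Qed.

Lemma nested_class_data x y : x < y ->
  (forall t, (forall k, (k >= 1)%nat -> Jint f z k (ik k) t) <-> x <= t <= y) ->
  class_data f x y z ik.
Proof.
  intros Hxy HJ.
  assert (Jx : forall k, (k >= 1)%nat -> Jint f z k (ik k) x) by (apply HJ; lra).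
  assert (Jy : forall k, (k >= 1)%nat -> Jint f z k (ik k) y) by (apply HJ; lra).
  assert (Jmono : forall k l t, (1 <= k <= l)%nat -> Jint f z l (ik l) t -> Jint f z k (ik k) t).
  { intros k l t Hkl (a & b & Ha & Hb & H). exists a, b.
    repeat split; try apply H; apply (omega_class_mono k l); assumption. }
  assert (Jout : forall u, ~ (x <= u <= y) -> exists k0, (1 <= k0)%nat /\
    forall k, (k0 <= k)%nat -> ~ Jint f z k (ik k) u).
  { intros u Hu. apply NNPP. intros Hno. apply Hu, HJ. intros k Hk. apply NNPP. intros Hnj.
    apply Hno. exists k. split; [exact Hk|]. intros l Hl J. apply Hnj, (Jmono k l); [lia|exact J]. }
  split.
  - apply Hf.
  - exact Hxy.
  - intros k Hk. apply (proj1 Hnest k Hk).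
  - exact nested_mod.
  - intros d Hd.
    destruct (Jout (x - d) ltac:(lra)) as (k1 & Hk1 & H1).
    destruct (Jout (y + d) ltac:(lra)) as (k2 & Hk2 & H2).
    exists (k1 + k2)%nat. intros k Hk. specialize (H1 k ltac:(lia)). specialize (H2 k ltac:(lia)).
    destruct (class_eventually_avoids k 0 (x - d)) as [N1 A1].
    { intros a Ha Ha'. apply H1, (Jint_convex f z k (ik k) a _ x);
        [exists a, a; repeat split; auto; lra|apply Jx; lia|lra]. }
    destruct (class_eventually_avoids k (y + d) 1) as [N2 A2].
    { intros a Ha Ha'. apply H2, (Jint_convex f z k (ik k) y _ a);
        [apply Jy; lia|exists a, a; repeat split; auto; lra|lra]. }
    exists (N1 + N2)%nat. intros n Hn Hc. pose proof (tame_iter_inI f n z Hf Hz) as [I0 I1].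
    specialize (A1 n ltac:(lia) Hc). specialize (A2 n ltac:(lia) Hc). lra.
  - intros k d N Hk Hd. destruct (Jx k Hk) as (a & b0 & Ha & _ & Hax).
    apply omega_class in Ha. destruct (Ha d Hd N) as (m & Hm & Hm'). apply Rabs_def2 in Hm'.
    exists (2 ^ k * m + ik k)%nat. split; [pose proof (pow2_pos k); nia|].
    split; [apply class_in, Hk|lra].
  - intros k d N Hk Hd. destruct (Jy k Hk) as (a0 & b & _ & Hb & Hby).
    apply omega_class in Hb. destruct (Hb d Hd N) as (m & Hm & Hm'). apply Rabs_def2 in Hm'.
    exists (2 ^ k * m + ik k)%nat. split; [pose proof (pow2_pos k); nia|].
    split; [apply class_in, Hk|lra].
  (* Class [k+1] has a limit point at most [x] and another at least [y], both on the same side of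
     [p]. Hence [p] lies outside [[x,y]], and the sibling, across [p], lies beyond the endpoint. *)
  - intros k Hk. destruct (level_split k (ik k)) as (p & e & N & b & He & H).
    assert (H' := H). rewrite <- (nested_mod k Hk) in H'.
    destruct (Jx (S k) ltac:(lia)) as (a1 & b0 & Ha1 & _ & Hax).
    destruct (Jy (S k) ltac:(lia)) as (a0 & b1 & _ & Hb1 & Hby).
    pose proof (half_class_side k (ik (S k)) p e N b a1 He H' Ha1) as S1.
    pose proof (half_class_side k (ik (S k)) p e N b b1 He H' Hb1) as S2.
    assert (Hother : forall n, (n >= 2 ^ k * N + ik k)%nat -> in_class ik k n -> ~ in_class ik (S k) n ->
      if Bool.eqb (negb (Nat.even (ik (S k) / 2 ^ k))) b then iter f n z < p - e else p + e < iter f n z).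
    { intros n Hn Hc Hc'. pose proof (in_class_decomp k n Hc) as En.
      specialize (H (n / 2 ^ k)%nat ltac:(pose proof (pow2_pos k); nia)). rewrite <- En in H.
      replace (negb (Nat.even (ik (S k) / 2 ^ k))) with (Nat.even (n / 2 ^ k)); [exact H|].
      pose proof (bit_lt2 k (ik (S k)) (proj1 Hnest (S k) ltac:(lia))) as Hb2.
      rewrite <- even_mod2. apply even_inj; [apply Nat.mod_upper_bound; lia|exact Hb2|].
      intros E. apply Hc'. unfold in_class in *.
      rewrite mod_pow2_S, Hc, E, <- (nested_mod k Hk). symmetry.
      rewrite Nat.add_comm. apply Nat.div_mod_eq. }
    destruct (Nat.even (ik (S k) / 2 ^ k)), b; simpl in S1, S2, Hother;
      [right|left|left|right]; exists e, (2 ^ k * N + ik k)%nat; (split; [exact He|]);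
      intros n Hn Hc Hc'; specialize (Hother n Hn Hc Hc'); lra.
Qed.
End Infinite.

Theorem nonseparable_shadows f x y : tame f -> x < y -> nonseparable f x y -> shadows f x y.
Proof.
  intros Hf Hxy (_ & z & Hz & Hinf & ik & Hnest & [HJ|HJ]).
  - exact (class_data_shadows f x y z ik (nested_class_data f z Hf Hz Hinf ik Hnest x y Hxy HJ)).
  - destruct (Jint_common_point f z Hf Hz Hinf ik Hnest) as [t Ht]. apply HJ in Ht. lra.
Qed.

(** * Independent pairs and periodic points *)

(** Finite independence with two extra demands: starting points in [K], and gaps longer than [G].
    Only the first [m] terms of the sequence matter. *)
Definition indep (K : R -> Prop) (g : R -> R) (x y : R) : Prop :=
  forall eps m G, eps > 0 -> exists t : nat -> nat, (forall j, (t j + G < t (S j))%nat) /\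
    forall s : nat -> bool, exists w, K w /\ forall j, (j < m)%nat ->
      Rabs (iter g (t j) w - (if s j then x else y)) < eps.

Record indep_system (f : R -> R) (x y : R) : Prop := {
  is_tame : tame f;
  is_x : inI x;
  is_y : inI y;
  is_lt : x < y;
  is_indep : forall q, (0 < q)%nat -> indep inI (iter f q) x y
}.
Arguments is_tame {f x y}.
Arguments is_lt {f x y}.
Arguments is_indep {f x y}.

Lemma indep_refl K g x y : indep K g x y ->
  indep (fun t => K (1 - t)) (refl g) (1 - y) (1 - x).
Proof.
  intros H eps m G He. destruct (H eps m G He) as (t & Ht & H'). exists t. split; [exact Ht|].
  intros s. destruct (H' (fun j => negb (s j))) as (w & Kw & Hw). exists (1 - w). split.
  - replace (1 - (1 - w)) with w by lra. exact Kw.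
  - intros j Hj. specialize (Hw j Hj). rewrite iter_refl. rewrite <- Rabs_Ropp.
    replace (1 - (1 - w)) with w by lra.
    destruct (s j); simpl in Hw;
    match goal with |- Rabs ?a < _ => match type of Hw with Rabs ?b < _ =>
      replace a with b by lra end end; exact Hw.
Qed.

Lemma indep_sub (K K' : R -> Prop) g x y : (forall t, K t -> K' t) -> indep K g x y -> indep K' g x y.
Proof.
  intros HK H eps m G He. destruct (H eps m G He) as (t & Ht & H'). exists t. split; [exact Ht|].
  intros s. destruct (H' s) as (w & Kw & Hw). exists w. auto.
Qed.

Lemma indep_ext K (g h : R -> R) x y : (forall n t, iter g n t = iter h n t) ->
  indep K g x y -> indep K h x y.
Proof.
  intros E H eps m G He. destruct (H eps m G He) as (t & Ht & H'). exists t. split; [exact Ht|].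
  intros s. destruct (H' s) as (w & Kw & Hw). exists w. split; [exact Kw|].
  intros j Hj. rewrite <- E. auto.
Qed.

Lemma indep_system_refl f x y : indep_system f x y -> indep_system (refl f) (1 - y) (1 - x).
Proof.
  intros [H1 H2 H3 H4 H5]. split.
  - apply tame_refl, H1.
  - unfold inI in *; lra.
  - unfold inI in *; lra.
  - lra.
  - intros q Hq. specialize (H5 q Hq). apply indep_refl in H5.
    apply (indep_sub _ inI) in H5; [|intros t; unfold inI; lra].
    apply (indep_ext _ _ (iter (refl f) q)) in H5; [exact H5|].
    intros n t. rewrite iter_refl, !iter_mul, iter_refl. reflexivity.
Qed.

Lemma indep_system_indep f x y : indep_system f x y -> indep inI f x y.
Proof.
  intros H. apply (indep_ext _ (iter f 1)); [|apply (is_indep H); lia].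
  intros n t. rewrite iter_mul, Nat.mul_1_l. reflexivity.
Qed.

Lemma iter_later g (t : nat -> nat) i j w : (t i <= t j)%nat ->
  iter g (t j) w = iter g (t j - t i) (iter g (t i) w).
Proof. intros H. rewrite <- iter_add. f_equal. lia. Qed.

Lemma gap_mono t G : (forall j, (t j + G < t (S j))%nat) -> forall i j, (i < j)%nat -> (t i + G < t j)%nat.
Proof.
  intros H i j Hij. induction Hij as [|j Hij IH]; [apply H|]. specialize (H j). lia.
Qed.

Definition pat (l : list bool) (j : nat) : bool := nth j l true.

Definition near (x y e : R) (b : bool) (t : R) : Prop :=
  if b then x - e < t < x + e else y - e < t < y + e.

Lemma indep_three K g x y e G : indep K g x y -> 0 < e ->
  exists n d d', (G < d)%nat /\ (G < d')%nat /\ forall a b c : bool, exists w, K w /\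
    near x y e a (iter g n w) /\ near x y e b (iter g d (iter g n w)) /\
    near x y e c (iter g d' (iter g d (iter g n w))).
Proof.
  intros HI He. destruct (HI e 3%nat G He) as (t & Ht & H).
  pose proof (Ht 0%nat). pose proof (Ht 1%nat).
  exists (t 0%nat), (t 1%nat - t 0%nat)%nat, (t 2%nat - t 1%nat)%nat.
  split; [lia|]. split; [lia|]. intros a b c. destruct (H (pat [a; b; c])) as (w & Kw & Hw).
  exists w. split; [exact Kw|]. rewrite <- !iter_later by lia.
  pose proof (Hw 0%nat ltac:(lia)) as A. pose proof (Hw 1%nat ltac:(lia)) as B.
  pose proof (Hw 2%nat ltac:(lia)) as C. unfold pat in A, B, C. simpl nth in A, B, C.
  apply Rabs_def2 in A, B, C. unfold near. destruct a, b, c; lra.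
Qed.

(** Otherwise an interval [[a,b]] inside [(x,y)] covers a neighbourhood of [y], hence [d] steps
    later both itself and an interval [[c,c']] near [y]. The patterns make [[c,c']] cover [[a,b]]
    again: two loops. *)
Lemma no_cover_right f x y t1 t2 m : indep_system f x y -> x < t1 < y -> x < t2 < y ->
  iter f m t1 < y -> y < iter f m t2 -> False.
Proof.
  intros HS H1 H2 L1 L2. pose proof (is_tame HS) as (Hc & _ & HN).
  set (a := Rmin t1 t2). set (b := Rmax t1 t2).
  assert (Ha : x < a < y /\ a <= t1 /\ a <= t2) by (unfold a, Rmin; destruct Rle_dec; lra).
  assert (Hb : x < b < y /\ t1 <= b /\ t2 <= b) by (unfold b, Rmax; destruct Rle_dec; lra).
  destruct (pos_min (a - x) (y - b)) as (u & Hu & U1 & U2); [lra..|].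
  destruct (pos_min (y - iter f m t1) (iter f m t2 - y)) as (v & Hv & V1 & V2); [lra..|].
  destruct (pos_min (u / 2) (v / 2)) as (e & He & E1 & E2); [lra..|].
  destruct (indep_three _ f x y e 0 (indep_system_indep f x y HS) He) as (n & d & d' & _ & _ & H).
  destruct (H false true true) as (wA & _ & A0 & A1 & _).
  destruct (H false false true) as (wB & _ & B0 & B1 & B2).
  destruct (H false false false) as (wC & _ & C0 & C1 & C2). simpl in *.
  set (pA := iter f n wA) in *. set (pB := iter f n wB) in *. set (pC := iter f n wC) in *.
  set (c := Rmin (iter f d pB) (iter f d pC)). set (c' := Rmax (iter f d pB) (iter f d pC)).
  assert (Hcc : y - e < c /\ c <= iter f d pB <= c' /\ c <= iter f d pC <= c')
    by (unfold c, c', Rmin, Rmax; destruct Rle_dec; lra).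
  assert (Hm : cov f m a b (y - e) (y + e)) by (exists t1, t2; repeat split; lra).
  apply (HN a b a b c c' (d + m)%nat 0%nat d').
  - lra.
  - apply (cov_comp f m d a b (y - e) (y + e)); [exact Hc|exact Hm|].
    exists pA, pB. repeat split; lra.
  - apply (cov_comp f m d a b (y - e) (y + e)); [exact Hc|exact Hm|].
    assert (c' = iter f d pB \/ c' = iter f d pC) as [E|E]
      by (unfold c', Rmax; destruct Rle_dec; auto).
    + exists pA, pB. repeat split; lra.
    + exists pA, pC. repeat split; lra.
  - exists a, b. unfold iter; simpl. repeat split; lra.
  - exists (iter f d pB), (iter f d pC). repeat split; lra.
Qed.

Lemma no_cover_left f x y t1 t2 m : indep_system f x y -> x < t1 < y -> x < t2 < y ->
  iter f m t1 < x -> x < iter f m t2 -> False.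
Proof.
  intros HS H1 H2 L1 L2.
  apply (no_cover_right (refl f) (1 - y) (1 - x) (1 - t2) (1 - t1) m (indep_system_refl _ _ _ HS));
    rewrite ?iter_refl; try lra.
  - replace (1 - (1 - t2)) with t2 by lra. lra.
  - replace (1 - (1 - t1)) with t1 by lra. lra.
Qed.

(** If [f^j x] were inside, a small interval around it would receive, after [j] steps, the points
    near [x] of every pattern. It would then cover itself directly, and also through an interval
    near [x]. *)
Lemma endpoint_avoids f x y j : indep_system f x y -> ~ (x < iter f j x < y).
Proof.
  intros HS Hu. pose proof (is_tame HS) as (Hc & _ & HN). pose proof (is_lt HS) as Hxy.
  set (u := iter f j x) in *. set (a := (x + u) / 2). set (b := (u + y) / 2).
  assert (Hab : x < a < u /\ u < b < y) by (unfold a, b; lra).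
  destruct (pos_min (u - a) (b - u)) as (r & Hr & M1 & M2); [lra..|].
  destruct (continuity_eps (iter f j) x r (iter_continuity f j Hc) Hr) as (dl & Hdl & Hn).
  destruct (pos_min ((a - x) / 2) (y - b)) as (r' & Hr' & M3 & M4); [lra..|].
  destruct (pos_min dl r' Hdl Hr') as (e & He & E1 & E2).
  destruct (indep_three _ f x y e j (indep_system_indep f x y HS) He) as (n & d0 & d' & Hj & _ & H).
  destruct (H true true true) as (wA & _ & A0 & A1 & A2).
  destruct (H true true false) as (wB & _ & B0 & B1 & B2).
  destruct (H true false false) as (wC & _ & C0 & C1 & _).
  replace d0 with ((d0 - j) + j)%nat in A1, A2, B1, B2, C1 by lia.
  rewrite (iter_add f (d0 - j) j) in A1, A2, B1, B2, C1. simpl in *.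
  set (d := (d0 - j)%nat) in *.
  assert (Hnear : forall w, x - e < iter f n w < x + e -> a <= iter f j (iter f n w) <= b).
  { intros w Hw. specialize (Hn (iter f n w)). fold u in Hn.
    apply Rabs_def2 in Hn; [|apply Rabs_def1]; lra. }
  apply Hnear in A0, B0, C0.
  set (pA := iter f j (iter f n wA)) in *. set (pB := iter f j (iter f n wB)) in *.
  set (pC := iter f j (iter f n wC)) in *.
  set (c := Rmin (iter f d pA) (iter f d pB)). set (c' := Rmax (iter f d pA) (iter f d pB)).
  assert (Hcc : c' < x + e /\ c <= iter f d pA <= c' /\ c <= iter f d pB <= c')
    by (unfold c, c', Rmin, Rmax; destruct Rle_dec; lra).
  apply (HN a b c c' a b d d' 0%nat).
  - lra.
  - assert (c = iter f d pA /\ c' = iter f d pB \/ c = iter f d pB /\ c' = iter f d pA) as [[E E']|[E E']]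
      by (unfold c, c', Rmin, Rmax; destruct Rle_dec; auto).
    + exists pA, pB. repeat split; lra.
    + exists pB, pA. repeat split; lra.
  - exists pA, pC. repeat split; lra.
  - exists (iter f d pA), (iter f d pB). repeat split; lra.
  - exists a, b. unfold iter; simpl. repeat split; lra.
Qed.

Lemma endpoint_avoids_right f x y j : indep_system f x y -> ~ (x < iter f j y < y).
Proof.
  intros HS H. apply (endpoint_avoids (refl f) (1 - y) (1 - x) j (indep_system_refl _ _ _ HS)).
  rewrite iter_refl. replace (1 - (1 - y)) with y by lra. lra.
Qed.

(** All four transitions between the outer neighbourhoods of [x] and [y], in one common time. *)
Definition outer_returns (g : R -> R) (x y eps : R) : Prop := exists d,
  (exists p, x - eps < p < x /\ x - eps < iter g d p < x) /\
  (exists p, x - eps < p < x /\ y < iter g d p < y + eps) /\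
  (exists p, y < p < y + eps /\ x - eps < iter g d p < x) /\
  (exists p, y < p < y + eps /\ y < iter g d p < y + eps).

Lemma outer_returns_mono g x y e e' : e <= e' -> outer_returns g x y e -> outer_returns g x y e'.
Proof.
  intros He (d & (p1 & P1) & (p2 & P2) & (p3 & P3) & (p4 & P4)). exists d.
  split; [|split; [|split]]; [exists p1|exists p2|exists p3|exists p4]; lra.
Qed.

(** * Returns outside an interval with a fixed endpoint *)

Section Outer.
Variables (g : R -> R) (x y : R).
Hypothesis Hg : tame g.
Hypothesis Hxy : x < y.
Hypothesis Hx : g x = x.
Hypothesis HO : forall e, 0 < e -> outer_returns g x y e.

(** The left outer box covers a neighbourhood of [[x,y]], so whatever is reached from all such
    neighbourhoods is reached from the left box. *)
Lemma outer_reach (P : R -> Prop) :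
  (forall e, 0 < e -> exists m t, x - e <= t <= y + e /\ P (iter g m t)) ->
  forall e, 0 < e -> exists M s, x - e <= s <= x /\ P (iter g M s).
Proof.
  intros Hreach e He. destruct (HO e He) as (d & (p1 & P1 & Q1) & (p2 & P2 & Q2) & _).
  destruct (pos_min (x - iter g d p1) (iter g d p2 - y)) as (r & Hr & R1 & R2); [lra..|].
  destruct (Hreach r Hr) as (m & t & Ht & Hm).
  destruct (ivt_within (iter g d) (x - e) x p1 p2 t (iter_continuity g d (proj1 Hg)))
    as (s & Hs & Es); [lra..|].
  exists (m + d)%nat, s. split; [exact Hs|]. rewrite iter_add, Es. exact Hm.
Qed.

(** As [x] is fixed, images of small intervals [[x-e,x]] contain [[l,x]]. So [[l,x]] has one loop
    through [[g^d p1, x]] and one through [[y, g^d p2]], from where outer returns lead back to the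
    left of [x]. *)
Lemma outer_reach_left l : l < x ->
  (forall e, 0 < e -> exists m t, x - e <= t <= y + e /\ iter g m t <= l) -> False.
Proof.
  intros Hl Hreach. pose proof (proj1 Hg) as Hc.
  assert (R : forall e, 0 < e -> exists M, cov g M (x - e) x l x).
  { intros e He. destruct (outer_reach (fun t => t <= l) Hreach e He) as (M & s & Hs & Hl').
    exists M, s, x. rewrite (iter_fix g _ x Hx). repeat split; lra. }
  destruct (HO (x - l) ltac:(lra)) as (d & (p1 & P1 & Q1) & (p2 & P2 & Q2) & _).
  destruct (HO (iter g d p2 - y) ltac:(lra)) as (d2 & _ & _ & (p3 & P3 & Q3) & (p4 & P4 & Q4)).
  destruct (R (x - iter g d p1) ltac:(lra)) as [M1 C1].
  destruct (R (x - iter g d2 p3) ltac:(lra)) as [M2 C2].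
  destruct Hg as (_ & _ & HN).
  apply (HN l x (iter g d p1) x y (iter g d p2) d M1 (M2 + d2)%nat Hxy).
  - exists p1, x. rewrite (iter_fix g _ x Hx). repeat split; lra.
  - exists x, p2. rewrite (iter_fix g _ x Hx). repeat split; lra.
  - apply (cov_sub _ _ _ _ _ _ _ _ _ _ C1); lra.
  - apply (cov_comp g d2 M2 _ _ (x - (x - iter g d2 p3)) x); [exact Hc| |exact C2].
    exists p3, p4. repeat split; lra.
Qed.

Lemma outer_reach_right l : y < l ->
  (forall e, 0 < e -> exists m t, x - e <= t <= y + e /\ l <= iter g m t) -> False.
Proof.
  intros Hl Hreach. pose proof (proj1 Hg) as Hc.
  assert (R : forall e, 0 < e -> exists M, cov g M (x - e) x x l).
  { intros e He. destruct (outer_reach (fun t => l <= t) Hreach e He) as (M & s & Hs & Hl').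
    exists M, x, s. rewrite (iter_fix g _ x Hx). repeat split; lra. }
  destruct (HO (l - y) ltac:(lra)) as (d & _ & _ & (p1 & P1 & Q1) & (p2 & P2 & Q2)).
  destruct (HO (iter g d p2 - y) ltac:(lra)) as (d2 & _ & _ & (p3 & P3 & Q3) & (p4 & P4 & Q4)).
  destruct (R (x - iter g d p1) ltac:(lra)) as [M1 C1].
  destruct (R (x - iter g d2 p3) ltac:(lra)) as [M2 C2].
  destruct Hg as (_ & _ & HN).
  apply (HN x l (iter g d p1) x y (iter g d p2) d M1 (M2 + d2)%nat Hxy).
  - exists p1, x. rewrite (iter_fix g _ x Hx). repeat split; lra.
  - exists p1, p2. repeat split; lra.
  - apply (cov_sub _ _ _ _ _ _ _ _ _ _ C1); lra.
  - apply (cov_comp g d2 M2 _ _ (x - (x - iter g d2 p3)) x); [exact Hc| |exact C2].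
    exists p3, p4. repeat split; lra.
Qed.

(** Orbits starting near [[x,y]] stay near it, so [[x,y]] is invariant and no orbit
    can pass from the left of the fixed point [x] to the right of [y]. *)
Lemma outer_returns_absurd : False.
Proof.
  assert (HL : forall l, l < x -> exists e, 0 < e /\ forall m t, x - e <= t <= y + e -> l < iter g m t).
  { intros l Hl. apply NNPP. intros Hno. apply (outer_reach_left l Hl). intros e He.
    apply NNPP. intros Hno'. apply Hno. exists e. split; [exact He|]. intros m t Ht.
    apply Rnot_le_lt. intros Hle. apply Hno'. eauto. }
  assert (HR : forall l, y < l -> exists e, 0 < e /\ forall m t, x - e <= t <= y + e -> iter g m t < l).
  { intros l Hl. apply NNPP. intros Hno. apply (outer_reach_right l Hl). intros e He.
    apply NNPP. intros Hno'. apply Hno. exists e. split; [exact He|]. intros m t Ht.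
    apply Rnot_le_lt. intros Hle. apply Hno'. eauto. }
  assert (HK : forall t, x <= t <= y -> x <= g t <= y).
  { intros t Ht. split; apply Rnot_lt_le; intros Hlt.
    - destruct (HL (g t) Hlt) as (e & He & H). specialize (H 1%nat t ltac:(lra)).
      rewrite iter_1 in H. lra.
    - destruct (HR (g t) Hlt) as (e & He & H). specialize (H 1%nat t ltac:(lra)).
      rewrite iter_1 in H. lra. }
  destruct (continuity_eps g x (y - x) (proj1 Hg)) as (d & Hd & Hnear); [lra|].
  destruct (HL (x - d) ltac:(lra)) as (e & He & H).
  destruct (pos_min e d He Hd) as (r & Hr & R1 & R2).
  destruct (HO r Hr) as (n & _ & (p & Hp & Hp') & _).
  assert (Hstay : forall j, x - d < iter g j p <= y).
  { induction j as [|j IH].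
    - unfold iter; simpl. lra.
    - specialize (H (S j) p ltac:(lra)). split; [exact H|]. rewrite iter_S.
      destruct (Rlt_or_le (iter g j p) x) as [Hlt|Hge].
      + specialize (Hnear (iter g j p)). rewrite Rabs_left in Hnear by lra.
        specialize (Hnear ltac:(lra)). apply Rabs_def2 in Hnear. lra.
      + apply HK. lra. }
  specialize (Hstay n). lra.
Qed.
End Outer.

Lemma iter_invariant (K : R -> Prop) g n t : (forall t, K t -> K (g t)) -> K t -> K (iter g n t).
Proof. intros H Ht. induction n as [|n IH]; [exact Ht|]. rewrite iter_S. auto. Qed.

Definition prefix2 (a b : bool) (s : nat -> bool) (j : nat) : bool :=
  match j with O => a | S O => b | S (S j) => s j end.

Lemma outer_of_positions g x y e (t : nat -> nat) (w : bool -> bool -> R) :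
  e <= y - x -> (t 0 <= t 1)%nat ->
  (forall a b, Rabs (iter g (t 0%nat) (w a b) - (if a then x else y)) < e /\
               Rabs (iter g (t 1%nat) (w a b) - (if b then x else y)) < e /\
               ~ (x <= iter g (t 0%nat) (w a b) <= y) /\ ~ (x <= iter g (t 1%nat) (w a b) <= y)) ->
  outer_returns g x y e.
Proof.
  intros He Ht H. exists (t 1%nat - t 0%nat)%nat.
  assert (P : forall a b : bool, exists p, (if a then x - e < p < x else y < p < y + e) /\
    (if b then x - e < iter g (t 1%nat - t 0%nat) p < x
     else y < iter g (t 1%nat - t 0%nat) p < y + e)).
  { intros a b. exists (iter g (t 0%nat) (w a b)). rewrite <- iter_later by exact Ht.
    destruct (H a b) as (H0 & H1 & H2 & H3). apply Rabs_def2 in H0, H1. destruct a, b; lra. }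
  destruct (P true true) as (p1 & ?), (P true false) as (p2 & ?),
    (P false true) as (p3 & ?), (P false false) as (p4 & ?).
  split; [exists p1|split; [exists p2|split; [exists p3|exists p4]]]; tauto.
Qed.

(** Prefix two arbitrary entries to a pattern that cannot be realised from inside [[x,y]]. By
    invariance the orbit is outside at both of the first two times, and the four prefixes give the
    four outer transitions. *)
Lemma outer_or_inner g x y : x < y -> (forall t, x <= t <= y -> x <= g t <= y) -> indep inI g x y ->
  (forall e, 0 < e -> outer_returns g x y e) \/ indep (fun t => x <= t <= y) g x y.
Proof.
  intros Hxy HK HI.
  destruct (classic (forall e, 0 < e -> outer_returns g x y e)) as [|Hno]; [left; assumption|right].
  apply not_all_ex_not in Hno. destruct Hno as [e0 Hno]. apply imply_to_and in Hno.
  destruct Hno as [He0 Hno].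
  intros eps m G Heps.
  destruct (pos_min e0 (y - x)) as (r & Hr & R1 & R2); [lra..|].
  destruct (pos_min eps r Heps Hr) as (e & He & He1 & He2).
  destruct (HI e (S (S m)) G He) as (t & Ht & H').
  exists (fun j => (t (S (S j)) - t 1%nat)%nat).
  pose proof (gap_mono t G Ht) as Hm.
  split.
  { intros j. pose proof (Ht (S (S j))). pose proof (Hm 1%nat (S (S j)) ltac:(lia)). lia. }
  intros s. apply NNPP. intros Hno'. apply Hno, (outer_returns_mono g x y e); [lra|].
  destruct (choice_function _ (fun ab : bool * bool => H' (prefix2 (fst ab) (snd ab) s))) as [w Hw].
  pose proof (Ht 0%nat) as T0.
  apply (outer_of_positions g x y e t (fun a b => w (a, b))); [lra|lia|].
  intros a b. destruct (Hw (a, b)) as [_ Hab].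
  assert (Hout : ~ (x <= iter g (t 1%nat) (w (a, b)) <= y)).
  { intros Hin. apply Hno'. exists (iter g (t 1%nat) (w (a, b))). split; [exact Hin|].
    intros j Hj. rewrite <- iter_later by (pose proof (Hm 1%nat (S (S j)) ltac:(lia)); lia).
    eapply Rlt_le_trans; [apply (Hab (S (S j))); lia|exact He1]. }
  repeat split.
  - apply (Hab 0%nat). lia.
  - apply (Hab 1%nat). lia.
  - intros Hin. apply Hout. rewrite (iter_later g t 0 1) by lia.
    apply (iter_invariant (fun t => x <= t <= y)); assumption.
  - exact Hout.
Qed.

(** * Independence inside an invariant interval *)

Section Inner.
Variables (h : R -> R) (x y : R).
Hypothesis Hh : tame h.
Hypothesis Hxy : x < y.
Hypothesis HK : forall t, x <= t <= y -> x <= h t <= y.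
Hypothesis Hx : h x = x.
Hypothesis HI : indep (fun t => x <= t <= y) h x y.

Lemma inner_stay n t : x <= t <= y -> x <= iter h n t <= y.
Proof. apply (iter_invariant (fun t => x <= t <= y)), HK. Qed.

(** A preimage of [x] inside would be a barrier that keeps orbits near [x] from reaching [y] at late
    times; an orbit exactly at [x] stays there. *)
Lemma inner_no_bad t r : x < t < y -> iter h r t <> x.
Proof.
  intros Ht E. destruct (pos_min (t - x) (y - t)) as (e & He & B1 & B2); [lra..|].
  destruct (indep_three _ h x y e r HI He) as (n & d & d0 & Hd & _ & H).
  destruct (H true false true) as (w & Kw & W0 & W1 & _). simpl in W0, W1.
  pose proof (inner_stay n w Kw) as Kc. set (c := iter h n w) in *.
  destruct (Req_dec c x) as [Ec|Hne].
  - rewrite Ec, (iter_fix h _ x Hx) in W1. lra.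
  - pose proof (trap_right h x t c r d Hh Hx ltac:(lra) E ltac:(lia)). lra.
Qed.

(** Late visits near [y] force the maximum of [h^2] on [[x,y]] to be [y]. If [h y = x], it is
    attained at an interior point, whose third image is [x], against [inner_no_bad]. *)
Lemma inner_right_fixed : h y = x \/ h y = y -> h y = y.
Proof.
  intros [Hy|]; [exfalso|assumption].
  destruct (continuity_ab_maj (iter h 2) x y) as (t & Hmax & Ht); [lra|intros; apply iter_continuity, Hh|].
  assert (Et : iter h 2 t = y).
  { apply Rle_antisym; [apply inner_stay, Ht|]. apply Rnot_lt_le. intros Hlt.
    destruct (indep_three _ h x y (y - iter h 2 t) 1 HI ltac:(lra)) as (n & d & d0 & Hd & _ & H).
    destruct (H true false true) as (w & Kw & _ & W1 & _). unfold near in W1.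
    replace d with (2 + (d - 2))%nat in W1 by lia. rewrite iter_add in W1.
    specialize (Hmax _ (inner_stay (d - 2) _ (inner_stay n w Kw))). lra. }
  assert (E2 : forall u, iter h 2 u = h (h u)) by reflexivity.
  destruct (Req_dec t x) as [->|Hnx]; [rewrite E2, Hx, Hx in Et; lra|].
  destruct (Req_dec t y) as [->|Hny]; [rewrite E2, Hy, Hx in Et; lra|].
  apply (inner_no_bad t 3%nat ltac:(lra)). rewrite iter_S, Et. exact Hy.
Qed.

(** An orbit passing from [x] to [y] makes an increasing step just before [y]; as it
    comes back to [x] later, there is no fixed point in between. *)
Lemma inner_mid_up : (forall t, x < t < y -> h t <> y) -> (x + y) / 2 < h ((x + y) / 2).
Proof.
  intros Hby. set (m := (x + y) / 2).
  assert (Hm : x < m < y) by (unfold m; lra).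
  destruct (continuity_ab_maj h x m) as (t & Hmax & Ht); [lra|intros; apply Hh|].
  assert (Hty : h t < y).
  { destruct (HK t ltac:(lra)) as [_ [Hlt|E]]; [exact Hlt|exfalso].
    destruct (Req_dec t x) as [->|Hne]; [lra|]. apply (Hby t); [lra|exact E]. }
  destruct (pos_min (y - h t) ((y - x) / 4)) as (e & He & B1 & B2); [lra..|].
  destruct (indep_three _ h x y e 0 HI He) as (n & d & d' & _ & _ & H).
  destruct (H true false true) as (w & Kw & W0 & W1 & W2). simpl in W0, W1, W2.
  pose proof (inner_stay n w Kw) as Kc. set (c := iter h n w) in *.
  destruct (first_index_gen (fun i => y - e < iter h i c) d) as (i & Hi & Hi1 & Hi2);
    [unfold iter; simpl; unfold m in *; lra|lra|].
  rewrite iter_S in Hi1. specialize (Hi2 i ltac:(lia)).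
  set (u := iter h i c) in *. pose proof (inner_stay i c Kc) as Ku. fold u in Ku.
  assert (Hmu : m < u).
  { apply Rnot_le_lt. intros Hle. specialize (Hmax u ltac:(lra)). lra. }
  destruct (last_fixed_below h x u (proj1 Hh)) as (z & Hz & Ez & Hup); [lra..|].
  destruct (Rlt_or_le z m) as [Hzm|Hzm]; [apply Hup; lra|exfalso].
  pose proof (no_return_below_fixed h z u (d' + d - i) Hh Ez ltac:(lra) Hup) as K.
  unfold u in K. rewrite <- iter_add in K.
  replace (d' + d - i + i)%nat with (d' + d)%nat in K by lia. rewrite iter_add in K.
  unfold m in *. lra.
Qed.
End Inner.

(** By [inner_mid_up] and its mirror image the midpoint would move both up and down. *)
Lemma inner_absurd h x y : tame h -> x < y -> (forall t, x <= t <= y -> x <= h t <= y) ->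
  h x = x -> h y = x \/ h y = y -> indep (fun t => x <= t <= y) h x y -> False.
Proof.
  intros Hh Hxy HK Hx Hy HI.
  apply (inner_right_fixed h x y Hh Hxy HK Hx HI) in Hy.
  assert (HK' : forall t, 1 - y <= t <= 1 - x -> 1 - y <= refl h t <= 1 - x).
  { intros t Ht. specialize (HK (1 - t) ltac:(lra)). unfold refl. lra. }
  assert (Hx' : refl h (1 - y) = 1 - y).
  { unfold refl. replace (1 - (1 - y)) with y by lra. lra. }
  assert (HI' : indep (fun t => 1 - y <= t <= 1 - x) (refl h) (1 - y) (1 - x)).
  { apply indep_refl in HI. eapply indep_sub; [|exact HI]. intros t. simpl. lra. }
  pose proof (inner_mid_up h x y Hh Hxy HK Hx HI) as U1.
  pose proof (inner_mid_up (refl h) (1 - y) (1 - x) (tame_refl h Hh) ltac:(lra) HK' Hx' HI') as U2.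
  assert (N1 : forall t, x < t < y -> h t <> y).
  { intros t Ht E.
    apply (inner_no_bad (refl h) (1 - y) (1 - x) (tame_refl h Hh) HK' Hx' HI' (1 - t) 1); [lra|].
    rewrite iter_1. unfold refl. replace (1 - (1 - t)) with t by lra. lra. }
  specialize (U1 N1). unfold refl in U2.
  replace (1 - (1 - y + (1 - x)) / 2) with ((x + y) / 2) in U2 by lra.
  assert ((1 - y + (1 - x)) / 2 < 1 - h ((x + y) / 2)); [|lra]. apply U2.
  intros t Ht E. apply (inner_no_bad h x y Hh HK Hx HI (1 - t) 1); [lra|].
  rewrite iter_1. lra.
Qed.

Lemma closure_bounds g x y a b : continuity g -> x < y -> (forall t, x < t < y -> a <= g t <= b) ->
  forall t, x <= t <= y -> a <= g t <= b.
Proof.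
  intros Hg Hxy H t Ht.
  assert (K : forall e, 0 < e -> exists u, x < u < y /\ Rabs (g u - g t) < e).
  { intros e He. destruct (continuity_eps g t e Hg He) as (d & Hd & H').
    (* The point [t] clamped into [[x+r,y-r]], which is interior and moves [t] by at most [r]. *)
    set (u := Rmax (x + Rmin (d / 2) ((y - x) / 4)) (Rmin t (y - Rmin (d / 2) ((y - x) / 4)))).
    exists u. set (r := Rmin (d / 2) ((y - x) / 4)) in *.
    assert (Hr : 0 < r) by (apply Rmin_pos; lra).
    assert (r <= d / 2) by apply Rmin_l. assert (r <= (y - x) / 4) by apply Rmin_r.
    assert (x < u < y /\ t - d < u < t + d).
    { unfold u, Rmax, Rmin. destruct (Rle_dec t (y - r)); destruct Rle_dec; lra. }
    split; [lra|]. apply H', Rabs_def1; lra. }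
  split; apply Rnot_lt_le; intros Hlt.
  - destruct (K (a - g t) ltac:(lra)) as (u & Hu & Hu'). specialize (H u Hu).
    apply Rabs_def2 in Hu'. lra.
  - destruct (K (g t - b) ltac:(lra)) as (u & Hu & Hu'). specialize (H u Hu).
    apply Rabs_def2 in Hu'. lra.
Qed.

Lemma invariant_fixed_absurd f x y q : indep_system f x y -> (0 < q)%nat ->
  (forall t, x <= t <= y -> x <= iter f q t <= y) -> iter f q x = x ->
  iter f q y = x \/ iter f q y = y -> False.
Proof.
  intros HS Hq HK Hx Hy. pose proof (is_lt HS) as Hxy.
  pose proof (tame_iter f q Hq (is_tame HS)) as Hg.
  destruct (outer_or_inner (iter f q) x y Hxy HK (is_indep HS q Hq)) as [HO|HI].
  - exact (outer_returns_absurd (iter f q) x y Hg Hxy Hx HO).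
  - exact (inner_absurd (iter f q) x y Hg Hxy HK Hx Hy HI).
Qed.

(** If [[x,y]] were invariant, its endpoints would be mapped to endpoints. If they are exchanged,
    time [n + n] fixes both; if both go to [y], the reflection applies. *)
Lemma no_return f x y n : indep_system f x y -> (0 < n)%nat ->
  ~ (forall t, x < t < y -> x <= iter f n t <= y).
Proof.
  intros HS Hn H. pose proof (is_lt HS) as Hxy. pose proof (is_tame HS) as Hf.
  pose proof (closure_bounds (iter f n) x y x y (iter_continuity f n (proj1 Hf)) Hxy H) as HK.
  assert (Ex : iter f n x = x \/ iter f n x = y).
  { pose proof (endpoint_avoids f x y n HS). specialize (HK x ltac:(lra)).
    destruct (Req_dec (iter f n x) x); [left; assumption|].
    destruct (Req_dec (iter f n x) y); [right; assumption|]. lra. }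
  assert (Ey : iter f n y = x \/ iter f n y = y).
  { pose proof (endpoint_avoids_right f x y n HS). specialize (HK y ltac:(lra)).
    destruct (Req_dec (iter f n y) x); [left; assumption|].
    destruct (Req_dec (iter f n y) y); [right; assumption|]. lra. }
  destruct Ex as [Ex|Ex].
  - exact (invariant_fixed_absurd f x y n HS Hn HK Ex Ey).
  - destruct Ey as [Ey|Ey].
    + apply (invariant_fixed_absurd f x y (n + n) HS ltac:(lia)).
      * intros t Ht. rewrite iter_add. apply HK, HK, Ht.
      * rewrite iter_add, Ex. exact Ey.
      * right. rewrite iter_add, Ey. exact Ex.
    + apply (invariant_fixed_absurd (refl f) (1 - y) (1 - x) n (indep_system_refl _ _ _ HS) Hn).
      * intros t Ht. rewrite iter_refl. specialize (HK (1 - t) ltac:(lra)). lra.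
      * rewrite iter_refl. replace (1 - (1 - y)) with y by lra. lra.
      * left. rewrite iter_refl. replace (1 - (1 - x)) with x by lra. lra.
Qed.

(** Some point of [(x,y)] leaves [[x,y]], and the other images cannot lie across the endpoint it has
    passed. *)
Lemma images_one_side f x y d : indep_system f x y -> (0 < d)%nat ->
  (forall t, x < t < y -> iter f d t <= x) \/ (forall t, x < t < y -> y <= iter f d t).
Proof.
  intros HS Hd.
  assert (exists t0, x < t0 < y /\ ~ (x <= iter f d t0 <= y)) as (t0 & Ht0 & H0).
  { apply NNPP. intros Hno. apply (no_return f x y d HS Hd). intros t Ht.
    apply NNPP. intros Hno'. apply Hno. eauto. }
  destruct (Rlt_or_le (iter f d t0) x) as [Hlt|Hge].
  - left. intros t Ht. apply Rnot_lt_le. intros K.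
    exact (no_cover_left f x y t0 t d HS Ht0 Ht Hlt K).
  - right. intros t Ht. apply Rnot_lt_le. intros K.
    apply (no_cover_right f x y t t0 d HS Ht Ht0 K). lra.
Qed.

(** Orbits positioned in [[x,y]] at one of the first two times realise only a few
    patterns afterwards; the pattern below avoids them all. *)
Lemma left_endpoint_not_periodic f x y n : indep_system f x y -> (0 < n)%nat -> iter f n x <> x.
Proof.
  intros HS Hn Hx. pose proof (is_lt HS) as Hxy. pose proof (is_tame HS) as Hf.
  set (g := iter f n) in *. assert (Hg : tame g) by (apply tame_iter; assumption).
  apply (outer_returns_absurd g x y Hg Hxy Hx). intros e0 He0.
  destruct (pos_min e0 ((y - x) / 2)) as (e & He & He1 & He2); [lra..|].
  apply (outer_returns_mono g x y e); [exact He1|].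
  destruct (is_indep HS n Hn e 7%nat 0%nat He) as (t & Ht & H). fold g in H.
  pose proof (gap_mono t 0 Ht) as Hm.
  assert (HM : forall d, (0 < d)%nat -> exists b : bool, forall v, x < v < y ->
    ~ Rabs (iter g d v - (if b then x else y)) < e).
  { intros d Hd. destruct (images_one_side f x y (n * d) HS ltac:(lia)) as [K|K];
      [exists false|exists true]; intros v Hv Hab; specialize (K v Hv); unfold g in Hab;
      rewrite iter_mul in Hab; apply Rabs_def2 in Hab; lra. }
  assert (Hy : forall d, exists b : bool, ~ Rabs (iter g d y - (if b then x else y)) < e).
  { intros d. destruct (Rlt_or_le (Rabs (iter g d y - x)) e) as [K|K]; [exists false|exists true; lra].
    intros K'. apply Rabs_def2 in K, K'. lra. }
  pose proof (Ht 0%nat). pose proof (Ht 1%nat). pose proof (Ht 2%nat).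
  pose proof (Ht 3%nat). pose proof (Ht 4%nat). pose proof (Ht 5%nat).
  destruct (HM (t 2 - t 0)%nat ltac:(lia)) as [b2 Hb2].
  destruct (HM (t 3 - t 1)%nat ltac:(lia)) as [b3 Hb3].
  destruct (Hy (t 5 - t 0)%nat) as [b5 Hb5].
  destruct (Hy (t 6 - t 1)%nat) as [b6 Hb6].
  (* Entries 2 and 3 exclude interior positions at times 0 and 1, entry 4 excludes the fixed point
     [x], and entries 5 and 6 exclude [y]. *)
  destruct (choice_function _ (fun ab : bool * bool =>
    H (pat [fst ab; snd ab; b2; b3; false; b5; b6]))) as [w' Hw'].
  set (w := fun a b => w' (a, b)).
  assert (Hw : forall a b j, (j < 7)%nat ->
    Rabs (iter g (t j) (w a b) - (if pat [a; b; b2; b3; false; b5; b6] j then x else y)) < e).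
  { intros a b. apply (Hw' (a, b)). }
  assert (Hfx : forall i a b, (i < 4)%nat -> iter g (t i) (w a b) <> x).
  { intros i a b Hi E. pose proof (Hw a b 4%nat ltac:(lia)) as W.
    rewrite (iter_later g t i 4) in W by (pose proof (Hm i 4%nat Hi); lia).
    rewrite E, (iter_fix g _ x Hx) in W. unfold pat in W. simpl nth in W. apply Rabs_def2 in W. lra. }
  apply (outer_of_positions g x y e t w); [lra|lia|]. intros a b.
  pose proof (Hw a b 0%nat ltac:(lia)) as W0. pose proof (Hw a b 1%nat ltac:(lia)) as W1.
  split; [exact W0|]. split; [exact W1|].
  split; intros Hin.
  - destruct (Req_dec (iter g (t 0%nat) (w a b)) x) as [E|Nx]; [exact (Hfx 0%nat a b ltac:(lia) E)|].
    destruct (Req_dec (iter g (t 0%nat) (w a b)) y) as [E|Ny].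
    + pose proof (Hw a b 5%nat ltac:(lia)) as W. rewrite (iter_later g t 0 5), E in W by lia.
      exact (Hb5 W).
    + pose proof (Hw a b 2%nat ltac:(lia)) as W. rewrite (iter_later g t 0 2) in W by lia.
      refine (Hb2 _ _ W). lra.
  - destruct (Req_dec (iter g (t 1%nat) (w a b)) x) as [E|Nx]; [exact (Hfx 1%nat a b ltac:(lia) E)|].
    destruct (Req_dec (iter g (t 1%nat) (w a b)) y) as [E|Ny].
    + pose proof (Hw a b 6%nat ltac:(lia)) as W. rewrite (iter_later g t 1 6), E in W by lia.
      exact (Hb6 W).
    + pose proof (Hw a b 3%nat ltac:(lia)) as W. rewrite (iter_later g t 1 3) in W by lia.
      refine (Hb3 _ _ W). lra.
Qed.

Theorem no_periodic_point f x y n p : indep_system f x y -> (0 < n)%nat -> x <= p <= y ->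
  iter f n p <> p.
Proof.
  intros HS Hn Hp E.
  destruct (Req_dec p x) as [->|Nx]; [exact (left_endpoint_not_periodic f x y n HS Hn E)|].
  destruct (Req_dec p y) as [->|Ny].
  - apply (left_endpoint_not_periodic (refl f) (1 - y) (1 - x) n (indep_system_refl _ _ _ HS) Hn).
    rewrite iter_refl. replace (1 - (1 - y)) with y by lra. lra.
  - destruct (images_one_side f x y n HS Hn) as [K|K]; specialize (K p ltac:(lra)); lra.
Qed.

(** * Nested periodic intervals *)

Definition convex (M : R -> Prop) : Prop := forall a b t, M a -> M b -> a <= t <= b -> M t.

(** The intervals that follow may lack their endpoints, so fixed points are found only in the
    closure. *)
Definition adherent (M : R -> Prop) (e : R) : Prop :=
  forall d, 0 < d -> exists t, M t /\ Rabs (t - e) < d.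

Lemma convex_fixed_up phi M t0 : tame phi -> convex M -> (forall t, M t -> inI t) ->
  (forall t, M t -> M (phi t)) -> M t0 -> t0 < phi t0 -> exists e, phi e = e /\ adherent M e.
Proof.
  intros Hphi HM HI Hinv H0 Hup. pose proof (proj1 Hphi) as Hc.
  destruct (completeness M) as [b [Hb1 Hb2]].
  { exists 1. intros t Ht. apply HI, Ht. }
  { exists t0. exact H0. }
  assert (Hab : adherent M b).
  { intros d Hd. apply NNPP. intros Hno. assert (b <= b - d); [|lra]. apply Hb2. intros t Ht.
    apply Rnot_lt_le. intros Hlt. apply Hno. exists t. split; [exact Ht|].
    specialize (Hb1 t Ht). apply Rabs_def1; lra. }
  assert (Hpb : phi b <= b).
  { apply Rnot_lt_le. intros Hlt.
    destruct (continuity_eps phi b (phi b - b) Hc) as (d & Hd & H); [lra|].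
    destruct (Hab d Hd) as (t & Ht & Ht'). specialize (H t Ht'). apply Rabs_def2 in H.
    specialize (Hb1 _ (Hinv t Ht)). lra. }
  destruct (first_fixed_above phi t0 b Hc (Hb1 t0 H0) Hup Hpb) as (e & He & Ee & _).
  exists e. split; [exact Ee|]. destruct (Req_dec e b) as [->|Hne]; [exact Hab|].
  intros d Hd. destruct (Hab (b - e) ltac:(lra)) as (t & Ht & Ht'). apply Rabs_def2 in Ht'.
  exists e. split; [apply (HM t0 t e H0 Ht); lra|]. rewrite Rminus_diag, Rabs_R0. exact Hd.
Qed.

Lemma convex_fixed phi M t0 : tame phi -> convex M -> (forall t, M t -> inI t) ->
  (forall t, M t -> M (phi t)) -> M t0 -> exists e, phi e = e /\ adherent M e.
Proof.
  intros Hphi HM HI Hinv H0.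
  destruct (Rtotal_order t0 (phi t0)) as [Hlt|[E|Hlt]].
  - exact (convex_fixed_up phi M t0 Hphi HM HI Hinv H0 Hlt).
  - exists t0. split; [congruence|]. intros d Hd. exists t0. split; [exact H0|].
    rewrite Rminus_diag, Rabs_R0. exact Hd.
  - destruct (convex_fixed_up (refl phi) (fun t => M (1 - t)) (1 - t0)) as (e & Ee & He).
    + apply tame_refl, Hphi.
    + intros a b t Ha Hb Ht. apply (HM (1 - b) (1 - a)); auto; lra.
    + intros t Ht. specialize (HI _ Ht). unfold inI in *. lra.
    + intros t Ht. unfold refl. replace (1 - (1 - phi (1 - t))) with (phi (1 - t)) by lra. auto.
    + replace (1 - (1 - t0)) with t0 by lra. exact H0.
    + unfold refl. replace (1 - (1 - t0)) with t0 by lra. lra.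
    + exists (1 - e). split; [unfold refl in Ee; lra|]. intros d Hd.
      destruct (He d Hd) as (t & Ht & Ht'). exists (1 - t). split; [exact Ht|].
      rewrite <- Rabs_Ropp. replace (- (1 - t - (1 - e))) with (t - e) by lra. exact Ht'.
Qed.

Lemma convex_fills_right S e c t : convex S -> adherent S e -> S c -> e < t <= c -> S t.
Proof.
  intros HS He Hc Ht. destruct (He (t - e) ltac:(lra)) as (u & Hu & Hu'). apply Rabs_def2 in Hu'.
  apply (HS u c); auto; lra.
Qed.

Lemma convex_fills_left S e c t : convex S -> adherent S e -> S c -> c <= t < e -> S t.
Proof.
  intros HS He Hc Ht. destruct (He (e - t) ltac:(lra)) as (u & Hu & Hu'). apply Rabs_def2 in Hu'.
  apply (HS c u); auto; lra.
Qed.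

Lemma two_convex_same_side S1 S2 e c1 c2 : convex S1 -> convex S2 -> adherent S1 e -> adherent S2 e ->
  S1 c1 -> S2 c2 -> (forall t, S1 t -> S2 t -> False) -> (e < c1 /\ e < c2) \/ (c1 < e /\ c2 < e) -> False.
Proof.
  intros K1 K2 A1 A2 H1 H2 HD [[L1 L2]|[L1 L2]].
  - apply (HD (Rmin c1 c2)).
    + apply (convex_fills_right S1 e c1); auto. unfold Rmin; destruct Rle_dec; lra.
    + apply (convex_fills_right S2 e c2); auto. unfold Rmin; destruct Rle_dec; lra.
  - apply (HD (Rmax c1 c2)).
    + apply (convex_fills_left S1 e c1); auto. unfold Rmax; destruct Rle_dec; lra.
    + apply (convex_fills_left S2 e c2); auto. unfold Rmax; destruct Rle_dec; lra.
Qed.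

Definition image (g : R -> R) (n : nat) (M : R -> Prop) (t : R) : Prop := exists v, M v /\ iter g n v = t.

Lemma image_convex g n M : continuity g -> convex M -> convex (image g n M).
Proof.
  intros Hg HM a b t (u & Hu & Eu) (v & Hv & Ev) Ht.
  destruct (ivt (iter g n) u v t (iter_continuity g n Hg)) as (w & Hw & Ew); [lra|].
  exists w. split; [|exact Ew]. unfold Rmin, Rmax in Hw.
  destruct (Rle_dec u v); [apply (HM u v)|apply (HM v u)]; auto.
Qed.

Lemma image_adherent g n M e : continuity g -> adherent M e -> iter g n e = e -> adherent (image g n M) e.
Proof.
  intros Hg HM E d Hd. destruct (continuity_eps (iter g n) e d (iter_continuity g n Hg) Hd) as (d' & Hd' & H).
  destruct (HM d' Hd') as (t & Ht & Ht'). exists (iter g n t). split; [exists t; auto|].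
  rewrite <- E. apply H, Ht'.
Qed.

(** A point in the closure of three disjoint nondegenerate intervals does not exist,
    hence a cycle of such intervals has a power of two as its period. *)
Lemma cycle_period_pow2 g M s : tame g -> convex M -> (forall t, M t -> inI t) ->
  (forall t, M t -> M (iter g s t)) -> (0 < s)%nat ->
  (forall i t, (0 < i < s)%nat -> M t -> ~ M (iter g i t)) ->
  (forall i, (i < s)%nat -> exists t1 t2, M t1 /\ M t2 /\ iter g i t1 <> iter g i t2) ->
  exists k, s = (2 ^ k)%nat.
Proof.
  intros Hg HM HI Hinv Hs Hdisj Hnd. pose proof (proj1 Hg) as Hc.
  destruct (odd_part s Hs) as (k & q & Es).
  exists k. destruct q as [|q]; [rewrite Es; simpl; lia|exfalso].
  set (n := (2 ^ k)%nat) in *.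
  assert (Hn : (0 < n)%nat) by (unfold n; pose proof (Nat.pow_nonzero 2 k); lia).
  destruct (Hnd 0%nat Hs) as (t0 & _ & Ht0 & _).
  destruct (convex_fixed (iter g s) M t0 (tame_iter g s Hs Hg) HM HI Hinv Ht0) as (e & Ee & Ae).
  assert (HeI : inI e) by (rewrite <- Ee; apply (tame_iter g s Hs Hg)).
  (* The point [e] has odd period under [g^n], so it is fixed by [g^n] and adheres to [M] and to its
     images at times [n] and [n + n], which precede [s] because the odd factor is at least 3. *)
  assert (En : iter g n e = e).
  { apply (odd_period_fixed (iter g n) (2 * S q + 1)); [apply tame_iter; assumption|exact HeI| |].
    - exists (S q). lia.
    - rewrite iter_mul, <- Es. exact Ee. }
  assert (En2 : iter g (n + n) e = e) by (rewrite iter_add, En; exact En).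
  assert (Hsep : forall i j t, (i < j < s)%nat -> image g i M t -> image g j M t -> False).
  { intros i j t Hij (u & Hu & Eu) (v & Hv & Ev).
    apply (Hdisj (s - j + i)%nat u ltac:(lia) Hu).
    rewrite iter_add, Eu, <- Ev, <- iter_add. replace (s - j + j)%nat with s by lia. auto. }
  assert (Hpt : forall i, (i < s)%nat -> exists c, image g i M c /\ c <> e).
  { intros i Hi. destruct (Hnd i Hi) as (t1 & t2 & H1 & H2 & Hne).
    destruct (Req_dec (iter g i t1) e) as [E|E].
    - exists (iter g i t2). split; [exists t2; auto|congruence].
    - exists (iter g i t1). split; [exists t1; auto|exact E]. }
  assert (L1 : (n + n < s)%nat) by nia.
  destruct (Hpt 0%nat ltac:(lia)) as (c0 & C0 & N0). destruct (Hpt n ltac:(lia)) as (c1 & C1 & N1).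
  destruct (Hpt (n + n)%nat ltac:(lia)) as (c2 & C2 & N2).
  pose proof (image_convex g 0 M Hc HM) as K0. pose proof (image_convex g n M Hc HM) as K1.
  pose proof (image_convex g (n + n) M Hc HM) as K2.
  pose proof (image_adherent g 0 M e Hc Ae eq_refl) as A0.
  pose proof (image_adherent g n M e Hc Ae En) as A1.
  pose proof (image_adherent g (n + n) M e Hc Ae En2) as A2.
  pose proof (fun t => Hsep 0%nat n t ltac:(lia)) as D01.
  pose proof (fun t => Hsep 0%nat (n + n)%nat t ltac:(lia)) as D02.
  pose proof (fun t => Hsep n (n + n)%nat t ltac:(lia)) as D12.
  destruct (Rdichotomy _ _ N0), (Rdichotomy _ _ N1), (Rdichotomy _ _ N2);
  first
  [ apply (two_convex_same_side _ _ e c0 c1 K0 K1 A0 A1 C0 C1 D01); lra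
  | apply (two_convex_same_side _ _ e c0 c2 K0 K2 A0 A2 C0 C2 D02); lra
  | apply (two_convex_same_side _ _ e c1 c2 K1 K2 A1 A2 C1 C2 D12); lra ].
Qed.

(** An interval of exact period [S] around [(x,y)]. Independence from starting points in [M] is what
    allows the cut to be repeated. *)
Record level (f : R -> R) (x y : R) (M : R -> Prop) (S : nat) : Prop := {
  lv_pos : (0 < S)%nat;
  lv_I : forall t, M t -> inI t;
  lv_conv : convex M;
  lv_mid : forall t, x < t < y -> M t;
  lv_inv : forall t, M t -> M (iter f S t);
  lv_disj : forall i t, (0 < i < S)%nat -> M t -> ~ M (iter f i t);
  lv_indep : indep M (iter f S) x y
}.
Arguments lv_pos {f x y M S}.
Arguments lv_I {f x y M S}.
Arguments lv_conv {f x y M S}.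
Arguments lv_mid {f x y M S}.
Arguments lv_inv {f x y M S}.
Arguments lv_disj {f x y M S}.
Arguments lv_indep {f x y M S}.

Lemma level_inv_mul f x y M S n t : level f x y M S -> M t -> M (iter f (S * n) t).
Proof.
  intros HL Ht. rewrite <- iter_mul. apply (iter_invariant M); [apply (lv_inv HL)|exact Ht].
Qed.

Lemma level_return f x y M S n t : level f x y M S -> M t -> M (iter f n t) ->
  exists q, n = (S * q)%nat.
Proof.
  intros HL Ht Hn. pose proof (lv_pos HL) as HS.
  pose proof (Nat.div_mod_eq n S) as E. pose proof (Nat.mod_upper_bound n S ltac:(lia)) as B.
  exists (n / S)%nat. destruct (Nat.eq_dec (n mod S) 0) as [E0|Hne]; [lia|exfalso].
  apply (lv_disj HL (n mod S) (iter f (S * (n / S)) t)); [lia| |].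
  - apply (level_inv_mul f x y M S); assumption.
  - rewrite <- iter_add. replace (n mod S + S * (n / S))%nat with n by lia. exact Hn.
Qed.

Lemma level_refl f x y M S : level f x y M S ->
  level (refl f) (1 - y) (1 - x) (fun t => M (1 - t)) S.
Proof.
  intros [H1 H2 H3 H4 H5 H6 H7].
  assert (E : forall n t, 1 - iter (refl f) n t = iter f n (1 - t)) by (intros; rewrite iter_refl; lra).
  split.
  - exact H1.
  - intros t Ht. specialize (H2 _ Ht). unfold inI in *; lra.
  - intros a b t Ha Hb Ht. apply (H3 (1 - b) (1 - a)); auto; lra.
  - intros t Ht. apply H4. lra.
  - intros t Ht. rewrite E. auto.
  - intros i t Hi Ht. rewrite E. auto.
  - apply indep_refl in H7. apply (indep_ext _ _ (iter (refl f) S)) in H7; [exact H7|].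
    intros n t. rewrite iter_refl, !iter_mul, iter_refl. reflexivity.
Qed.

(** * Cutting a periodic interval along a backward orbit *)

Section Step.
Variables (f : R -> R) (x y : R) (M : R -> Prop) (S0 : nat).
Hypothesis HS : indep_system f x y.
Hypothesis HL : level f x y M S0.
Let g := iter f S0.
Let m := (x + y) / 2.
Hypothesis Hup : m < g m.

Let Hxy : x < y := is_lt HS.
Let Hg : tame g := tame_iter f S0 (lv_pos HL) (is_tame HS).

Lemma level_stay n t : M t -> M (iter g n t).
Proof. apply (iter_invariant M), (lv_inv HL). Qed.

(** No fixed point lies in [[x,y]], so the first one above the midpoint is beyond [y], and the
    upward motion extends down to [x]. *)
Lemma step_fixed_point : exists p, y < p /\ g p = p /\ forall t, x <= t < p -> t < g t.
Proof.
  assert (Hnf : forall t, x <= t <= y -> g t <> t).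
  { intros t Ht. apply (no_periodic_point f x y S0 t HS (lv_pos HL) Ht). }
  assert (Hm : x < m < y) by (unfold m; lra).
  assert (HI1 : m <= 1) by (pose proof (is_y _ _ _ HS); unfold inI in *; lra).
  destruct (first_fixed_above g m 1 (proj1 Hg) HI1 Hup) as (p & Hp & Ep & H).
  { destruct Hg as (_ & HI & _). apply (HI 1). }
  assert (y < p). { apply Rnot_le_lt. intros Hle. apply (Hnf p); [lra|exact Ep]. }
  exists p. split; [assumption|]. split; [exact Ep|]. intros t Ht.
  destruct (Rle_or_lt m t) as [Hle|Hlt]; [apply H; lra|].
  apply Rnot_le_lt. intros Hdn.
  destruct (last_fixed_below g t m (proj1 Hg)) as (z & Hz & Ez & _); [lra|lra|exact Hup|].
  apply (Hnf z); [lra|exact Ez].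
Qed.

Variable p : R.
Hypothesis Hyp : y < p.
Hypothesis Hp : g p = p.
Hypothesis Hpup : forall t, x <= t < p -> t < g t.

(** The component containing [(x,y)] of [M] minus the backward orbit of [p]. *)
Definition piece (t : R) : Prop :=
  M t /\ forall u, (t <= u <= m \/ m <= u <= t) -> ~ bad g p u.

(** Such a point is a barrier: an orbit near [y] lies between it and [p], so it could not be near
    [x] at a late time. *)
Lemma no_bad_middle t : x < t < y -> ~ bad g p t.
Proof.
  intros Ht [r Hr].
  destruct (pos_min (t - x) (y - t)) as (e' & He' & B1 & B2); [lra..|].
  destruct (pos_min e' (p - y)) as (e & He & B3 & B4); [lra..|].
  destruct (indep_three _ g x y e r (lv_indep HL) He) as (n & d & d' & Hd & _ & H).
  destruct (H false true true) as (w & _ & W0 & W1 & _). simpl in W0, W1.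
  pose proof (trap_left g p t (iter g n w) r d Hg Hp ltac:(lra) Hr ltac:(lia)). lra.
Qed.

Lemma piece_not_bad t : piece t -> ~ bad g p t.
Proof. intros [_ H]. apply H. destruct (Rle_or_lt t m); [left|right]; lra. Qed.

Lemma piece_lt t : piece t -> t < p.
Proof.
  intros [_ H]. apply Rnot_le_lt. intros Hle. apply (H p); [right; unfold m; lra|].
  exists 0%nat. reflexivity.
Qed.

Lemma piece_convex : convex piece.
Proof.
  intros a b t [Ma Ha] [Mb Hb] Ht. split; [apply (lv_conv HL a b); assumption|].
  intros u Hu. destruct Hu as [Hu|Hu]; [apply Ha|apply Hb]; [left|right]; lra.
Qed.

Lemma piece_middle t : x < t < y -> piece t.
Proof.
  intros Ht. split; [apply (lv_mid HL), Ht|]. intros u Hu. apply no_bad_middle.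
  unfold m in Hu. lra.
Qed.

(** A preimage of [p] in the image of the piece would pull back to one in the piece; so the whole
    image stays in the component that one point has entered. *)
Lemma piece_return n t t1 : piece t -> piece (iter g n t) -> piece t1 -> piece (iter g n t1).
Proof.
  intros Ht [Mn Hn] Ht1. split; [apply level_stay, Ht1|]. intros u Hu [r Hr].
  destruct (classic (iter g n t <= u <= m \/ m <= u <= iter g n t)) as [Hc|Hc].
  { apply (Hn u Hc). exists r. exact Hr. }
  assert (exists v, Rmin t t1 <= v <= Rmax t t1 /\ iter g n v = u) as (v & Hv & Ev).
  { destruct (Rle_or_lt (iter g n t) (iter g n t1)).
    - apply ivt; [apply iter_continuity, Hg|]. lra.
    - rewrite Rmin_comm, Rmax_comm. apply ivt; [apply iter_continuity, Hg|]. lra. }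
  apply (piece_not_bad v).
  - unfold Rmin, Rmax in Hv. destruct (Rle_dec t t1);
      [apply (piece_convex t t1)|apply (piece_convex t1 t)]; assumption.
  - exists (r + n)%nat. rewrite iter_add, Ev. exact Hr.
Qed.

(** A leading entry [y] in the pattern places the orbit in the piece at its first time, on either
    side of [y]; the orbit is restarted there. *)
Lemma indep_piece_interior eta : 0 < eta -> (forall t, M t -> y <= t < y + eta -> piece t) ->
  indep piece g x y.
Proof.
  intros Heta Hint eps n G Heps.
  destruct (pos_min eta (y - x)) as (r & Hr & R1 & R2); [lra..|].
  destruct (pos_min eps r Heps Hr) as (e & He & He1 & He2).
  destruct (lv_indep HL e (S n) G He) as (T & HT & H'). fold g in H'.
  pose proof (gap_mono T G HT) as HTm.
  exists (fun j => (T (S j) - T 0%nat)%nat). split.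
  { intros j. pose proof (HT (S j)). pose proof (HTm 0%nat (S j) ltac:(lia)). lia. }
  intros s. destruct (H' (fun j => match j with O => false | S j => s j end)) as (w & Kw & Hw).
  exists (iter g (T 0%nat) w). split.
  - pose proof (Hw 0%nat ltac:(lia)) as W. simpl in W. apply Rabs_def2 in W.
    destruct (Rlt_or_le (iter g (T 0%nat) w) y).
    + apply piece_middle. lra.
    + apply Hint; [apply level_stay, Kw|lra].
  - intros j Hj. rewrite <- iter_later by (pose proof (HTm 0%nat (S j) ltac:(lia)); lia).
    eapply Rlt_le_trans; [apply (Hw (S j)); lia|exact He1].
Qed.

(** If preimages of [p] accumulate at [y], a return to the left of the piece near [x]
    would create two loops through a neighbourhood of [y]. *)
Lemma indep_piece_boundary : (forall eta, 0 < eta -> exists u, y <= u < y + eta /\ bad g p u) ->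
  indep piece g x y.
Proof.
  intros Hacc eps n G Heps.
  destruct (Hacc ((p - y) / 2) ltac:(lra)) as (tb & Htb & [rb Hrb]).
  (* When [x] never reaches [p], the value 0 is a dummy. Otherwise the gaps exceed [rx], so an orbit
     exactly at [x] would be at [p] at the next time, too far from both endpoints. *)
  assert (exists rx, bad g p x -> iter g rx x = p) as [rx Hrx].
  { destruct (classic (bad g p x)) as [[r Hr]|Hn]; [exists r; auto|exists 0%nat; tauto]. }
  destruct (pos_min ((y - x) / 4) ((p - y) / 2)) as (r0 & Hr0 & R1 & R2); [lra..|].
  destruct (pos_min eps r0 Heps Hr0) as (e & He & He1 & He2).
  destruct (lv_indep HL e (S (S (S n))) (G + rb + rx)%nat He) as (T & HT & H'). fold g in H'.
  pose proof (gap_mono T _ HT) as HTm.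
  exists (fun j => (T (S (S j)) - T 1%nat)%nat). split.
  { intros j. pose proof (HT (S (S j))). pose proof (HTm 1%nat (S (S j)) ltac:(lia)). lia. }
  intros s. destruct (H' (prefix2 false true s)) as (w & Kw & Hw).
  exists (iter g (T 1%nat) w). split.
  2:{ intros j Hj. rewrite <- iter_later by (pose proof (HTm 1%nat (S (S j)) ltac:(lia)); lia).
      eapply Rlt_le_trans; [apply (Hw (S (S j))); lia|exact He1]. }
  pose proof (HT 0%nat) as T0. pose proof (HT 1%nat) as T1.
  pose proof (Hw 0%nat ltac:(lia)) as W0. pose proof (Hw 1%nat ltac:(lia)) as W1.
  pose proof (Hw 2%nat ltac:(lia)) as W2. simpl in W0, W1, W2.
  rewrite (iter_later g T 1 2) in W2 by lia.
  set (c' := iter g (T 1%nat) w) in *.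
  assert (Ec : c' = iter g (T 1%nat - T 0%nat) (iter g (T 0%nat) w)) by (apply iter_later; lia).
  set (c := iter g (T 0%nat) w) in *. set (d := (T 1%nat - T 0%nat)%nat) in *.
  apply Rabs_def2 in W0, W1.
  split; [apply level_stay, Kw|]. intros b Hb Bb.
  assert (Hbx : b <= x).
  { apply Rnot_lt_le. intros Hlt. apply (no_bad_middle b); [unfold m in Hb; lra|exact Bb]. }
  destruct (Req_dec c' x) as [E|Hne].
  { assert (b = x) as -> by (unfold m in Hb; lra).
    rewrite E, (iter_fix_ge g rx _ x p Hp (Hrx Bb)) in W2 by lia.
    destruct (s 0%nat); apply Rabs_def2 in W2; lra. }
  assert (Hc' : c' < x) by (unfold m in Hb; lra).
  destruct Bb as [r Hr].
  destruct (pos_min (x - c') e) as (e' & He' & R3 & R4); [lra..|].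
  destruct (indep_three _ g x y e' r (lv_indep HL) He') as (k & d' & k' & Hd' & _ & H2).
  destruct (H2 true true true) as (w' & _ & V0 & V1 & _). simpl in V0, V1.
  set (top := Rmax tb (y + e)).
  assert (Htop : tb <= top /\ y + e <= top /\ top < p) by (unfold top, Rmax; destruct Rle_dec; lra).
  assert (HW : cov g d (y - e) top c' p).
  { exists c, tb. rewrite <- Ec, (iter_fix_ge g rb d tb p Hp Hrb) by lia. repeat split; lra. }
  assert (HV : cov g d' c' (x + e) (x + e) p).
  { exists (iter g k w'), b. rewrite (iter_fix_ge g r _ b p Hp Hr) by lia.
    unfold m in Hb. repeat split; lra. }
  destruct Hg as (_ & _ & HN).
  apply (HN (y - e) top c' (x + e) (y - e) top d d' 0%nat); [lra| | | |].
  - apply (cov_sub _ _ _ _ _ _ _ _ _ _ HW); lra.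
  - apply (cov_sub _ _ _ _ _ _ _ _ _ _ HW); lra.
  - apply (cov_sub _ _ _ _ _ _ _ _ _ _ HV); lra.
  - exists (y - e), top. unfold iter; simpl. repeat split; lra.
Qed.

Lemma indep_piece : indep piece g x y.
Proof.
  destruct (classic (exists eta, 0 < eta /\ forall t, M t -> y <= t < y + eta -> piece t))
    as [(eta & He & H)|Hno]; [exact (indep_piece_interior eta He H)|].
  apply indep_piece_boundary. intros eta He. apply NNPP. intros Hno'. apply Hno. exists eta.
  split; [exact He|]. intros t Mt Ht. split; [exact Mt|]. intros u Hu Bu. apply Hno'.
  exists u. split; [|exact Bu].
  assert (y <= u); [|unfold m in Hu; lra]. apply Rnot_lt_le. intros Hlt.
  apply (no_bad_middle u); [unfold m in Hu; lra|exact Bu].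
Qed.

Lemma piece_both_hit n t1 t2 : piece t1 -> piece t2 -> iter g n t1 < m -> m < iter g n t2 ->
  forall t, piece t -> piece (iter g n t).
Proof.
  intros P1 P2 L1 L2 t Pt.
  destruct (ivt (iter g n) t1 t2 m (iter_continuity g n (proj1 Hg))) as (v & Hv & Ev); [lra|].
  apply (piece_return n v); [|rewrite Ev; apply piece_middle; unfold m; lra|exact Pt].
  unfold Rmin, Rmax in Hv. destruct (Rle_dec t1 t2);
    [apply (piece_convex t1 t2)|apply (piece_convex t2 t1)]; assumption.
Qed.

(** With precision at most a quarter of [y - x], the image of the piece at an independence time has
    points on both sides of the midpoint. So it meets the piece, hence lies in it, and it is
    nondegenerate. *)
Lemma indep_piece_times eps n G : eps > 0 -> exists T : nat -> nat,
  (forall j, (T j + G < T (S j))%nat) /\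
  (forall s : nat -> bool, exists w, piece w /\ forall j, (j < n)%nat ->
      Rabs (iter g (T j) w - (if s j then x else y)) < eps) /\
  forall j, (j < n)%nat -> (forall t, piece t -> piece (iter g (T j) t)) /\
    exists t1 t2, piece t1 /\ piece t2 /\ iter g (T j) t1 <> iter g (T j) t2.
Proof.
  intros He.
  destruct (pos_min eps ((y - x) / 4)) as (e & He' & R1 & R2); [lra..|].
  destruct (indep_piece e n G He') as (T & HT & H).
  exists T. split; [exact HT|]. split.
  - intros s. destruct (H s) as (w & Kw & Hw). exists w. split; [exact Kw|].
    intros j Hj. specialize (Hw j Hj). lra.
  - intros j Hj. destruct (H (fun _ => true)) as (w1 & K1 & W1). destruct (H (fun _ => false)) as (w2 & K2 & W2).
    specialize (W1 j Hj). specialize (W2 j Hj). simpl in W1, W2. apply Rabs_def2 in W1, W2.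
    split; [|exists w1, w2; split; [exact K1|split; [exact K2|intros E; lra]]].
    apply (piece_both_hit (T j) w1 w2 K1 K2); unfold m; lra.
Qed.

Lemma step_up : exists M' j, (forall t, M' t -> M t) /\ (1 <= j)%nat /\ level f x y M' (S0 * 2 ^ j).
Proof.
  set (ret := fun n => (1 <= n)%nat /\ forall t, piece t -> piece (iter g n t)).
  assert (exists s, ret s /\ forall i, (0 < i < s)%nat -> ~ ret i) as (s & [Hs1 Hs2] & Hmin).
  { destruct (indep_piece_times 1 2 0 ltac:(lra)) as (T & HT & _ & H).
    pose proof (HT 0%nat). destruct (H 1%nat ltac:(lia)) as [H1 _].
    assert (R1 : ret (T 1%nat)) by (split; [lia|exact H1]).
    revert R1. generalize (T 1%nat). intros n. induction n as [n IH] using lt_wf_ind. intros Rn.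
    destruct (classic (exists i, (0 < i < n)%nat /\ ret i)) as [(i & Hi & Ri)|Hno].
    - apply (IH i ltac:(lia) Ri).
    - exists n. split; [exact Rn|]. intros i Hi Ri. apply Hno. eauto. }
  assert (Hdisj : forall i t, (0 < i < s)%nat -> piece t -> ~ piece (iter g i t)).
  { intros i t Hi Pt Pi. apply (Hmin i Hi). split; [lia|]. intros t1. apply (piece_return i t t1 Pt Pi). }
  assert (Hmul : forall n, (forall t, piece t -> piece (iter g n t)) -> exists q, n = (s * q)%nat).
  { intros n Hn. pose proof (Nat.div_mod_eq n s) as E. pose proof (Nat.mod_upper_bound n s ltac:(lia)).
    exists (n / s)%nat. destruct (Nat.eq_dec (n mod s) 0); [lia|exfalso].
    assert (Pm : piece m) by (apply piece_middle; unfold m; lra).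
    apply (Hdisj (n mod s)%nat (iter g (s * (n / s)) m)); [lia| |].
    - rewrite <- iter_mul. apply (iter_invariant piece); assumption.
    - rewrite <- iter_add. replace (n mod s + s * (n / s))%nat with n by lia. apply Hn, Pm. }
  (* An invariant piece would lie below [p], so an orbit starting near [y] would only move up and
     never come near [x]. *)
  assert (Hs : s <> 1%nat).
  { intros ->.
    destruct (indep_three _ g x y ((y - x) / 4) 0 indep_piece ltac:(lra)) as (n & d & d' & _ & _ & H).
    destruct (H false true true) as (w & Kw & W0 & W1 & _). simpl in W0, W1.
    assert (Pst : forall n t, piece t -> piece (iter g n t)).
    { intros i t. apply (iter_invariant piece). exact Hs2. }
    pose proof (Pst n w Kw) as Pc. set (c := iter g n w) in *.
    assert (K : forall j, c <= iter g j c).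
    { induction j as [|j IH]; [unfold iter; simpl; lra|].
      pose proof (piece_lt _ (Pst j c Pc)). rewrite iter_S.
      specialize (Hpup (iter g j c) ltac:(lra)). lra. }
    specialize (K d). lra. }
  destruct (cycle_period_pow2 g piece s Hg piece_convex) as [k Ek]; [|exact Hs2|lia|exact Hdisj| |].
  { intros t [Mt _]. apply (lv_I HL t Mt). }
  (* The image at a time beyond [s] is nondegenerate, hence so are all earlier images. *)
  { intros i Hi. destruct (indep_piece_times 1 2 s ltac:(lra)) as (T & HT & _ & H).
    pose proof (HT 0%nat). destruct (H 1%nat ltac:(lia)) as [_ (t1 & t2 & P1 & P2 & Hne)].
    exists t1, t2. split; [exact P1|]. split; [exact P2|]. intros E. apply Hne.
    replace (T 1%nat) with ((T 1%nat - i) + i)%nat by lia. rewrite !iter_add, E. reflexivity. }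
  exists piece, k. split; [intros t [Mt _]; exact Mt|].
  split; [destruct k; [exfalso; apply Hs; exact Ek|lia]|]. rewrite <- Ek.
  pose proof (lv_pos HL) as HS0.
  split.
  - nia.
  - intros t [Mt _]. apply (lv_I HL t Mt).
  - exact piece_convex.
  - exact piece_middle.
  - intros t Pt. rewrite <- iter_mul. apply Hs2, Pt.
  - intros i t Hi Pt Pi.
    destruct (level_return f x y M S0 i t HL (proj1 Pt) (proj1 Pi)) as [q Eq].
    apply (Hdisj q t); [nia|exact Pt|]. unfold g. rewrite iter_mul, <- Eq. exact Pi.
  (* The times are returns of the piece, hence multiples of [s]; the gap [s * (G + 1)] still exceeds
     [G] after division by [s]. *)
  - intros eps n G Heps. destruct (indep_piece_times eps n (s * (G + 1)) Heps) as (T & HT & H & Hm).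
    exists (fun j => (T j / s)%nat). split.
    + intros j. specialize (HT j).
      assert (T j / s + (G + 1) <= T (S j) / s)%nat; [|lia].
      apply Nat.div_le_lower_bound; [lia|].
      pose proof (Nat.Div0.mul_div_le (T j) s). nia.
    + intros sg. destruct (H sg) as (w & Kw & Hw). exists w. split; [exact Kw|]. intros j Hj.
      destruct (Hmul (T j) (proj1 (Hm j Hj))) as [q Eq]. specialize (Hw j Hj).
      rewrite Eq in Hw |- *.
      replace (s * q / s)%nat with q by (rewrite Nat.mul_comm, Nat.div_mul; lia).
      rewrite iter_mul, <- Nat.mul_assoc, <- iter_mul. exact Hw.
Qed.
End Step.

Lemma step f x y M S : indep_system f x y -> level f x y M S ->
  exists M' j, (forall t, M' t -> M t) /\ (1 <= j)%nat /\ level f x y M' (S * 2 ^ j).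
Proof.
  intros HS HL. pose proof (is_lt HS) as Hxy.
  destruct (Rtotal_order ((x + y) / 2) (iter f S ((x + y) / 2))) as [Hlt|[E|Hlt]].
  - destruct (step_fixed_point f x y M S HS HL Hlt) as (p & H1 & H2 & H3).
    exact (step_up f x y M S HS HL p H1 H2 H3).
  - exfalso. apply (no_periodic_point f x y S ((x + y) / 2) HS (lv_pos HL)); [lra|congruence].
  - pose proof (indep_system_refl _ _ _ HS) as HS'. pose proof (level_refl _ _ _ _ _ HL) as HL'.
    assert (Hup : (1 - y + (1 - x)) / 2 < iter (refl f) S ((1 - y + (1 - x)) / 2)).
    { rewrite iter_refl. replace (1 - (1 - y + (1 - x)) / 2) with ((x + y) / 2) by lra. lra. }
    destruct (step_fixed_point _ _ _ _ _ HS' HL' Hup) as (p & H1 & H2 & H3).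
    destruct (step_up _ _ _ _ _ HS' HL' p H1 H2 H3) as (M' & j & Hsub & Hj & HL2).
    exists (fun t => M' (1 - t)), j. split.
    { intros t Ht. specialize (Hsub _ Ht). replace (1 - (1 - t)) with t in Hsub by lra. exact Hsub. }
    split; [exact Hj|]. apply level_refl in HL2.
    destruct HL2 as [L1 L2 L3 L4 L5 L6 L7].
    assert (E : forall n t, iter (refl (refl f)) n t = iter f n t).
    { intros n t. rewrite !iter_refl. replace (1 - (1 - t)) with t by lra. lra. }
    replace (1 - (1 - x)) with x in * by lra. replace (1 - (1 - y)) with y in * by lra.
    split; auto.
    + intros t Ht. rewrite <- E. apply L5, Ht.
    + intros i t Hi Ht. rewrite <- E. apply L6; assumption.
    + apply (indep_ext _ _ (iter f (S * 2 ^ j))) in L7; [exact L7|].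
      intros n t. rewrite !iter_mul, E. reflexivity.
Qed.

Theorem level_sequence f x y : indep_system f x y -> exists (M : nat -> R -> Prop) (e : nat -> nat),
  (forall k, level f x y (M k) (2 ^ e k)) /\ (forall k, (e k < e (S k))%nat) /\
  forall k t, M (S k) t -> M k t.
Proof.
  intros HS.
  set (A := {P : (R -> Prop) * nat | level f x y (fst P) (2 ^ snd P)}).
  assert (H0 : level f x y inI (2 ^ 0)).
  { pose proof (is_x _ _ _ HS) as Ix. pose proof (is_y _ _ _ HS) as Iy. unfold inI in Ix, Iy. simpl.
    split; auto.
    - intros a b t Ha Hb Ht. unfold inI in *. lra.
    - intros t Ht. unfold inI. lra.
    - intros t Ht. apply (is_tame HS).
    - intros i t Hi. lia.
    - apply (is_indep HS). lia. }
  destruct (dependent_choice (fun a b : A => (snd (proj1_sig a) < snd (proj1_sig b))%nat /\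
    forall t, fst (proj1_sig b) t -> fst (proj1_sig a) t) (exist _ (inI, 0%nat) H0)) as (s & _ & Hs).
  { intros [[M e] HL]. simpl in HL.
    destruct (step f x y M (2 ^ e) HS HL) as (M' & j & Hsub & Hj & HL').
    rewrite <- Nat.pow_add_r in HL'. exists (exist _ (M', (e + j)%nat) HL'). simpl. split; [lia|exact Hsub]. }
  exists (fun k => fst (proj1_sig (s k))), (fun k => snd (proj1_sig (s k))).
  split; [intros k; apply (proj2_sig (s k))|]. split; intros k; apply Hs.
Qed.

(** * An orbit visiting all the nested intervals *)

Record tower (f : R -> R) (x y : R) (M : nat -> R -> Prop) (e : nat -> nat) : Prop := {
  tw_sys : indep_system f x y;
  tw_level : forall k, level f x y (M k) (2 ^ e k);
  tw_incr : forall k, (e k < e (S k))%nat;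
  tw_nest : forall k t, M (S k) t -> M k t
}.
Arguments tw_sys {f x y M e}.
Arguments tw_level {f x y M e}.
Arguments tw_incr {f x y M e}.
Arguments tw_nest {f x y M e}.

(** The compatible residues of the visiting times define the nested sequence of portions of [z]. *)
Record follows (f : R -> R) (M : nat -> R -> Prop) (z : R) (n : nat -> nat) : Prop := {
  fo_inI : inI z;
  fo_visit : forall k, M k (iter f (n k) z);
  fo_mod : forall k, (n (S k) mod 2 ^ k = n k mod 2 ^ k)%nat
}.
Arguments fo_inI {f M z n}.
Arguments fo_visit {f M z n}.
Arguments fo_mod {f M z n}.

Lemma tower_refl f x y M e : tower f x y M e ->
  tower (refl f) (1 - y) (1 - x) (fun k t => M k (1 - t)) e.
Proof.
  intros [H1 H2 H3 H4]. split; auto.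
  - apply indep_system_refl, H1.
  - intros k. apply (level_refl f x y (M k) (2 ^ e k)), H2.
Qed.
Arguments tower_refl {f x y M e}.

Lemma follows_refl f M z n : follows f M z n ->
  follows (refl f) (fun k t => M k (1 - t)) (1 - z) n.
Proof.
  intros [H1 H2 H3]. split; auto.
  - unfold inI in *; lra.
  - intros k. rewrite iter_refl. replace (1 - (1 - iter f (n k) (1 - (1 - z)))) with (iter f (n k) z); auto.
    replace (1 - (1 - z)) with z by lra. lra.
Qed.
Arguments follows_refl {f M z n}.

(** The time is a multiple of the period of [M k], so these are returns of the midpoint to [M k],
    landing on the outer left. *)
Definition returns_left (f : R -> R) (x y : R) (e : nat -> nat) : Prop :=
  forall k, exists d, (0 < d)%nat /\ (d mod 2 ^ e k = 0)%nat /\ iter f d ((x + y) / 2) <= x.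

Definition returns_right (f : R -> R) (x y : R) (e : nat -> nat) : Prop :=
  forall k, exists d, (0 < d)%nat /\ (d mod 2 ^ e k = 0)%nat /\ y <= iter f d ((x + y) / 2).

Lemma returns_right_refl f x y e : returns_right f x y e -> returns_left (refl f) (1 - y) (1 - x) e.
Proof.
  intros H k. destruct (H k) as (d & H1 & H2 & H3). exists d. split; [exact H1|]. split; [exact H2|].
  rewrite iter_refl. replace (1 - (1 - y + (1 - x)) / 2) with ((x + y) / 2) by lra. lra.
Qed.

Lemma mul_pow2_mod k n : (n mod 2 ^ k = 0)%nat -> exists q, n = (2 ^ k * q)%nat.
Proof. intros H. exists (n / 2 ^ k)%nat. pose proof (Nat.div_mod_eq n (2 ^ k)). lia. Qed.

Lemma mod_pow2_decomp k n c : (n mod 2 ^ k = c mod 2 ^ k)%nat -> (c <= n)%nat ->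
  exists q, n = (c + 2 ^ k * q)%nat.
Proof.
  intros H Hle. exists (n / 2 ^ k - c / 2 ^ k)%nat.
  pose proof (Nat.div_mod_eq n (2 ^ k)). pose proof (Nat.div_mod_eq c (2 ^ k)).
  pose proof (Nat.Div0.div_le_mono c n (2 ^ k) Hle). rewrite Nat.mul_sub_distr_l. nia.
Qed.

Section Tower.
Variables (f : R -> R) (x y : R) (M : nat -> R -> Prop) (e : nat -> nat).
Hypothesis HT : tower f x y M e.

Let m := (x + y) / 2.
Let Hxy : x < y := is_lt (tw_sys HT).
Let Hf : tame f := is_tame (tw_sys HT).

Lemma tower_nest k l t : (k <= l)%nat -> M l t -> M k t.
Proof. intros H. induction H as [|l H IH]; [auto|]. intros Ht. apply IH, (tw_nest HT), Ht. Qed.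

Lemma tower_exp_ge k : (k <= e k)%nat.
Proof.
  induction k as [|k IH]; [lia|]. pose proof (tw_incr HT k). lia.
Qed.

Lemma tower_exp_mono k l : (k <= l)%nat -> (e k <= e l)%nat.
Proof. intros H. induction H as [|l H IH]; [lia|]. pose proof (tw_incr HT l). lia. Qed.

Lemma tower_period_gt d : (d < 2 ^ e d)%nat.
Proof.
  eapply Nat.lt_le_trans; [apply (Nat.pow_gt_lin_r 2); lia|].
  apply Nat.pow_le_mono_r; [lia|apply tower_exp_ge].
Qed.

Lemma tower_no_return d k t : (0 < d)%nat -> (d <= k)%nat -> M k t -> ~ M k (iter f d t).
Proof.
  intros Hd Hk Ht. apply (lv_disj (tw_level HT k)); [|exact Ht].
  split; [exact Hd|]. eapply Nat.lt_le_trans; [apply tower_period_gt|].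
  apply Nat.pow_le_mono_r; [lia|apply tower_exp_mono, Hk].
Qed.

Lemma tower_middle k t : x < t < y -> M k t.
Proof. apply (lv_mid (tw_level HT k)). Qed.

Lemma tower_convex k : convex (M k).
Proof. apply (lv_conv (tw_level HT k)). Qed.

Lemma tower_m k : M k m.
Proof. apply tower_middle. unfold m. lra. Qed.

Lemma tower_stay k t q : M k t -> M k (iter f (2 ^ e k * q) t).
Proof. apply (level_inv_mul f x y), (tw_level HT k). Qed.

(** If all levels contained [u], they would contain [[u,y)]. Independence brings some point near [x]
    back near [x] after [d] steps, which contradicts the disjointness at level [d]. *)
Lemma tower_separates_left u : u < x -> exists k, ~ M k u.
Proof.
  intros Hu. apply NNPP. intros Hno.
  assert (Hall : forall k t, u <= t < y -> M k t).
  { intros k t Ht. assert (M k u) by (apply NNPP; intros K; apply Hno; eauto).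
    destruct (Rle_or_lt t m); [apply (tower_convex k u m); auto using tower_m; lra|].
    apply tower_middle. unfold m in *. lra. }
  destruct (pos_min (x - u) (y - x)) as (r & Hr & R1 & R2); [lra..|].
  destruct (indep_three _ f x y r 0 (indep_system_indep f x y (tw_sys HT)) Hr)
    as (n & d & d' & Hd & _ & H).
  destruct (H true true true) as (w & _ & W0 & W1 & _). simpl in W0, W1.
  apply (tower_no_return d d (iter f n w)); [lia|lia| |]; apply Hall; lra.
Qed.

Lemma tower_elements_gt k u t : u < x -> ~ M k u -> M k t -> u < t.
Proof.
  intros Hu Hn Ht. apply Rnot_le_lt. intros Hle. apply Hn.
  apply (tower_convex k t m); [exact Ht|apply tower_m|unfold m; lra].
Qed.

(** [f^d (M j)] is an interval disjoint from [M j], so it lies on one side of it. *)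
Lemma translate_below d j v t : (0 < d)%nat -> (d <= j)%nat -> iter f d m <= x -> M j v -> v <= m ->
  M j t -> iter f d t < v.
Proof.
  intros Hd Hj Hm Hv Hvm Ht. apply Rnot_le_lt. intros Hle.
  assert (iter f d m < v).
  { apply Rnot_le_lt. intros K. apply (tower_no_return d j m Hd Hj (tower_m j)).
    apply (tower_convex j v m); auto using tower_m. unfold m in *. lra. }
  destruct (ivt (iter f d) m t v (iter_continuity f d (proj1 Hf))) as (w & Hw & Ew); [lra|].
  apply (tower_no_return d j w Hd Hj); [|rewrite Ew; exact Hv].
  unfold Rmin, Rmax in Hw. destruct (Rle_dec m t);
    [apply (tower_convex j m t)|apply (tower_convex j t m)]; auto using tower_m.
Qed.

Lemma translate_le d j t : (0 < d)%nat -> (d <= j)%nat -> iter f d m <= x -> M j t -> iter f d t <= x.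
Proof.
  intros Hd Hj Hm Ht. apply Rnot_lt_le. intros Hlt.
  set (v := Rmin m ((x + iter f d t) / 2)).
  assert (Hv : x < v <= m /\ v < iter f d t) by (unfold v, Rmin; destruct Rle_dec; unfold m in *; lra).
  pose proof (translate_below d j v t Hd Hj Hm) as K.
  assert (iter f d t < v); [|lra]. apply K; [|lra|exact Ht].
  apply tower_middle. unfold m in *. lra.
Qed.

Section Follow.
Variables (z : R) (n : nat -> nat).
Hypothesis HF : follows f M z n.

(** The index [i_k] of the portion of [z] that will contain [x] and [y]. *)
Definition cls (k : nat) : nat := (n k mod 2 ^ k)%nat.

Lemma follow_mod k j : (k <= j)%nat -> (n j mod 2 ^ k = n k mod 2 ^ k)%nat.
Proof.
  intros H. induction H as [|j H IH]; [reflexivity|]. rewrite <- IH.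
  apply (mod_pow2_le _ _ k j H), (fo_mod HF).
Qed.

Lemma omega_cls k a : climit (fun l => iter f (n k + 2 ^ k * l) z) a ->
  omega (iter f (2 ^ k)) (iter f (cls k) z) a.
Proof.
  intros H. apply omega_class. intros eps He N. destruct (H eps He N) as (l & Hl & Hl').
  exists (n k / 2 ^ k + l)%nat. split; [lia|]. unfold cls.
  pose proof (Nat.div_mod_eq (n k) (2 ^ k)).
  replace (2 ^ k * (n k / 2 ^ k + l) + n k mod 2 ^ k)%nat with (n k + 2 ^ k * l)%nat by lia. exact Hl'.
Qed.

Lemma omega_cls_times k a : (forall eps, eps > 0 -> forall N, exists i, (i >= N)%nat /\
    (i mod 2 ^ k = n k mod 2 ^ k)%nat /\ Rabs (iter f i z - a) < eps) ->
  omega (iter f (2 ^ k)) (iter f (cls k) z) a.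
Proof.
  intros H. apply omega_cls. intros eps He N.
  destruct (H eps He (n k + 2 ^ k * N)%nat) as (i & Hi & Hm & Hi').
  destruct (mod_pow2_decomp k i (n k) Hm ltac:(lia)) as [q Eq]. exists q.
  split; [pose proof (pow2_pos k); nia|]. rewrite <- Eq. exact Hi'.
Qed.

(** A left return time [d] of level [k2] is applied to a deeper level [j]. The image of [M j] stays
    in [M k2], hence above [u], but lies below [v], a return of the midpoint to [M j] with [v < x].
    The orbit of [z] visits [M j] periodically, so its shift by [d] accumulates in [[u,v]]. *)
Lemma omega_left k c : returns_left f x y e -> c < x ->
  exists q, c < q < x /\ omega (iter f (2 ^ k)) (iter f (cls k) z) q.
Proof.
  intros HL Hc. set (u := (c + x) / 2).
  destruct (tower_separates_left u ltac:(unfold u; lra)) as [k1 Hk1].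
  set (k2 := (k + k1)%nat).
  assert (Hk2 : ~ M k2 u) by (intros K; apply Hk1, (tower_nest k1 k2); [unfold k2; lia|exact K]).
  destruct (HL k2) as (d & Hd & Hdm & Hdx). fold m in Hdx.
  destruct (mul_pow2_mod _ _ Hdm) as [dq Hdq].
  set (j := (k2 + d)%nat).
  destruct (HL j) as (d' & Hd' & Hdm' & Hdx'). fold m in Hdx'.
  destruct (mul_pow2_mod _ _ Hdm') as [dq' Hdq'].
  set (v := iter f d' m) in *.
  assert (Mv : M j v) by (unfold v; rewrite Hdq'; apply tower_stay, tower_m).
  set (j2 := (j + d')%nat).
  destruct (HL j2) as (d2 & Hd2 & Hdm2 & Hdx2). fold m in Hdx2.
  destruct (mul_pow2_mod _ _ Hdm2) as [dq2 Hdq2].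
  assert (Hvx : v < x).
  { eapply Rlt_le_trans; [|exact Hdx2].
    apply (translate_below d' j2 (iter f d2 m) m); auto using tower_m; [unfold j2; lia| |unfold m in *; lra].
    rewrite Hdq2. apply tower_stay, tower_m. }
  assert (Hin : forall l, u <= iter f (n j + 2 ^ e j * l + d) z <= v).
  { intros l. set (w := iter f (n j + 2 ^ e j * l) z).
    assert (Mw : M j w).
    { unfold w. rewrite Nat.add_comm, iter_add. apply tower_stay, (fo_visit HF). }
    rewrite Nat.add_comm, iter_add. fold w. split.
    - apply Rlt_le, (tower_elements_gt k2); [unfold u; lra|exact Hk2|].
      rewrite Hdq. apply tower_stay, (tower_nest k2 j); [unfold j; lia|exact Mw].
    - apply Rlt_le, (translate_below d j v w); auto; [unfold j; lia|unfold m in *; lra]. }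
  destruct (climit_exists (fun l => iter f (n j + 2 ^ e j * l + d) z) u v) as (q & Hq & Hq').
  { intros N. exists N. split; [lia|apply Hin]. }
  exists q. split; [unfold u in *; lra|]. apply omega_cls_times. intros eps He N.
  destruct (Hq eps He N) as (l & Hl & Hl'). exists (n j + 2 ^ e j * l + d)%nat.
  split; [pose proof (pow2_pos (e j)); nia|]. split; [|exact Hl'].
  rewrite Hdq.
  assert (k <= e k2)%nat by (pose proof (tower_exp_ge k2); unfold k2 in *; lia).
  assert (k <= e j)%nat by (pose proof (tower_exp_mono k2 j ltac:(unfold j; lia)); lia).
  rewrite !mod_pow2_add_mul by assumption. apply follow_mod. unfold j, k2. lia.
Qed.

Lemma omega_ge k1 u a : (1 <= k1)%nat -> u < x -> ~ M k1 u ->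
  omega (iter f (2 ^ e k1)) (iter f (cls (e k1)) z) a -> u <= a.
Proof.
  intros Hk1 Hu Hn Ha. apply omega_class in Ha.
  pose proof (tower_exp_ge k1) as Hek.
  apply (climit_ge _ _ u Ha). exists (n (e k1)). intros l Hl.
  apply Rlt_le, (tower_elements_gt k1 u); [exact Hu|exact Hn|].
  destruct (mod_pow2_decomp (e k1) (2 ^ e k1 * l + cls (e k1)) (n (e k1))) as [q Eq].
  - rewrite Nat.add_comm, mod_pow2_add_mul by lia. apply Nat.Div0.mod_mod.
  - pose proof (pow2_pos (e k1)). nia.
  - rewrite Eq, Nat.add_comm, iter_add. apply tower_stay, (tower_nest k1 (e k1) _ Hek).
    apply (fo_visit HF).
Qed.

Lemma Jint_common_ge t : (forall k, (k >= 1)%nat -> Jint f z k (cls k) t) -> x <= t.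
Proof.
  intros HJ. apply Rnot_lt_le. intros Hlt. set (u := (t + x) / 2).
  destruct (tower_separates_left u ltac:(unfold u; lra)) as [k Hk].
  assert (HSk : ~ M (S k) u) by (intros K; apply Hk, (tw_nest HT), K).
  destruct (HJ (e (S k))) as (a & b & Ha & _ & Hab); [pose proof (tower_exp_ge (S k)); lia|].
  pose proof (omega_ge (S k) u a ltac:(lia) ltac:(unfold u; lra) HSk Ha). unfold u in *. lra.
Qed.
End Follow.
End Tower.
Arguments tower_exp_ge {f x y M e}.
Arguments tower_exp_mono {f x y M e}.
Arguments tower_no_return {f x y M e}.
Arguments tower_middle {f x y M e}.
Arguments tower_convex {f x y M e}.
Arguments tower_m {f x y M e}.
Arguments translate_le {f x y M e}.

Lemma omega_refl_class f z q i a : omega (iter (refl f) q) (iter (refl f) i (1 - z)) a ->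
  omega (iter f q) (iter f i z) (1 - a).
Proof.
  intros H. apply omega_class. apply omega_class in H. intros eps He N.
  destruct (H eps He N) as (l & Hl & Hl'). exists l. split; [exact Hl|].
  rewrite iter_refl in Hl'. replace (1 - (1 - z)) with z in Hl' by lra.
  rewrite <- Rabs_Ropp. replace (- (iter f (q * l + i) z - (1 - a))) with (1 - iter f (q * l + i) z - a) by lra.
  exact Hl'.
Qed.

Lemma omega_class_refl f z q i a : omega (iter f q) (iter f i z) a ->
  omega (iter (refl f) q) (iter (refl f) i (1 - z)) (1 - a).
Proof.
  intros H. apply omega_class. apply omega_class in H. intros eps He N.
  destruct (H eps He N) as (l & Hl & Hl'). exists l. split; [exact Hl|].
  rewrite iter_refl. replace (1 - (1 - z)) with z by lra.
  rewrite <- Rabs_Ropp. replace (- (1 - iter f (q * l + i) z - (1 - a))) with (iter f (q * l + i) z - a) by lra.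
  exact Hl'.
Qed.

Lemma omega_of_class f z q i a : omega (iter f q) (iter f i z) a -> (0 < q)%nat -> omega f z a.
Proof.
  intros H Hq eps He N. apply omega_class in H. destruct (H eps He N) as (l & Hl & Hl').
  exists (q * l + i)%nat. split; [nia|exact Hl'].
Qed.

Section Conclude.
Variables (f : R -> R) (x y : R) (M : nat -> R -> Prop) (e : nat -> nat) (z : R) (n : nat -> nat).
Hypothesis HT : tower f x y M e.
Hypothesis HF : follows f M z n.
Hypothesis HL : returns_left f x y e.

(** Limit points accumulate at [x] from the left, so a finite list misses one of them. *)
Lemma omega_infinite_of_left : infinite_set (omega f z).
Proof.
  intros l.
  assert (exists c, c < x /\ forall v, In v l -> v < x -> v <= c) as (c & Hc & Hl).
  { induction l as [|v l (c & Hc & IH)]; [exists (x - 1); split; [lra|intros v []]|].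
    destruct (Rlt_or_le v x) as [Hv|Hv].
    - exists (Rmax c v). split; [apply Rmax_lub_lt; assumption|]. intros w [<-|Hw] Hwx; [apply Rmax_r|].
      eapply Rle_trans; [apply (IH w Hw Hwx)|apply Rmax_l].
    - exists c. split; [exact Hc|]. intros w [<-|Hw] Hwx; [lra|auto]. }
  destruct (omega_left f x y M e HT z n HF 1 c HL Hc) as (q & Hq & Hq').
  exists q. split.
  - apply (omega_of_class f z _ _ q Hq'). apply pow2_pos.
  - intros Hin. specialize (Hl q Hin ltac:(lra)). lra.
Qed.

Lemma nonseparable_of_follows :
  (forall k, exists b, y <= b /\ omega (iter f (2 ^ k)) (iter f (cls n k) z) b) -> nonseparable f x y.
Proof.
  intros HR. pose proof (is_lt (tw_sys HT)) as Hxy.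
  split; [lra|]. exists z. split; [apply (fo_inI HF)|]. split; [exact omega_infinite_of_left|].
  exists (cls n). split.
  - split.
    + intros k _. apply Nat.mod_upper_bound. pose proof (pow2_pos k). lia.
    + intros k Hk t HJ. apply Jint_refine in HJ. unfold cls in HJ at 1.
      rewrite mod_pow2_S_mod, (fo_mod HF) in HJ. exact HJ.
  - left. intros t. split.
    + intros HJ. split; [exact (Jint_common_ge f x y M e HT z n HF t HJ)|].
      pose proof (Jint_common_ge _ _ _ _ _ (tower_refl HT) _ _ (follows_refl HF) (1 - t)) as K.
      assert (1 - y <= 1 - t); [|lra]. apply K. intros k Hk. destruct (HJ k Hk) as (a & b & Ha & Hb & Hab).
      exists (1 - b), (1 - a). split; [apply omega_class_refl, Hb|].
      split; [apply omega_class_refl, Ha|lra].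
    + intros Ht k _. destruct (omega_left f x y M e HT z n HF k (x - 1) HL ltac:(lra)) as (a & Ha & Ha').
      destruct (HR k) as (b & Hb & Hb'). exists a, b. repeat split; auto; lra.
Qed.
End Conclude.

Section Chain.
Variables (f : R -> R) (x y : R) (M : nat -> R -> Prop) (e : nat -> nat).
Hypothesis HT : tower f x y M e.
Hypothesis HL : returns_left f x y e.
Hypothesis HR : ~ returns_right f x y e.

Let m := (x + y) / 2.
Let Hxy : x < y := is_lt (tw_sys HT).
Let Hf : tame f := is_tame (tw_sys HT).

Lemma eventually_left_returns : exists k0, forall d, (0 < d)%nat -> (d mod 2 ^ e k0 = 0)%nat -> iter f d m <= x.
Proof.
  apply not_all_ex_not in HR. destruct HR as [k0 H]. exists k0. intros d Hd Hdm.
  apply Rnot_lt_le. intros Hlt. destruct (Rlt_or_le (iter f d m) y) as [Hy|Hy].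
  - apply (tower_no_return HT d d m Hd (Nat.le_refl d)).
    + apply (tower_m HT).
    + apply (tower_middle HT). lra.
  - apply H. exists d. auto.
Qed.

Lemma no_return_middle d t : (0 < d)%nat -> x < t < y -> x < iter f d t < y -> False.
Proof.
  intros Hd Ht Ht'. apply (tower_no_return HT d d t Hd (Nat.le_refl d));
    apply (tower_middle HT); assumption.
Qed.

Lemma returns_positions k eps G : 0 < eps -> exists c0 c1 c2 d1 d2,
  M k c0 /\ M k c1 /\ M k c2 /\ iter f d1 c0 = c1 /\ iter f d2 c1 = c2 /\
  (G < d1)%nat /\ (G < d2)%nat /\ (d1 mod 2 ^ e k = 0)%nat /\ (d2 mod 2 ^ e k = 0)%nat /\
  Rabs (c0 - y) < eps /\ Rabs (c1 - y) < eps /\ Rabs (c2 - y) < eps.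
Proof.
  intros He. pose proof (tw_level HT k) as HLk.
  destruct (indep_three _ _ x y eps G (lv_indep HLk) He) as (n & d & d' & Hd & Hd' & H).
  destruct (H false false false) as (w & Kw & W0 & W1 & W2). pose proof (pow2_pos (e k)).
  set (g := iter f (2 ^ e k)) in *. simpl in W0, W1, W2.
  assert (Hst : forall j t, M k t -> M k (iter g j t))
    by (intros j t; apply (iter_invariant (M k)), HLk).
  exists (iter g n w), (iter g d (iter g n w)), (iter g d' (iter g d (iter g n w))),
    (2 ^ e k * d)%nat, (2 ^ e k * d')%nat.
  rewrite <- !iter_mul. repeat split; auto using mul_pow2_mod0; try nia; apply Rabs_def1; lra.
Qed.

(** Otherwise three successive visits near [y] would be at most [y]. As [y] is not periodic, at most
    one equals [y]; the other two are interior, and [(x,y)] never returns to itself. *)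
Lemma beyond_right k : exists b, y < b /\ M k b.
Proof.
  apply NNPP. intros Hno.
  assert (Hle : forall t, M k t -> t <= y).
  { intros t Ht. apply Rnot_lt_le. intros K. apply Hno. eauto. }
  destruct (returns_positions k (y - x) 0 ltac:(lra)) as
    (c0 & c1 & c2 & d1 & d2 & M0 & M1 & M2 & E1 & E2 & G1 & G2 & _ & _ & A0 & A1 & A2).
  apply Hle in M0, M1, M2. apply Rabs_def2 in A0, A1, A2.
  assert (E3 : iter f (d2 + d1) c0 = c2) by (rewrite iter_add, E1; exact E2).
  assert (Hper : forall d, (0 < d)%nat -> iter f d y <> y).
  { intros d Hd. apply (no_periodic_point f x y d y (tw_sys HT) Hd). lra. }
  destruct (Req_dec c0 y) as [->|N0].
  - assert (c1 <> y) by (intros ->; exact (Hper d1 ltac:(lia) E1)).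
    assert (c2 <> y) by (intros ->; exact (Hper (d2 + d1)%nat ltac:(lia) E3)).
    apply (no_return_middle d2 c1); [lia|lra|rewrite E2; lra].
  - destruct (Req_dec c1 y) as [->|N1].
    + assert (c2 <> y) by (intros ->; exact (Hper d2 ltac:(lia) E2)).
      apply (no_return_middle (d2 + d1) c0); [lia|lra|rewrite E3; lra].
    + apply (no_return_middle d1 c0); [lia|lra|rewrite E1; lra].
Qed.

Lemma tower_closed_right k t : x < t <= y -> M k t.
Proof.
  intros Ht. destruct (beyond_right k) as (b & Hb & Mb).
  destruct (Rlt_or_le t y); [apply (tower_middle HT); lra|].
  apply (tower_convex HT k m b); [apply (tower_m HT)|exact Mb|unfold m; lra].
Qed.

(** At high levels every return of [(x,y]] lands left of [x]. So visits near [y] that return near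
    [y] lie strictly to its right, and together with the image of [y] they cover a right
    neighbourhood of [y]. *)
Lemma right_chain k eps : 0 < eps -> exists eps' d, 0 < eps' /\ eps' <= / INR (S (S k)) /\
  (0 < d)%nat /\ (d mod 2 ^ k = 0)%nat /\ (forall t, y <= t <= y + eps' -> M (S k) t) /\
  cov f d y (y + eps) y (y + eps').
Proof.
  intros He. destruct eventually_left_returns as [k0 Hk0].
  set (k1 := (k + k0)%nat).
  assert (Hret : forall d t, (0 < d)%nat -> (d mod 2 ^ e k1 = 0)%nat -> x < t <= y -> iter f d t <= x).
  { intros d t Hd Hdm Ht. apply (translate_le HT d d t Hd (Nat.le_refl d)).
    - apply Hk0; [exact Hd|]. destruct (mul_pow2_mod _ _ Hdm) as [q ->].
      apply mul_pow2_mod0, (tower_exp_mono HT). unfold k1. lia.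
    - apply tower_closed_right, Ht. }
  destruct (pos_min eps (y - x)) as (r & Hr & R1 & R2); [lra..|].
  destruct (returns_positions k1 r 0 Hr) as
    (c0 & c1 & c2 & d1 & d2 & M0 & M1 & M2 & E1 & E2 & G1 & G2 & D1 & D2 & A0 & A1 & A2).
  apply Rabs_def2 in A0, A1, A2.
  assert (Hc0 : y < c0).
  { apply Rnot_le_lt. intros Hle. pose proof (Hret d1 c0 G1 D1 ltac:(lra)). lra. }
  assert (Hc1 : y < c1).
  { apply Rnot_le_lt. intros Hle. pose proof (Hret d2 c1 G2 D2 ltac:(lra)). lra. }
  destruct (beyond_right (S k)) as (b & Hb & Mb).
  assert (Hinv : 0 < / INR (S (S k))) by (apply Rinv_0_lt_compat, lt_0_INR; lia).
  destruct (pos_min (b - y) (/ INR (S (S k)))) as (r' & Hr' & R3 & R4); [lra..|].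
  destruct (pos_min (c1 - y) r') as (eps' & Heps' & B1 & B2); [lra..|].
  exists eps', d1. split; [exact Heps'|]. split; [lra|].
  split; [exact G1|]. split; [|split].
  - destruct (mul_pow2_mod _ _ D1) as [q ->].
    apply mul_pow2_mod0. pose proof (tower_exp_ge HT k1). unfold k1 in *. lia.
  - intros t Ht. apply (tower_convex HT (S k) m b);
      [apply (tower_m HT)|exact Mb|unfold m; lra].
  - exists y, c0. rewrite E1. pose proof (Hret d1 y G1 D1 ltac:(lra)). repeat split; lra.
Qed.

Lemma right_chain_follows : exists z n, follows f M z n /\
  (forall k, (n k < n (S k))%nat) /\
  forall k, Rabs (iter f (n k) z - y) <= / INR (S k).
Proof.
  set (A := {p : nat * nat * R | 0 < snd p}).
  assert (exists e0, 0 < e0 /\ e0 <= / INR 1 /\ forall t, y <= t <= y + e0 -> M 0%nat t) as (e0 & He0 & He0' & HM0).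
  { destruct (beyond_right 0) as (b & Hb & Mb). destruct (pos_min (b - y) 1) as (r & Hr & R1 & R2); [lra..|].
    exists r. simpl. rewrite Rinv_1. split; [exact Hr|]. split; [exact R2|]. intros t Ht.
    apply (tower_convex HT 0 m b); [apply (tower_m HT)|exact Mb|unfold m; lra]. }
  set (kk := fun a : A => fst (fst (proj1_sig a))).
  set (nn := fun a : A => snd (fst (proj1_sig a))).
  set (ee := fun a : A => snd (proj1_sig a)).
  destruct (dependent_choice (fun a b : A => kk b = S (kk a) /\ (nn a < nn b)%nat /\
    (nn b mod 2 ^ kk a = nn a mod 2 ^ kk a)%nat /\ ee b <= / INR (S (S (kk a))) /\
    (forall t, y <= t <= y + ee b -> M (S (kk a)) t) /\
    cov f (nn b - nn a) y (y + ee a) y (y + ee b)) (exist _ (0%nat, 0%nat, e0) He0)) as (s & Hs0 & Hs).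
  { intros [[[k n] eps] Heps]. simpl in Heps. destruct (right_chain k eps Heps) as
      (eps' & d & P1 & P2 & P3 & P4 & P5 & P6).
    exists (exist _ (S k, (n + d)%nat, eps') P1). unfold kk, nn, ee. simpl.
    split; [reflexivity|]. split; [lia|]. split; [|split; [exact P2|split; [exact P5|]]].
    - destruct (mul_pow2_mod _ _ P4) as [q ->]. apply mod_pow2_add_mul. lia.
    - replace (n + d - n)%nat with d by lia. exact P6. }
  assert (Hk : forall j, kk (s j) = j).
  { induction j as [|j IH]; [rewrite Hs0; reflexivity|]. destruct (Hs j) as [-> _]. congruence. }
  set (n := fun j => nn (s j)). set (eps := fun j => ee (s j)).
  assert (Hpos : forall j, 0 < eps j) by (intros j; apply (proj2_sig (s j))).
  assert (Hn : forall j, (n j < n (S j))%nat) by (intros j; apply Hs).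
  assert (Hnm : forall j i, (n j <= n (j + i))%nat).
  { intros j i. induction i as [|i IH]; [rewrite Nat.add_0_r; lia|]. rewrite Nat.add_succ_r.
    specialize (Hn (j + i)%nat). lia. }
  assert (Hmod : forall j, (n (S j) mod 2 ^ j = n j mod 2 ^ j)%nat).
  { intros j. destruct (Hs j) as (_ & _ & H & _). rewrite Hk in H. exact H. }
  assert (Heps : forall j, eps j <= / INR (S j)).
  { intros [|j].
    - unfold eps. rewrite Hs0. exact He0'.
    - destruct (Hs j) as (_ & _ & _ & H & _). rewrite Hk in H. exact H. }
  assert (HM : forall j t, y <= t <= y + eps j -> M j t).
  { intros [|j] t Ht.
    - apply HM0. unfold eps in Ht. rewrite Hs0 in Ht. exact Ht.
    - destruct (Hs j) as (_ & _ & _ & _ & H & _). rewrite Hk in H. apply H, Ht. }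
  assert (Hcov : forall j, cov f (n (S j) - n j) y (y + eps j) y (y + eps (S j))) by (intros j; apply Hs).
  assert (Hpull : forall N j, exists w, forall i, (i <= N)%nat ->
    y <= iter f (n (j + i)%nat - n j) w <= y + eps (j + i)%nat).
  { induction N as [|N IH]; intros j.
    - exists y. intros i Hi. replace i with 0%nat by lia. rewrite Nat.add_0_r, Nat.sub_diag.
      specialize (Hpos j). unfold iter; simpl. lra.
    - destruct (IH (S j)) as (w1 & H1).
      pose proof (H1 0%nat ltac:(lia)) as H0. rewrite Nat.add_0_r, Nat.sub_diag in H0.
      destruct (cov_point f _ _ _ _ _ w1 (proj1 Hf) (Hcov j) H0) as (w & Hw & Ew).
      exists w. intros [|i] Hi.
      + rewrite Nat.add_0_r, Nat.sub_diag. exact Hw.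
      + specialize (H1 i ltac:(lia)). rewrite Nat.add_succ_r. simpl Nat.add in H1.
        replace (n (S (j + i)) - n j)%nat with ((n (S (j + i)) - n (S j)) + (n (S j) - n j))%nat.
        * rewrite iter_add, Ew. exact H1.
        * pose proof (Hnm (S j) i) as K. simpl Nat.add in K. specialize (Hn j). lia. }
  assert (Hn0 : n 0%nat = 0%nat) by (unfold n; rewrite Hs0; reflexivity).
  destruct (choice_function _ (fun N => Hpull N 0%nat)) as [zs Hzs'].
  assert (Hzs : forall N i, (i <= N)%nat -> y <= iter f (n i) (zs N) <= y + eps i).
  { intros N i Hi. specialize (Hzs' N i Hi). simpl in Hzs'. rewrite Hn0, Nat.sub_0_r in Hzs'. exact Hzs'. }
  (* Each [zs N] follows the first boxes up to [N]; these are closed, so a cluster point follows all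
     of them. *)
  destruct (climit_exists zs y (y + eps 0%nat)) as (z & Hz & _).
  { intros N. exists N. split; [lia|]. specialize (Hzs N 0%nat ltac:(lia)). rewrite Hn0 in Hzs. exact Hzs. }
  assert (Hbox : forall j, y <= iter f (n j) z <= y + eps j).
  { intros j.
    assert (K : climit (fun N => iter f (n j) (zs N)) (iter f (n j) z)).
    { intros d Hd N. destruct (continuity_eps (iter f (n j)) z d (iter_continuity f _ (proj1 Hf)) Hd)
        as (d' & Hd' & H). destruct (Hz d' Hd' N) as (i & Hi & Hi'). exists i. split; [exact Hi|apply H, Hi']. }
    split; [apply (climit_ge _ _ _ K)|apply (climit_le _ _ _ K)]; exists j; intros N HN; apply Hzs; lia. }
  exists z, n. split; [|split; [exact Hn|]].
  - split.
    + apply (lv_I (tw_level HT 0%nat)), HM. specialize (Hbox 0%nat). rewrite Hn0 in Hbox.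
      exact Hbox.
    + intros k. apply HM, Hbox.
    + exact Hmod.
  - intros k. specialize (Hbox k). specialize (Heps k). rewrite Rabs_right; lra.
Qed.
End Chain.

Lemma nonseparable_of_left f x y M e : tower f x y M e -> returns_left f x y e -> nonseparable f x y.
Proof.
  intros HT HL. pose proof (is_lt (tw_sys HT)) as Hxy.
  destruct (classic (returns_right f x y e)) as [HR|HR].
  - assert (HF : follows f M ((x + y) / 2) (fun _ => 0%nat)).
    { split.
      - apply (lv_I (tw_level HT 0%nat)), (tower_m HT).
      - intros k. apply (tower_m HT).
      - reflexivity. }
    apply (nonseparable_of_follows f x y M e _ _ HT HF HL). intros k.
    destruct (omega_left _ _ _ _ _ (tower_refl HT) _ _ (follows_refl HF) k (1 - y - 1)
      (returns_right_refl _ _ _ _ HR) ltac:(lra)) as (q & Hq & Hq').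
    apply omega_refl_class in Hq'. exists (1 - q). split; [lra|exact Hq'].
  - destruct (right_chain_follows f x y M e HT HR) as (z & n & HF & Hn & Hy).
    apply (nonseparable_of_follows f x y M e z n HT HF HL). intros k. exists y. split; [lra|].
    apply omega_cls_times. intros eps He N.
    destruct (archimed_cor1 eps He) as (j & Hj & Hj0).
    assert (Hge : forall i, (i <= n i)%nat).
    { induction i as [|i IH]; [lia|]. specialize (Hn i). lia. }
    set (i := (N + j + k)%nat). exists (n i).
    split; [specialize (Hge i); unfold i in *; lia|].
    split; [apply (follow_mod f M z n HF); unfold i; lia|].
    eapply Rle_lt_trans; [apply Hy|]. eapply Rle_lt_trans; [|exact Hj].
    apply Rinv_le_contravar; [apply lt_0_INR; exact Hj0|apply le_INR; unfold i; lia].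
Qed.

(** * Independence sets *)

Lemma nonseparable_refl f x y : nonseparable (refl f) (1 - y) (1 - x) -> nonseparable f x y.
Proof.
  intros (Hne & z & Hz & Hinf & ik & [Hb Hnest] & HJ).
  assert (Ez : z = 1 - (1 - z)) by lra.
  assert (O1 : forall q i a, omega (iter (refl f) q) (iter (refl f) i z) a ->
    omega (iter f q) (iter f i (1 - z)) (1 - a)).
  { intros q i a H. rewrite Ez in H. apply omega_refl_class, H. }
  assert (O2 : forall q i a, omega (iter f q) (iter f i (1 - z)) a ->
    omega (iter (refl f) q) (iter (refl f) i z) (1 - a)).
  { intros q i a H. rewrite Ez. apply omega_class_refl, H. }
  assert (JE : forall k i t, Jint f (1 - z) k i t <-> Jint (refl f) z k i (1 - t)).
  { intros k i t. split; intros (a & b & Ha & Hb' & H).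
    - exists (1 - b), (1 - a). split; [apply O2, Hb'|]. split; [apply O2, Ha|lra].
    - exists (1 - b), (1 - a). split; [apply O1, Hb'|]. split; [apply O1, Ha|lra]. }
  split; [lra|]. exists (1 - z). split; [unfold inI in *; lra|]. split.
  - intros l. destruct (Hinf (map (fun t => 1 - t) l)) as (a & Ha & Hl). exists (1 - a). split.
    + exact (O1 1%nat 0%nat a Ha).
    + intros Hin. apply Hl, in_map_iff. exists (1 - a). split; [lra|exact Hin].
  - exists ik. split; [split; [exact Hb|]|].
    + intros k Hk t. rewrite !JE. apply Hnest, Hk.
    + destruct HJ as [HJ|HJ]; [left|right]; intros t; specialize (HJ (1 - t));
        (split; [intros H; assert (K : forall k, (k >= 1)%nat -> Jint (refl f) z k (ik k) (1 - t))
                   by (intros k Hk; apply JE, H, Hk); apply HJ in K; lra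
                |intros H k Hk; apply JE; revert k Hk; apply HJ; lra]).
Qed.

Theorem indep_system_nonseparable f x y : indep_system f x y -> nonseparable f x y.
Proof.
  intros HS. destruct (level_sequence f x y HS) as (M & e & H1 & H2 & H3).
  assert (HT : tower f x y M e) by (split; assumption).
  destruct (classic (returns_left f x y e)) as [HL|HL]; [exact (nonseparable_of_left f x y M e HT HL)|].
  apply nonseparable_refl, (nonseparable_of_left _ _ _ _ e (tower_refl HT)).
  apply returns_right_refl. intros k.
  apply not_all_ex_not in HL. destruct HL as [k0 HL].
  pose proof (is_lt HS) as Hxy.
  (* A common return time for levels [k] and [k0]. At level [k0] no return is on the left, and none
     is inside [(x,y)]. *)
  set (d := (2 ^ e (k + k0))%nat). assert (Hd : (0 < d)%nat) by apply pow2_pos.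
  assert (Hmod : forall j, (j <= k + k0)%nat -> (d mod 2 ^ e j = 0)%nat).
  { intros j Hj. unfold d. rewrite <- (Nat.mul_1_r (2 ^ e (k + k0)%nat)).
    apply mul_pow2_mod0, (tower_exp_mono HT), Hj. }
  exists d. split; [exact Hd|]. split; [apply Hmod; lia|].
  apply Rnot_lt_le. intros Hlt.
  destruct (Rle_or_lt (iter f d ((x + y) / 2)) x) as [Hle|Hgt].
  - apply HL. exists d. split; [exact Hd|]. split; [apply Hmod; lia|exact Hle].
  - apply (tower_no_return HT d d ((x + y) / 2) Hd (Nat.le_refl d));
      apply (tower_middle HT); lra.
Qed.

(** * Extension to the line, and translation of independence sets *)

Definition clamp (t : R) : R := Rmax 0 (Rmin 1 t).

Lemma clamp_inI t : inI (clamp t).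
Proof. unfold inI, clamp, Rmax, Rmin. destruct (Rle_dec 1 t); destruct Rle_dec; lra. Qed.

Lemma clamp_id t : inI t -> clamp t = t.
Proof. unfold inI, clamp, Rmax, Rmin. intros H. destruct (Rle_dec 1 t); destruct Rle_dec; lra. Qed.

Lemma clamp_lipschitz s t : Rabs (clamp s - clamp t) <= Rabs (s - t).
Proof.
  unfold clamp, Rmax, Rmin. destruct (Rle_dec 1 s), (Rle_dec 1 t); repeat destruct Rle_dec;
  unfold Rabs; repeat destruct Rcase_abs; lra.
Qed.

Definition extend (f : R -> R) (t : R) : R := f (clamp t).

Lemma extend_continuity f : CII f -> continuity (extend f).
Proof.
  intros [_ Hc] t eps He. destruct (Hc (clamp t) (clamp_inI t) eps He) as (d & Hd & H).
  exists d. split; [exact Hd|]. intros u [_ Hu]. apply H; [apply clamp_inI|].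
  eapply Rle_lt_trans; [apply clamp_lipschitz|exact Hu].
Qed.

Lemma extend_inI f t : CII f -> inI (extend f t).
Proof. intros [Hm _]. apply Hm, clamp_inI. Qed.

Lemma iter_inI f n w : CII f -> inI w -> inI (iter f n w).
Proof. intros [Hm _] Hw. induction n as [|n IH]; [exact Hw|]. rewrite iter_S. apply Hm, IH. Qed.

Lemma iter_extend f n w : CII f -> inI w -> iter (extend f) n w = iter f n w.
Proof.
  intros Hf Hw. induction n as [|n IH]; [reflexivity|]. rewrite !iter_S, IH. unfold extend.
  rewrite clamp_id; [reflexivity|]. apply iter_inI; assumption.
Qed.

Lemma extend_tame f : CII f -> zero_entropy f -> tame (extend f).
Proof.
  intros Hf HZ. split; [apply extend_continuity, Hf|]. split; [intros t; apply extend_inI, Hf|].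
  apply zero_entropy_no_horseshoe; [apply extend_continuity, Hf|intros t; apply extend_inI, Hf|].
  intros eps delta He Hd. destruct (HZ eps delta He Hd) as [N HN]. exists N. intros n E Hn (H1 & H2 & H3).
  apply (HN n E Hn). split; [exact H1|]. split; [exact H2|]. intros p q Hp Hq Hpq.
  destruct (H3 p q Hp Hq Hpq) as (j & Hj & Hj'). exists j. split; [exact Hj|].
  rewrite !iter_extend in Hj' by auto. exact Hj'.
Qed.

Lemma nonseparable_ext f g x y : (forall n w, inI w -> iter f n w = iter g n w) ->
  nonseparable f x y -> nonseparable g x y.
Proof.
  intros E (Hne & z & Hz & Hinf & ik & [Hb Hnest] & HJ).
  assert (O : forall q i a, omega (iter f q) (iter f i z) a <-> omega (iter g q) (iter g i z) a).
  { intros q i a. rewrite !omega_class. split; intros H eps He N; destruct (H eps He N) as (n & Hn & Hn');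
      exists n; (split; [exact Hn|]); [rewrite <- E by exact Hz|rewrite E by exact Hz]; exact Hn'. }
  assert (JE : forall k i t, Jint f z k i t <-> Jint g z k i t).
  { intros k i t. split; intros (a & b & Ha & Hb' & H); exists a, b;
      (split; [apply O, Ha|split; [apply O, Hb'|exact H]]). }
  split; [exact Hne|]. exists z. split; [exact Hz|]. split.
  - intros l. destruct (Hinf l) as (a & Ha & Hl). exists a. split; [|exact Hl].
    exact (proj1 (O 1%nat 0%nat a) Ha).
  - exists ik. split; [split; [exact Hb|intros k Hk t; rewrite <- !JE; apply Hnest, Hk]|].
    destruct HJ as [HJ|HJ]; [left|right]; intros t; rewrite <- HJ;
      (split; intros H k Hk; [apply JE|apply JE]; apply H, Hk).
Qed.

Lemma shadows_IT_pair f x y : CII f -> shadows (extend f) x y -> IT_pair f x y.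
Proof.
  intros Hf HS U1 U2 (e1 & He1 & HU1) (e2 & He2 & HU2).
  destruct (pos_min e1 e2 He1 He2) as (e & He & E1 & E2).
  destruct (HS e He) as (t & Ht & H).
  assert (Hinc : forall i j, (i < j)%nat -> (t i < t j)%nat).
  { intros i j Hij. induction Hij as [|j Hij IH]; [apply Ht|]. specialize (Ht j). lia. }
  assert (Hge : forall j, (j <= t j)%nat).
  { induction j as [|j IH]; [lia|]. specialize (Ht j). lia. }
  (* All times are counted from [t 1], which is positive, so that the starting point is an image and
     lies in [I]. *)
  exists (fun i => exists j, i = (t (S j) - t 1)%nat). split.
  { intros N. exists (t (S (N + t 1)) - t 1)%nat. split; [|eauto]. specialize (Hge (S (N + t 1%nat))). lia. }
  intros F s _ HF.
  assert (exists N, forall i, In i F -> exists j, (S j < N)%nat /\ i = (t (S j) - t 1)%nat) as [N HN].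
  { clear - HF. induction F as [|i F IH]; [exists 0%nat; intros i []|].
    destruct IH as [N HN]; [intros j Hj; apply HF; right; exact Hj|].
    destruct (HF i (or_introl eq_refl)) as [j Hj]. exists (N + S (S j))%nat. intros k [<-|Hk].
    - exists j. split; [lia|exact Hj].
    - destruct (HN k Hk) as (l & Hl & Hl'). exists l. split; [lia|exact Hl']. }
  destruct (H N (fun j => s (t j - t 1)%nat)) as [w Hw].
  assert (HI : inI (iter (extend f) (t 1%nat) w)).
  { pose proof (Hge 1%nat). destruct (t 1%nat) as [|k]; [lia|]. rewrite iter_S. apply extend_inI, Hf. }
  exists (iter (extend f) (t 1%nat) w). split; [exact HI|]. intros i Hi.
  destruct (HN i Hi) as (j & Hj & ->). specialize (Hw (S j) Hj).
  assert (Hle : (t 1 <= t (S j))%nat) by (destruct j; [lia|specialize (Hinc 1%nat (S (S j)) ltac:(lia)); lia]).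
  assert (HI' : inI (iter f (t (S j) - t 1%nat) (iter (extend f) (t 1%nat) w))) by (apply iter_inI; assumption).
  rewrite (iter_later (extend f) t 1 (S j) w Hle), iter_extend in Hw by assumption.
  destruct (s (t (S j) - t 1)%nat); [apply HU1|apply HU2]; auto; lra.
Qed.

Lemma IT_pair_IN_pair f x y : IT_pair f x y -> IN_pair f x y.
Proof.
  intros H U1 U2 H1 H2 m. destruct (H U1 U2 H1 H2) as (J & HJ & Hind).
  assert (exists l B, NoDup l /\ length l = m /\ forall i, In i l -> J i /\ (i < B)%nat) as (l & B0 & Hnd & Hl & Hin).
  { induction m as [|m (l & B & Hnd & Hl & Hin)]; [exists [], 0%nat; repeat split; [constructor|contradiction..]|].
    destruct (HJ B) as (n & Hn & Jn). exists (n :: l), (S n). split; [|split].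
    - constructor; [|exact Hnd]. intros K. apply Hin in K. lia.
    - simpl. congruence.
    - intros i [<-|Hi]; [auto|]. destruct (Hin i Hi). split; [assumption|lia]. }
  exists l. split; [exact Hnd|]. split; [lia|]. intros F s HF HFl. apply Hind; [exact HF|].
  intros i Hi. apply Hin, HFl, Hi.
Qed.

Lemma list_least (l : list nat) : l <> [] -> exists n, In n l /\ forall i, In i l -> (n <= i)%nat.
Proof.
  induction l as [|a l IH]; [contradiction|]. intros _. destruct l as [|b l].
  - exists a. split; [left; reflexivity|]. intros i [<-|[]]. lia.
  - destruct IH as (n & Hn & Hmin); [discriminate|]. destruct (Nat.le_gt_cases a n).
    + exists a. split; [left; reflexivity|]. intros i [<-|Hi]; [lia|]. specialize (Hmin i Hi). lia.
    + exists n. split; [right; exact Hn|]. intros i [<-|Hi]; [lia|]. auto.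
Qed.

Lemma residue_class (c : nat -> nat) m q (l : list nat) : (forall i, In i l -> (c i < q)%nat) ->
  (length l >= m * q)%nat -> (0 < q)%nat -> exists r, (length (filter (fun i => c i =? r) l) >= m)%nat.
Proof.
  revert l. induction q as [|q IH]; intros l Hc Hl Hq; [lia|].
  destruct (Nat.le_gt_cases m (length (filter (fun i => c i =? q)%nat l))) as [Hm|Hm]; [exists q; exact Hm|].
  destruct (Nat.eq_dec q 0) as [->|Hq0].
  - exists 0%nat. rewrite forallb_filter_id; [lia|]. apply forallb_forall. intros i Hi.
    specialize (Hc i Hi). apply Nat.eqb_eq. lia.
  - destruct (IH (filter (fun i => negb (c i =? q)%nat) l)) as [r Hr].
    + intros i Hi. apply filter_In in Hi. destruct Hi as [Hi Hne]. specialize (Hc i Hi).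
      apply Bool.negb_true_iff, Nat.eqb_neq in Hne. lia.
    + pose proof (filter_length (fun i => c i =? q)%nat l). lia.
    + lia.
    + exists r. eapply Nat.le_trans; [exact Hr|]. clear. induction l as [|a l IH]; [simpl; lia|].
      simpl. destruct (c a =? q)%nat eqn:E1; simpl; destruct (c a =? r)%nat; simpl; lia.
Qed.

(** Greedy choice: take the least element and discard what lies within [H] of it, which is at most
    [H] elements. *)
Lemma spread_out H m (l : list nat) B : NoDup l -> (length l >= m * H)%nat -> (0 < H)%nat ->
  (forall i, In i l -> (B <= i)%nat) ->
  exists T : nat -> nat, (B <= T 0)%nat /\ (forall j, (T j + H <= T (S j))%nat) /\
    forall j, (j < m)%nat -> In (T j) l.
Proof.
  intros Hnd Hl HH. revert l B Hnd Hl. induction m as [|m IH]; intros l B Hnd Hl HB.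
  - exists (fun j => (B + j * H)%nat). split; [lia|]. split; [intros j; lia|]. intros j Hj. lia.
  - destruct (list_least l) as (n0 & Hn0 & Hmin); [intros ->; simpl in Hl; lia|].
    destruct (IH (filter (fun i => n0 + H <=? i)%nat l) (n0 + H)%nat) as (T & HT0 & HT & HTl).
    + apply NoDup_filter, Hnd.
    + assert (length (filter (fun i => negb (n0 + H <=? i)%nat) l) <= H)%nat.
      { apply Nat.le_trans with (length (seq n0 H)); [|rewrite length_seq; lia].
        apply NoDup_incl_length; [apply NoDup_filter, Hnd|].
        intros i Hi. apply filter_In in Hi. destruct Hi as [Hi Hlt].
        apply Bool.negb_true_iff, Nat.leb_gt in Hlt. apply in_seq. specialize (Hmin i Hi). lia. }
      pose proof (filter_length (fun i => n0 + H <=? i)%nat l). lia.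
    + intros i Hi. apply filter_In in Hi. destruct Hi as [_ Hi]. apply Nat.leb_le in Hi. exact Hi.
    + exists (fun j => match j with O => n0 | S j => T j end). split; [apply HB, Hn0|]. split.
      * intros [|j]; [exact HT0|apply HT].
      * intros [|j] Hj; [exact Hn0|]. specialize (HTl j ltac:(lia)). apply filter_In in HTl. apply HTl.
Qed.

Lemma IN_pair_indep f x y q : CII f -> (0 < q)%nat -> IN_pair f x y -> indep inI (iter (extend f) q) x y.
Proof.
  intros Hf Hq HIN eps m G He.
  (* Gaps of [q * (G + 1)] exceed [G] after division by [q]. Of [m * H * q] times, one residue class
     modulo [q] keeps [m * H], and spacing them by [H] keeps [m]. *)
  set (H := (q * (G + 1))%nat).
  destruct (HIN (fun t => Rabs (t - x) < eps) (fun t => Rabs (t - y) < eps)) with (m := (m * H * q)%nat)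
    as (l & Hnd & Hl & Hind).
  { exists eps. split; [exact He|]. auto. }
  { exists eps. split; [exact He|]. auto. }
  destruct (residue_class (fun i => i mod q)%nat (m * H) q l) as [r Hr]; [|exact Hl|exact Hq|].
  { intros i _. apply Nat.mod_upper_bound. lia. }
  destruct (spread_out H m (filter (fun i => i mod q =? r)%nat l) 0) as (T & _ & HT & HTl);
    [apply NoDup_filter, Hnd|exact Hr|unfold H; nia|intros; lia|].
  assert (HT0 : forall j, (T 0 <= T j)%nat).
  { induction j as [|j IH]; [lia|]. specialize (HT j). lia. }
  exists (fun j => ((T j - T 0) / q)%nat). split.
  { intros j. assert ((T j - T 0) / q + (G + 1) <= (T (S j) - T 0) / q)%nat; [|lia].
    apply Nat.div_le_lower_bound; [lia|]. pose proof (Nat.Div0.mul_div_le (T j - T 0%nat) q).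
    specialize (HT j). specialize (HT0 j). unfold H in HT. nia. }
  intros s.
  assert (Hin : forall j, (j < m)%nat -> In (T j) l /\ (T j mod q = r)%nat).
  { intros j Hj. specialize (HTl j Hj). apply filter_In in HTl. destruct HTl as [H1 H2].
    apply Nat.eqb_eq in H2. auto. }
  destruct m as [|m]; [exists 0; split; [unfold inI; lra|intros; lia]|].
  assert (Hinj : forall i j, T i = T j -> i = j).
  { assert (K : forall i j, (i < j)%nat -> (T i < T j)%nat).
    { intros i j Hij. induction Hij as [|j Hij IH].
      - specialize (HT i). unfold H in HT. nia.
      - specialize (HT j). unfold H in HT. nia. }
    intros i j E. destruct (Nat.lt_trichotomy i j) as [L|[L|L]]; [|exact L|];
      apply K in L; lia. }
  (* The pattern is moved from indices to times, which is consistent because [T] is injective; other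
     times get the value [false]. *)
  set (sg := fun i => if excluded_middle_informative (exists j, T j = i /\ s j = true) then true else false).
  assert (Hsg : forall j, sg (T j) = s j).
  { intros j. unfold sg. destruct excluded_middle_informative as [(j' & E & Ej)|Hno].
    - apply Hinj in E. congruence.
    - destruct (s j) eqn:E; [exfalso; apply Hno; eauto|reflexivity]. }
  destruct (Hind (map T (seq 0 (S m))) sg) as (w & Hw & Hpos).
  { discriminate. }
  { intros i Hi. apply in_map_iff in Hi. destruct Hi as (j & <- & Hj). apply in_seq in Hj. apply Hin. lia. }
  exists (iter f (T 0%nat) w). split; [apply iter_inI; assumption|]. intros j Hj.
  assert (Ed : (T j - T 0 = q * ((T j - T 0) / q))%nat).
  { destruct (Hin j Hj) as [_ E1]. destruct (Hin 0%nat ltac:(lia)) as [_ E2]. specialize (HT0 j).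
    pose proof (Nat.div_mod_eq (T j) q). pose proof (Nat.div_mod_eq (T 0%nat) q).
    assert (E : (T j - T 0 = (T j / q - T 0 / q) * q)%nat).
    { rewrite Nat.mul_sub_distr_r. nia. }
    rewrite E at 2. rewrite Nat.div_mul by lia. lia. }
  rewrite iter_mul, <- Ed, iter_extend, <- iter_later by (auto using iter_inI).
  specialize (Hpos (T j)). rewrite Hsg in Hpos.
  assert (K : In (T j) (map T (seq 0 (S m)))).
  { apply in_map_iff. exists j. split; [reflexivity|]. apply in_seq. lia. }
  specialize (Hpos K). destruct (s j); exact Hpos.
Qed.

Theorem mainTheorem15 (f : R -> R) (x y : R) :
  CII f -> zero_entropy f -> inI x -> inI y -> x < y ->
  (nonseparable f x y <-> IT_pair f x y) /\ (IT_pair f x y <-> IN_pair f x y).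
Proof.
  intros Hf HZ Hx Hy Hxy.
  assert (HT : tame (extend f)) by (apply extend_tame; assumption).
  assert (H12 : nonseparable f x y -> IT_pair f x y).
  { intros H. apply shadows_IT_pair; [exact Hf|]. apply nonseparable_shadows; [exact HT|exact Hxy|].
    apply (nonseparable_ext f); [|exact H]. intros n w Hw. symmetry. apply iter_extend; assumption. }
  assert (H23 : IT_pair f x y -> IN_pair f x y) by apply IT_pair_IN_pair.
  assert (H31 : IN_pair f x y -> nonseparable f x y).
  { intros H. apply (nonseparable_ext (extend f)).
    - intros n w Hw. apply iter_extend; assumption.
    - apply indep_system_nonseparable. split; auto. intros q Hq. apply IN_pair_indep; assumption. }
  tauto.
Qed.
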